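(* Let $\epsilon\in(0,1]$. There is a constant $b=b(\epsilon)\ge1$ depending only on $\epsilon$ such that the following holds with $k^*=k^*(b)$. For each $n\in\mathbb N$ consider the linear model $Y=X\beta^*+\mathcal E$ with dependent Gaussian design and minimum-norm interpolator $\hat\beta$ described in the context (where $p=p_n$, $\Sigma=\Sigma_n$, $\beta^*=\beta^*_n$ may depend on $n$), with $\lambda_{n+1}>0$ and with the coherence assumption holding with this $\epsilon$ for every $n$. Suppose that $\Sigma$ is a benign covariance and that $\|\beta^*\|=O(1)$ as $n\to\infty$. Then $$R(\hat\beta)=O_P(\tau_n+\nu_n\eta_n)\quad\text{as } n\to\infty,$$ where $\nu_n=\|\Xi_{0,n}^{-1}\Upsilon_n\|$.
   Context: Design (for each $n$). $\Sigma\in\mathbb R^{p\times p}$ is positive definite, $\Sigma=U\Lambda U^\top$ with $U=[e_1,\dots,e_p]$ orthogonal and $\Lambda=\mathrm{diag}\{\lambda_1,\dots,\lambda_p\}$, $\lambda_1\ge\dots\ge\lambda_p>0$; put $\lambda_j=0$ for $j>p$ (so $\lambda_{n+1}>0$ means $p\ge n+1$). $\Xi_{1,n},\dots,\Xi_{p,n}\in\mathbb R^{n\times n}$ are positive definite, $z_1,\dots,z_p$ are i.i.d. $N(\mathbf 0,I_n)$, and $X=[\Xi_{1,n}^{1/2}z_1,\dots,\Xi_{p,n}^{1/2}z_p]\Lambda^{1/2}U^\top\in\mathbb R^{n\times p}$. Model. $Y=X\beta^*+\mathcal E$ with $\beta^*\in\mathbb R^p$ deterministic, $\mathcal E\sim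 N(\mathbf 0,\Upsilon_n)$ independent of $X$, $\Upsilon_n$ positive definite. $\hat\beta=X^\top(XX^\top)^{-1}Y$ is the minimum-Euclidean-norm solution of $X\beta=Y$. Risk. $R(\hat\beta)=\mathbb E^*[(y^*-\langle\hat\beta,x^*\rangle)^2-(y^*-\langle\beta^*,x^*\rangle)^2]$, where $x^*\sim N(\mathbf 0,\Sigma)$, $y^*=\langle\beta^*,x^*\rangle+\varepsilon^*$, $\varepsilon^*\sim N(0,\sigma_\varepsilon^2)$ with $\sigma_\varepsilon>0$ arbitrary, $(x^*,\varepsilon^* )$ are independent of each other and of the data, and $\mathbb E^*$ is the expectation over $(x^*,y^* )$ only. Coherence assumption (with $\epsilon$). There are positive definite reference matrices $\Xi_{0,n}\in\mathbb R^{n\times n}$ with $\epsilon\le\mu_n(\Xi_{0,n}^{-1}\Xi_{i,n})\le\mu_1(\Xi_{0,n}^{-1}\Xi_{i,n})\le1/\epsilon$ for all $n$ and all $i=1,\dots,p$, where $\mu_i(\cdot)$ is the $i$-th largest eigenvalue. Notation. $\|\cdot\|$ is the Euclidean norm for vectors and the operator norm for matrices; $\|\beta\|_M^2=\beta^\top M\beta$. $\Sigma_{k:\infty}=\sum_{i=k+1}^p\lambda_ie_ie_i^\top$, $\Sigma_{0:k}^\dagger=\sum_{i=1}^k\lambda_i^{-1}e_ie_i^\top$. For $0\le k<p$: $r_k(\Sigma)=\sum_{i>k}\lambda_i/\lambda_{k+1}$, $R_k(\Sigma)=(\sum_{i>k}\lambda_i)^2/\sum_{i>k}\lambda_i^2$.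 $k^*(b)=\min\{k\ge0:r_k(\Sigma)\ge bn\}$, and $\infty$ if the set is empty. Benign covariance. With $k^*=k^*(b)$, put $$\tau_n=\|\beta_n^*\|^2_{\Sigma_{k^*:\infty}}+\|\beta_n^*\|^2_{\Sigma_{0:k^*}^\dagger}\Big(\frac{\sum_{i>k^*}\lambda_i}{n}\Big)^2,\qquad \eta_n=\max\Big\{\frac{k^*}{n},\frac{n}{R_{k^*}(\Sigma)}\Big\}.$$ $\Sigma=\Sigma_n$ is benign if for all sequences $\beta_n^*\in\mathbb R^{p_n}$ with $\sup_n\|\beta_n^*\|<\infty$, $\tau_n\to0$ and $\eta_n\to0$. In the conclusion, $\tau_n$ is evaluated at the true parameter $\beta^*=\beta_n^*$. *)

(* Defs.v *)
(* MathComp-Analysis *)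
From HB Require Import structures.
From mathcomp Require Import all_boot all_order all_algebra.
From mathcomp Require Import all_classical all_reals all_analysis.

Set Implicit Arguments.
Unset Strict Implicit.
Unset Printing Implicit Defensive.

Import Order.TTheory GRing.Theory Num.Theory.
Import numFieldNormedType.Exports.

Local Open Scope classical_set_scope.
Local Open Scope ring_scope.

Section LinearAlgebra.
Context {R : realType}.

Definition dotcv n (u v : 'cV[R]_n) : R := (u^T *m v) 0 0.

Definition l2norm n (v : 'cV[R]_n) : R := Num.sqrt (\sum_i v i 0 ^+ 2).

Definition opnorm m n (A : 'M[R]_(m, n)) : R :=
  sup [set l2norm (A *m v) | v in [set v | l2norm v <= 1]].

(* ||v||_M^2 *)
Definition sqnorm_mx n (M : 'M[R]_n) (v : 'cV[R]_n) : R := (v^T *m M *m v) 0 0.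

Definition posdefmx n (A : 'M[R]_n) : Prop :=
  A^T = A /\ forall v : 'cV[R]_n, v != 0 -> 0 < sqnorm_mx A v.

(* B = A^{1/2}; for positive definite A such a B exists and is unique. *)
Definition is_sqrtmx n (A B : 'M[R]_n) : Prop := posdefmx B /\ B *m B = A.

(* The eigenvalues of A in nonincreasing order, with multiplicity; this is the
   empty sequence if the characteristic polynomial does not split over R. *)
Definition eigenseq n (A : 'M[R]_n) : seq R :=
  xget [::] [set s : seq R | sorted >=%R s /\
                             char_poly A = \prod_(x <- s) ('X - x%:P)].

(* The i-th largest eigenvalue, counted from i = 1. *)
Definition mu n (i : nat) (A : 'M[R]_n) : R := (eigenseq A)`_i.-1.

End LinearAlgebra.

(* The eigenvalues lambda_1 >= lambda_2 >= ... are stored in a row vector with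
   0-based indices: lam 0 i is lambda_{i+1}, so "i > k" becomes "k <= i". *)
Section Spectrum.
Context {R : realType} {p : nat}.
Implicit Types (U : 'M[R]_p) (lam : 'rV[R]_p).

(* lambda_{j+1}, extended by 0 *)
Definition eigv lam (j : nat) : R := if insub j is Some i then lam 0 i else 0.

Definition is_spectral_decomp (Sigma U : 'M[R]_p) lam : Prop :=
  [/\ U^T *m U = 1%:M,
      forall i j : 'I_p, (i <= j)%N -> lam 0 j <= lam 0 i,
      forall i, 0 < lam 0 i
    & Sigma = U *m diag_mx lam *m U^T].

Definition tail_sum lam (k : nat) : R := \sum_(i < p | (k <= i)%N) lam 0 i.

Definition r_eff lam (k : nat) : R := tail_sum lam k / eigv lam k.

Definition R_eff lam (k : nat) : R :=
  tail_sum lam k ^+ 2 / \sum_(i < p | (k <= i)%N) lam 0 i ^+ 2.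

(* Sigma_{k:oo} *)
Definition Sigma_tail U lam (k : nat) : 'M[R]_p :=
  \sum_(i < p | (k <= i)%N) lam 0 i *: (col i U *m (col i U)^T).

(* The pseudo-inverse of Sigma_{0:k} *)
Definition Sigma_head_pinv U lam (k : nat) : 'M[R]_p :=
  \sum_(i < p | (i < k)%N) (lam 0 i)^-1 *: (col i U *m (col i U)^T).

(* k^*(b); None stands for infinity. *)
Definition kstar (n : nat) (b : R) lam : option nat :=
  ohead [seq k <- iota 0 p | b * n%:R <= r_eff lam k].

(* If k^* is infinite then k^*/n is infinite, so eta is +oo; the value of tau
   has no influence on the notions below in that case. *)
Definition tau (n : nat) (b : R) U lam (beta : 'cV[R]_p) : \bar R :=
  if kstar n b lam is Some k then
    (sqnorm_mx (Sigma_tail U lam k) beta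
     + sqnorm_mx (Sigma_head_pinv U lam k) beta
       * (tail_sum lam k / n%:R) ^+ 2)%:E
  else +oo%E.

Definition eta (n : nat) (b : R) lam : \bar R :=
  if kstar n b lam is Some k then
    (Num.max (k%:R / n%:R) (n%:R / R_eff lam k))%:E
  else +oo%E.

End Spectrum.

Definition benign (R : realType) (b : R) (p : nat -> nat)
    (U : forall n, 'M[R]_(p n)) (lam : forall n, 'rV[R]_(p n)) : Prop :=
  forall beta : forall n, 'cV[R]_(p n),
    (exists C : R, forall n, l2norm (beta n) <= C) ->
    (tau n b (U n) (lam n) (beta n) @[n --> \oo] --> 0%E) /\
    (eta n b (lam n) @[n --> \oo] --> 0%E).

(* The reference matrix Xi0 and the covariances Xi satisfy the coherence
   assumption at sample size n. *)
Definition coherent (R : realType) (eps : R) (n p : nat) (Xi0 : 'M[R]_n)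
    (Xi : 'I_p -> 'M[R]_n) : Prop :=
  posdefmx Xi0 /\
  forall i, [/\ eps <= mu n (invmx Xi0 *m Xi i),
                mu n (invmx Xi0 *m Xi i) <= mu 1 (invmx Xi0 *m Xi i)
              & mu 1 (invmx Xi0 *m Xi i) <= 1 / eps].

Section Probability.
Context {R : realType} {d : measure_display} {T : measurableType d}
  (P : probability T R).

(* The sigma-algebra generated by a family of real functions. *)
Definition sigma_fam (I : Type) (f : I -> T -> R) : set_system T :=
  <<s \bigcup_i preimage_set_system setT (f i) measurable >>.

Definition sigma_mx m n (X : T -> 'M[R]_(m, n)) : set_system T :=
  sigma_fam (fun (ij : 'I_m * 'I_n) t => X t ij.1 ij.2).

Definition sigma_rv (X : T -> R) : set_system T := sigma_fam (fun _ : unit => X).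

Definition indep2 (F G : set_system T) : Prop :=
  forall A B, F A -> G B -> P (A `&` B) = (P A * P B)%E.

(* The members F i all contain the whole space, so the product rule for the
   full index set implies it for every subset. *)
Definition mutual_indep (I : finType) (F : I -> set_system T) : Prop :=
  forall A : I -> set T, (forall i, F i (A i)) ->
    P (\bigcap_i A i) = (\prod_i P (A i))%E.

Definition normal_rv (X : T -> R) (m s : R) : Prop :=
  measurable_fun setT X /\
  forall B, measurable B -> P (X @^-1` B) = normal_prob m s B.

(* Z ~ N(0, I_n) *)
Definition std_normal_vec n (Z : T -> 'cV[R]_n) : Prop :=
  (forall i, normal_rv (fun t => Z t i 0) 0 1) /\
  mutual_indep (fun i => sigma_rv (fun t => Z t i 0)).

(* V ~ N(0, S), for positive definite S: then every A with A A^T = S is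
   invertible, so Z = A^-1 V lives on the same space as V. *)
Definition normal_vec n (V : T -> 'cV[R]_n) (S : 'M[R]_n) : Prop :=
  exists (A : 'M[R]_n) (Z : T -> 'cV[R]_n),
    [/\ A *m A^T = S, std_normal_vec Z & forall t, V t = A *m Z t].

End Probability.

(* X = [Xi_1^{1/2} z_1, ..., Xi_p^{1/2} z_p] Lambda^{1/2} U^T *)
Definition design_mx (R : realType) (n p : nat) (Xih : 'I_p -> 'M[R]_n)
    (z : 'I_p -> 'cV[R]_n) (lam : 'rV[R]_p) (U : 'M[R]_p) : 'M[R]_(n, p) :=
  (\matrix_(i, j) (Xih j *m z j) i 0) *m diag_mx (map_mx Num.sqrt lam) *m U^T.

Record linear_model (R : realType) (n p : nat) := LinearModel {
  lm_disp : measure_display;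
  lm_T : measurableType lm_disp;
  lm_P : probability lm_T R;

  lm_Sigma : 'M[R]_p;
  lm_U : 'M[R]_p;
  lm_lam : 'rV[R]_p;
  lm_SigmaP : posdefmx lm_Sigma;
  lm_spectralP : is_spectral_decomp lm_Sigma lm_U lm_lam;

  lm_Xi : 'I_p -> 'M[R]_n;
  lm_XiP : forall i, posdefmx (lm_Xi i);
  lm_Xih : 'I_p -> 'M[R]_n;
  lm_XihP : forall i, is_sqrtmx (lm_Xi i) (lm_Xih i);

  lm_z : 'I_p -> lm_T -> 'cV[R]_n;
  lm_z_normal : forall i, std_normal_vec lm_P (lm_z i);
  lm_z_indep : mutual_indep lm_P (fun i => sigma_mx (lm_z i));
  lm_X := fun t => design_mx lm_Xih (lm_z ^~ t) lm_lam lm_U;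

  lm_beta : 'cV[R]_p;
  lm_Upsilon : 'M[R]_n;
  lm_UpsilonP : posdefmx lm_Upsilon;
  lm_E : lm_T -> 'cV[R]_n;
  lm_E_normal : normal_vec lm_P lm_E lm_Upsilon;
  lm_E_indep : indep2 lm_P (sigma_mx lm_E) (sigma_mx lm_X);
  lm_Y := fun t => lm_X t *m lm_beta + lm_E t;

  (* the test point x^* and its noise *)
  lm_xs : lm_T -> 'cV[R]_p;
  lm_xs_normal : normal_vec lm_P lm_xs lm_Sigma;
  lm_sigma_eps : R;
  lm_sigma_eps_gt0 : 0 < lm_sigma_eps;
  lm_eps : lm_T -> R;
  lm_eps_normal : normal_rv lm_P lm_eps 0 lm_sigma_eps;
  lm_xs_eps_indep : indep2 lm_P (sigma_mx lm_xs) (sigma_rv lm_eps);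
  lm_test_indep : indep2 lm_P
    (sigma_mx (fun t => col_mx (lm_xs t) (lm_eps t)%:M))
    (sigma_mx (fun t => row_mx (lm_X t) (lm_Y t)))
}.

Section Estimation.
Context {R : realType} {n p : nat} (M : linear_model R n p).

(* X X^T is almost surely invertible when n <= p. *)
Definition beta_hat (t : lm_T M) : 'cV[R]_p :=
  let X := lm_X t in X^T *m invmx (X *m X^T) *m lm_Y t.

Definition ystar (t : lm_T M) : R := dotcv (lm_beta M) (lm_xs t) + lm_eps t.

(* The argument b is a fixed vector.  As the test pair is independent of the
   data, integrating over x^* and y^* only, with the data held fixed at an
   outcome t, amounts to evaluating this function at b = beta_hat t. *)
Definition risk (b : 'cV[R]_p) : \bar R :=
  'E_(lm_P M)[fun t => (ystar t - dotcv b (lm_xs t)) ^+ 2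
                       - (ystar t - dotcv (lm_beta M) (lm_xs t)) ^+ 2].

End Estimation.

(* W_n = O_P(a_n) *)
Definition bigO_P (R : realType) (d : nat -> measure_display)
    (T : forall n, measurableType (d n)) (P : forall n, probability (T n) R)
    (W : forall n, T n -> \bar R) (a : nat -> \bar R) : Prop :=
  forall delta : R, 0 < delta ->
  exists C : R, 0 < C /\
    \forall n \near \oo,
      (P n [set t | C%:E * a n < `|W n t|] <= delta%:E)%E.

(* Main.v *)
(** Let [L] be the Cholesky factor of [Xi0]. The whitened design
    [Z = L^-1 X U Lambda^{-1/2}] has independent columns whose covariances lie
    between [eps I] and [eps^-1 I], and [s] denotes the tail sum
    [lambda_{k+1} + lambda_{k+2} + ...] for [k = k^*(b)].

    The Laplace transform of a Gaussian quadratic form gives Chernoff bounds, in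
    each fixed direction, for the tail Gram matrix [A1 = sum_{j>k} lambda_j Z_j Z_j^T]
    and for the first [k] columns of [Z]. A union bound over a net of the ball,
    affordable because [b] is large and [k/n] is small, makes [A1] comparable to
    [s I] and the head Gram matrix to [n I].

    With [delta = U^T (beta - beta_hat)], the interpolation equation reads
    [A1 w = Z q + g + f], where [q_j = sqrt lambda_j delta_j] for [j <= k] and
    [q_j = 0] otherwise, [g] is the tail signal and [f] the noise. Pairing it with
    [A1^-1 Z q] bounds the risk by [tau_n] plus a quadratic form in [f]: no prior
    bound on [w] is needed, because
    [q_j (Z^T w)_j = q_j theta_j / sqrt lambda_j - delta_j^2] in each head
    coordinate. The conditional expectation of the quadratic form given the design
    is at most a constant times [nu_n eta_n], and Markov's inequality concludes. *)
From HB Require Import structures.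
Require Import Defs.
From mathcomp Require Import all_boot all_order all_algebra.
From mathcomp Require Import all_classical all_reals all_analysis measurable_realfun.
From mathcomp Require Import ring lra zify.
Import Order.TTheory GRing.Theory Num.Theory.
Import numFieldNormedType.Exports.
Local Open Scope classical_set_scope.
Local Open Scope ring_scope.
Set Implicit Arguments.
Unset Strict Implicit.
Unset Printing Implicit Defensive.

(** The Laplace transform survives this: it is the inverse square root of a determinant, and a
    determinant is bounded below as soon as the quadratic form is. The net has covering radius
    [eps / 60] and at most [G^d] points in dimension [d], with [G = 3 * 2^K] depending on [eps]
    only. The tail needs [d = n] against a failure probability [2 exp (- eps r_k / 8)] per point;
    [r_k >= b n] with [b >= 8 (ln G + 1) / eps] is what wins, and this is the origin of [b]. The
    head needs [d = k] against [2 exp (- eps n / 8)], which wins once [k / n < eps / (16 ln G)],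
    hence eventually because [eta] tends to 0. The dual vector [w] depends on the head error that it
    is meant to control. The pairing breaks this circle because the unknown part of [w] enters it
    with a favourable sign. *)

Section Dot.
Context {R : realType}.

(** * Inner products and Euclidean norms *)

Lemma dotcvE n (u v : 'cV[R]_n) : dotcv u v = \sum_i u i 0 * v i 0.
Proof. by rewrite /dotcv mxE; apply: eq_bigr => i _; rewrite mxE. Qed.

Lemma dotcvvE n (u : 'cV[R]_n) : dotcv u u = \sum_i u i 0 ^+ 2.
Proof. by rewrite dotcvE; apply: eq_bigr => i _; rewrite expr2. Qed.

Lemma dotcvC n (u v : 'cV[R]_n) : dotcv u v = dotcv v u.
Proof. by rewrite !dotcvE; apply: eq_bigr => i _; rewrite mulrC. Qed.

Lemma dotcvDl n (u v w : 'cV[R]_n) : dotcv (u + v) w = dotcv u w + dotcv v w.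
Proof. by rewrite /dotcv linearD /= mulmxDl mxE. Qed.

Lemma dotcvDr n (u v w : 'cV[R]_n) : dotcv u (v + w) = dotcv u v + dotcv u w.
Proof. by rewrite /dotcv mulmxDr mxE. Qed.

Lemma dotcvZl n a (u v : 'cV[R]_n) : dotcv (a *: u) v = a * dotcv u v.
Proof. by rewrite /dotcv linearZ /= -scalemxAl mxE. Qed.

Lemma dotcvZr n a (u v : 'cV[R]_n) : dotcv u (a *: v) = a * dotcv u v.
Proof. by rewrite dotcvC dotcvZl dotcvC. Qed.

Lemma dotcvNl n (u v : 'cV[R]_n) : dotcv (- u) v = - dotcv u v.
Proof. by rewrite -scaleN1r dotcvZl mulN1r. Qed.

Lemma dotcvNr n (u v : 'cV[R]_n) : dotcv u (- v) = - dotcv u v.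
Proof. by rewrite dotcvC dotcvNl dotcvC. Qed.

Lemma dotcv0l n (v : 'cV[R]_n) : dotcv 0 v = 0.
Proof. by rewrite -(scale0r 0) dotcvZl mul0r. Qed.

Lemma dotcv0r n (v : 'cV[R]_n) : dotcv v 0 = 0.
Proof. by rewrite dotcvC dotcv0l. Qed.

Lemma dotcv_mulmxl m n (A : 'M[R]_(m, n)) u v :
  dotcv (A *m u) v = dotcv u (A^T *m v).
Proof. by rewrite /dotcv trmx_mul mulmxA. Qed.

Lemma dotcv_mulmxr m n (A : 'M[R]_(n, m)) u v :
  dotcv u (A *m v) = dotcv (A^T *m u) v.
Proof. by rewrite dotcvC dotcv_mulmxl dotcvC. Qed.

Lemma dotcv_ge0 n (u : 'cV[R]_n) : 0 <= dotcv u u.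
Proof. by rewrite dotcvvE sumr_ge0// => i _; rewrite sqr_ge0. Qed.

Lemma dotcv_eq0 n (u : 'cV[R]_n) : (dotcv u u == 0) = (u == 0).
Proof.
apply/eqP/eqP => [|->]; last exact: dotcv0l.
rewrite dotcvvE => /eqP; rewrite psumr_eq0 => [/allP H|i _]; last exact: sqr_ge0.
apply/colP => i; rewrite mxE; apply/eqP.
by have := H i (mem_index_enum _); rewrite /= sqrf_eq0.
Qed.

Lemma dotcv_gt0 n (u : 'cV[R]_n) : (0 < dotcv u u) = (u != 0).
Proof. by rewrite lt_def dotcv_ge0 andbT dotcv_eq0. Qed.

Lemma sqnorm_mxE n (M : 'M[R]_n) v : sqnorm_mx M v = dotcv v (M *m v).
Proof. by rewrite /sqnorm_mx /dotcv mulmxA. Qed.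

Lemma dotcv_col_mx m n (u u' : 'cV[R]_m) (v v' : 'cV[R]_n) :
  dotcv (col_mx u v) (col_mx u' v') = dotcv u u' + dotcv v v'.
Proof.
rewrite !dotcvE big_split_ord /=; congr (_ + _); apply: eq_bigr => i _.
  by rewrite !col_mxEu.
by rewrite !col_mxEd.
Qed.

Lemma dotcv_CS n (u v : 'cV[R]_n) :
  dotcv u v ^+ 2 <= dotcv u u * dotcv v v.
Proof.
have [->|v0] := eqVneq v 0; first by rewrite !dotcv0r expr0n mulr0.
have vv0 : 0 < dotcv v v by rewrite dotcv_gt0.
have := dotcv_ge0 (dotcv v v *: u - dotcv u v *: v).
rewrite !(dotcvDl, dotcvDr, dotcvNl, dotcvNr, dotcvZl, dotcvZr) (dotcvC v u).
set a := dotcv u u; set b := dotcv u v; set c := dotcv v v => H.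
have : 0 <= c * (a * c - b ^+ 2) by lra.
by rewrite pmulr_rge0 // subr_ge0.
Qed.

Lemma l2norm_sqr n (v : 'cV[R]_n) : l2norm v ^+ 2 = dotcv v v.
Proof. by rewrite /l2norm -dotcvvE sqr_sqrtr// dotcv_ge0. Qed.

Lemma l2normE n (v : 'cV[R]_n) : l2norm v = Num.sqrt (dotcv v v).
Proof. by rewrite /l2norm -dotcvvE. Qed.

Lemma l2norm_ge0 n (v : 'cV[R]_n) : 0 <= l2norm v.
Proof. exact: sqrtr_ge0. Qed.

Lemma dotcv_le_l2norm n (u v : 'cV[R]_n) : dotcv u v <= l2norm u * l2norm v.
Proof.
have [h|h] := lerP (dotcv u v) 0.
  by rewrite (le_trans h)// mulr_ge0// l2norm_ge0.
rewrite -(@ler_pXn2r _ 2) ?nnegrE ?mulr_ge0 ?l2norm_ge0 ?(ltW h)//.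
by rewrite exprMn !l2norm_sqr dotcv_CS.
Qed.

Lemma l2normD n (u v : 'cV[R]_n) : l2norm (u + v) <= l2norm u + l2norm v.
Proof.
rewrite -(@ler_pXn2r _ 2) ?nnegrE ?addr_ge0 ?l2norm_ge0//.
rewrite sqrrD !l2norm_sqr !(dotcvDl, dotcvDr) (dotcvC v u).
have := dotcv_le_l2norm u v; lra.
Qed.

Lemma l2normZ n a (u : 'cV[R]_n) : l2norm (a *: u) = `|a| * l2norm u.
Proof.
by rewrite !l2normE dotcvZl dotcvZr mulrA -expr2 sqrtrM ?sqr_ge0// sqrtr_sqr.
Qed.

Lemma l2norm_gt0 n (u : 'cV[R]_n) : (0 < l2norm u) = (u != 0).
Proof. by rewrite l2normE sqrtr_gt0 dotcv_gt0. Qed.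

Lemma ler_l2norm_sqr m n a b (u : 'cV[R]_m) (v : 'cV[R]_n) : 0 <= a -> 0 <= b ->
  (a * l2norm u <= b * l2norm v) = (a ^+ 2 * dotcv u u <= b ^+ 2 * dotcv v v).
Proof.
move=> a0 b0; rewrite -(@ler_pXn2r _ 2) ?nnegrE ?mulr_ge0 ?l2norm_ge0//.
by rewrite !exprMn !l2norm_sqr.
Qed.

End Dot.

(** * Schur complements, determinants and Cholesky factors *)

Section PosDef.
Context {R : realType}.

Definition schur n (M : 'M[R]_(1 + n)) : 'M[R]_n :=
  drsubmx M - (M 0 0)^-1 *: (dlsubmx M *m (dlsubmx M)^T).

Lemma schur_sym n (M : 'M[R]_(1 + n)) : M^T = M -> (schur M)^T = schur M.
Proof.
move=> MT; rewrite /schur linearB linearZ /= trmx_mul trmxK.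
by rewrite trmx_drsub MT.
Qed.

Lemma sym_block n (M : 'M[R]_(1 + n)) : M^T = M ->
  M = block_mx (M 0 0)%:M (dlsubmx M)^T (dlsubmx M) (drsubmx M).
Proof.
move=> MT; rewrite -[LHS]submxK; congr block_mx.
  by rewrite [LHS]mx11_scalar !mxE lshift0.
by rewrite trmx_dlsub MT.
Qed.

(** Completion of the square in the first coordinate; both the determinant bound and the Gaussian
    integral below rest on it. *)
Lemma sqnorm_mx_schur n (M : 'M[R]_(1 + n)) x v : M^T = M -> M 0 0 != 0 ->
  sqnorm_mx M (col_mx x%:M v) =
  M 0 0 * (x + (M 0 0)^-1 * dotcv (dlsubmx M) v) ^+ 2 + sqnorm_mx (schur M) v.
Proof.
move=> MT a0; rewrite [in LHS](sym_block MT) !sqnorm_mxE mul_block_col.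
rewrite dotcv_col_mx dotcvE big_ord1.
rewrite /schur mulmxBl -scalemxAl -mulmxA !dotcvDr dotcvNr dotcvZr.
rewrite (dotcv_mulmxr (dlsubmx M) v (_ *m v)).
set b := dlsubmx M; set S := drsubmx M.
have e1 : (b *m x%:M : 'cV_n) = x *: b by rewrite mul_mx_scalar.
have e2 : (b^T *m v) 0 0 = dotcv b v by [].
have e3 : dotcv (b^T *m v) (b^T *m v) = dotcv b v ^+ 2.
  by rewrite dotcvE big_ord1 e2 expr2.
rewrite e1 e3 dotcvZr [in X in x%:M 0 0 * X]mxE e2 -scalar_mxM !mxE eqxx !mulr1n (dotcvC v b).
set a := M 0 0 in a0 *; field.
exact: a0.
Qed.

Lemma det_schur n (M : 'M[R]_(1 + n)) : M^T = M -> M 0 0 != 0 ->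
  \det M = M 0 0 * \det (schur M).
Proof.
move=> MT a0.
pose E : 'M[R]_(1 + n) := block_mx 1%:M 0 (- (M 0 0)^-1 *: dlsubmx M) 1%:M.
have detE : \det E = 1 by rewrite det_lblock !det1 mulr1.
rewrite -[LHS]mul1r -detE -det_mulmx [in X in _ *m X](sym_block MT) mulmx_block.
rewrite !mul1mx !mul0mx !addr0 mul_mx_scalar scalerA.
have -> : M 0 0 * (- (M 0 0)^-1) = -1 by rewrite mulrN divff.
rewrite scaleN1r addNr det_ublock det_scalar1; congr (_ * \det _).
by rewrite /schur -scalemxAl scaleNr addrC.
Qed.

Lemma posdef_diag_gt0 n (M : 'M[R]_(1 + n)) : posdefmx M -> 0 < M 0 0.
Proof.
have e : sqnorm_mx M (delta_mx 0 0) = M 0 0.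
  rewrite sqnorm_mxE -colE dotcvE (bigD1 0)//= !mxE eqxx mul1r big1 ?addr0//.
  by move=> i /negbTE i0; rewrite !mxE i0/= mul0r.
case=> MT /(_ (delta_mx 0 0)); rewrite e; apply; apply/eqP => /matrixP/(_ 0 0).
by rewrite !mxE eqxx/= => /eqP; rewrite oner_eq0.
Qed.

Lemma posdef_schur n (M : 'M[R]_(1 + n)) : posdefmx M -> posdefmx (schur M).
Proof.
move=> Mpd; have a0 := posdef_diag_gt0 Mpd; case: (Mpd) => MT Mp.
split; first exact: schur_sym.
move=> v v0.
(* This first coordinate annihilates the completed square, so only the Schur part is left. *)
have := Mp (col_mx (- ((M 0 0)^-1 * dotcv (dlsubmx M) v))%:M v).
rewrite sqnorm_mx_schur ?gt_eqF// addNr expr0n mulr0 add0r; apply.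
apply: contraNneq v0 => /(congr1 dsubmx); rewrite col_mxKd => ->.
by apply/eqP/colP => i; rewrite !mxE.
Qed.

Lemma posdef_det_gt0 n (M : 'M[R]_n) : posdefmx M -> 0 < \det M.
Proof.
elim: n M => [|n IH] M Mpd; first by rewrite det_mx00.
have a0 := posdef_diag_gt0 Mpd.
rewrite (@det_schur n M (proj1 Mpd)) ?gt_eqF// mulr_gt0//.
exact/IH/posdef_schur.
Qed.

Lemma posdef_unitmx n (M : 'M[R]_n) : posdefmx M -> M \in unitmx.
Proof. by move=> /posdef_det_gt0 h; rewrite unitmxE unitfE gt_eqF. Qed.

(** Induction on Schur complements: the bound [c] passes to the pivot (test on the first basis
    vector) and to the Schur complement (choose the first coordinate that kills the square). *)
Lemma det_ge_expr n (M : 'M[R]_n) c : M^T = M -> 0 < c ->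
  (forall v, c * dotcv v v <= sqnorm_mx M v) -> c ^+ n <= \det M.
Proof.
elim: n M => [|n IH] M MT c0 Mc; first by rewrite det_mx00.
have {}Mc : forall v : 'cV[R]_(1 + n),
  c * dotcv v v <= sqnorm_mx (M : 'M[R]_(1 + n)) v := Mc.
have Mpd : posdefmx (M : 'M[R]_(1 + n)).
  by split => // v v0; rewrite (lt_le_trans _ (Mc v))// mulr_gt0// dotcv_gt0.
have a0 := posdef_diag_gt0 Mpd.
rewrite (@det_schur n M MT) ?gt_eqF// exprS ler_pM ?exprn_ge0 ?(ltW c0)//.
  have := Mc (col_mx 1%:M 0).
  rewrite dotcv_col_mx dotcv0l addr0 (@sqnorm_mx_schur n M) ?gt_eqF//.
  rewrite !sqnorm_mxE mulmx0 !dotcv0r mulr0 !addr0 expr1n mulr1.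
  by rewrite dotcvE big_ord1 !mxE eqxx mulr1 mulr1.
apply: IH => //; first exact: (@schur_sym n M).
move=> v.
have := Mc (col_mx (- ((M 0 0)^-1 * dotcv (@dlsubmx _ 1 n 1 n M) v))%:M v).
rewrite (@sqnorm_mx_schur n M)// ?gt_eqF// addNr expr0n mulr0 add0r.
apply: le_trans; rewrite ler_wpM2l ?(ltW c0)//.
by rewrite dotcv_col_mx lerDr dotcv_ge0.
Qed.

(** Any factor [L] with [L *m L^T = M] whitens as well as the symmetric square root, and this one
    comes from the same induction. *)
Lemma cholesky n (M : 'M[R]_n) : posdefmx M ->
  exists2 L : 'M[R]_n, L \in unitmx & L *m L^T = M.
Proof.
elim: n M => [|n IH] M Mpd.
  by exists 1%:M; [exact: unitmx1|apply/matrixP => -[]].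
have [L Lu LL] := IH _ (posdef_schur Mpd).
have a0 := posdef_diag_gt0 Mpd.
set a := M 0 0 in a0.
pose b := @dlsubmx _ 1 n 1 n M.
exists (block_mx (Num.sqrt a)%:M 0 ((Num.sqrt a)^-1 *: b) L : 'M[R]_(1 + n)).
  rewrite unitmxE (@det_lblock _ 1 n) unitrM -!unitmxE Lu andbT unitmxE det_scalar1.
  by rewrite unitfE gt_eqF// sqrtr_gt0.
have sa : Num.sqrt a != 0 by rewrite gt_eqF// sqrtr_gt0.
rewrite (@tr_block_mx _ 1 n 1 n) (@mulmx_block _ 1 n 1 n 1 n) [RHS](@sym_block n M (proj1 Mpd)).
rewrite !trmx0 !mulmx0 !mul0mx !addr0 tr_scalar_mx -scalar_mxM.
rewrite mul_scalar_mx mul_mx_scalar linearZ /= !scalerA mulfV// !scale1r.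
rewrite -expr2 sqr_sqrtr ?(ltW a0)//.
rewrite LL -scalemxAl -scalemxAr scalerA -invfM -expr2 sqr_sqrtr ?(ltW a0)//.
by rewrite /schur addrC subrK.
Qed.

(** Sylvester's identity: one block matrix is made triangular by multiplication from the right and
    from the left. *)
Lemma det_one_add_mulC m n (A : 'M[R]_(m, n)) (B : 'M[R]_(n, m)) :
  \det (1%:M + A *m B) = \det (1%:M + B *m A).
Proof.
have e1 : \det (block_mx 1%:M (- A) B 1%:M) = \det (1%:M + A *m B).
  have : \det (block_mx 1%:M (- A) B 1%:M *m block_mx 1%:M 0 (- B) 1%:M)
      = \det (1%:M + A *m B).
    rewrite mulmx_block !mulmx1 !mulmx0 !mul1mx mulNmx mulmxN opprK subrr.
    by rewrite !add0r (det_ublock (1%:M + A *m B)) det1 mulr1.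
  by rewrite det_mulmx det_lblock !det1 !mulr1.
rewrite -e1.
have : \det (block_mx 1%:M 0 (- B) 1%:M *m block_mx 1%:M (- A) B 1%:M)
    = \det (1%:M + B *m A).
  rewrite mulmx_block !mulmx1 !mul0mx !mul1mx mulNmx mulmxN opprK addNr.
  by rewrite !addr0 (det_ublock _ (- A)) det1 mul1r addrC.
by rewrite det_mulmx det_lblock !det1 !mul1r.
Qed.

End PosDef.

(** * Rayleigh quotients: from eigenvalues and operator norms to quadratic forms *)

Section Rayleigh.
Context {R : realType}.

(** On row vectors, because [rV_compact] and [EVT_min_rV] concern these. *)
Let quad n (A : 'M[R]_n) (v : 'rV[R]_n) : R :=
  \sum_i \sum_j v 0 i * (A i j * v 0 j).

Let quadE n (A : 'M[R]_n) (v : 'rV[R]_n) : quad A v = sqnorm_mx A v^T.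
Proof.
rewrite sqnorm_mxE dotcvE; apply: eq_bigr => i _.
by rewrite !mxE mulr_sumr; apply: eq_bigr => j _; rewrite !mxE.
Qed.

Let continuous_quad n (A : 'M[R]_n) : continuous (quad A).
Proof.
apply: (@continuous_big _ _ _ _ _ add_continuous) => i _.
apply: (@continuous_big _ _ _ _ _ add_continuous) => j _ v.
have vc k : {for v, continuous (fun w : 'rV[R]_n => w 0 k)}.
  exact: (@coord_continuous R 1 n 0 k v).
apply: (@continuousM _ _ (fun w : 'rV[R]_n => w 0 i)
  (fun w : 'rV[R]_n => A i j * w 0 j)) => //.
by apply: (@continuousM _ _ (cst (A i j)) (fun w : 'rV[R]_n => w 0 j)) => //; exact: cst_continuous.
Qed.

(** The unit sphere is compact as a closed subset of a cube, so the form has a minimum on it;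
    homogeneity does the rest. *)
Lemma rayleigh_min n (A : 'M[R]_n.+1) : exists v : 'cV[R]_n.+1,
  dotcv v v = 1 /\ forall u, sqnorm_mx A v * dotcv u u <= sqnorm_mx A u.
Proof.
pose S := [set v : 'rV[R]_n.+1 | quad 1%:M v = 1].
have S1 v : S v <-> dotcv v^T v^T = 1 by rewrite /S/= quadE sqnorm_mxE mul1mx.
have S0 : S !=set0.
  exists (delta_mx 0 0); apply/S1; rewrite trmx_delta dotcvvE (bigD1 0)//= big1.
    by rewrite !mxE !eqxx expr1n addr0.
  by move=> i /negbTE i0; rewrite !mxE i0 expr0n.
have cS : compact S.
  have cB := @rV_compact R _ (fun _ : 'I_n.+1 => `[-1, 1]%classic)
    (fun=> @segment_compact R (-1) 1).
  apply: (subclosed_compact _ cB).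
    by apply: closed_comp (@closed_eq _ _) => v _; exact: continuous_quad.
  move=> v /S1 v1 i.
  rewrite /= in_itv/= -ler_norml -(@ler_pXn2r _ 2) ?nnegrE//.
  rewrite expr1n real_normK ?num_real// -v1 dotcvvE (bigD1 i)//= mxE.
  by rewrite lerDl sumr_ge0// => j _; rewrite sqr_ge0.
have [c cS1 cmin] := EVT_min_rV S0 cS
  (continuous_subspaceT (@continuous_quad _ A)).
exists c^T; split; first exact/S1/set_mem.
move=> u; have [->|u0] := eqVneq u 0.
  by rewrite dotcv0l mulr0 sqnorm_mxE mulmx0 dotcv0r.
have uu : 0 < dotcv u u by rewrite dotcv_gt0.
have /cmin : ((l2norm u)^-1 *: u)^T \in S.
  apply/mem_set/S1; rewrite trmxK dotcvZl dotcvZr mulrA -expr2 exprVn.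
  by rewrite l2norm_sqr mulVf// gt_eqF.
rewrite !quadE trmxK [X in _ <= X]sqnorm_mxE -scalemxAr dotcvZl dotcvZr mulrA.
by rewrite -expr2 exprVn l2norm_sqr mulrC ler_pdivlMr// -sqnorm_mxE.
Qed.

(** At a zero of a nonnegative form the first variation vanishes; otherwise a move from [v] against
    [A v] would make the form negative. *)
Lemma psd_kernel n (A : 'M[R]_n) v : A^T = A ->
  (forall u, 0 <= sqnorm_mx A u) -> sqnorm_mx A v = 0 -> A *m v = 0.
Proof.
move=> AT A0 v0; apply/eqP; apply: contraT => Av.
set u := A *m v in Av; have d0 : 0 < dotcv u u by rewrite dotcv_gt0.
have q0 := A0 u; set q := sqnorm_mx A u in q0.
(* With [d = |u|^2], the form at [v - t u] is [t^2 q - 2 t d], which is negative at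
   [t = d / (q + 1)]. *)
have := A0 (v - (dotcv u u / (q + 1)) *: u).
rewrite sqnorm_mxE mulmxBr -scalemxAr !(dotcvDl, dotcvDr, dotcvNl, dotcvNr).
rewrite !(dotcvZl, dotcvZr) -!sqnorm_mxE v0 [dotcv v _]dotcv_mulmxr AT.
rewrite -/u -/q; set d := dotcv u u in d0 *; clearbody d q => {AT A0 v0 Av u v A}.
have -> : 0 - d / (q + 1) * d + (- (d / (q + 1) * d) - - (d / (q + 1) * (d / (q + 1) * q))) =
  - (d ^+ 2 * (q + 2) / (q + 1) ^+ 2) by field; lra.
have q2 : 0 < q + 2 by lra.
have q1 : 0 < q + 1 by lra.
by rewrite oppr_ge0 leNgt divr_gt0 ?mulr_gt0 ?exprn_gt0.
Qed.

(** With [B = L L^T], minimise the form of [A' = L^-1 A L^-T]. The minimiser is an eigenvector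
    because [A' - c] is nonnegative and vanishes there. *)
Lemma generalized_rayleigh_min n (A B : 'M[R]_n.+1) : A^T = A -> posdefmx B ->
  exists c (v : 'cV[R]_n.+1), [/\ v != 0, A *m v = c *: (B *m v) &
    forall u, c * sqnorm_mx B u <= sqnorm_mx A u].
Proof.
move=> AT /cholesky[L Lu <-].
pose K := invmx L; have LK : L *m K = 1%:M by rewrite mulmxV.
have KTL : L^T *m K^T = 1%:M by rewrite -trmx_mul mulVmx// trmx1.
pose A' := K *m A *m K^T.
have A'T : A'^T = A' by rewrite !trmx_mul trmxK AT mulmxA.
have LA' : L *m A' *m L^T = A.
  rewrite /A' !mulmxA LK mul1mx -mulmxA -trmx_mul LK trmx1 mulmx1 //.
clearbody A'; have [v [v1 vmin]] := rayleigh_min A'.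
set c := sqnorm_mx A' v in vmin.
have A'v : A' *m v = c *: v.
  apply/eqP; rewrite -subr_eq0 -mul_scalar_mx -mulmxBl; apply/eqP.
  apply: psd_kernel.
  - by rewrite linearB /= A'T tr_scalar_mx.
  - move=> u; rewrite sqnorm_mxE mulmxBl dotcvDr dotcvNr mul_scalar_mx dotcvZr.
    by rewrite -sqnorm_mxE subr_ge0.
  - rewrite sqnorm_mxE mulmxBl dotcvDr dotcvNr mul_scalar_mx dotcvZr.
    by rewrite -sqnorm_mxE v1 mulr1 subrr.
exists c, (K^T *m v); split.
- apply: contra_eq_neq v1 => e.
  by rewrite -[v]mul1mx -KTL -mulmxA e mulmx0 dotcv0l eq_sym oner_eq0.
- rewrite -LA' -!mulmxA (mulmxA L^T K^T) KTL mul1mx A'v -scalemxAr.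
  by [].
- move=> u; have := vmin (L^T *m u).
  by rewrite !sqnorm_mxE -LA' -!mulmxA !(dotcv_mulmxr L).
Qed.

Lemma eigen_root n (W : 'M[R]_n) c (v : 'cV[R]_n) : v != 0 -> W *m v = c *: v ->
  root (char_poly W) c.
Proof.
move=> v0 Wv.
(* [eigenvalue] speaks of row vectors, hence the passage to the transpose. *)
have -> : char_poly W = char_poly W^T.
  rewrite /char_poly -det_tr; congr (\det _).
  by apply/matrixP => i j; rewrite !mxE eq_sym.
rewrite -eigenvalue_root_char; apply/eigenvalueP; exists v^T.
  by rewrite -trmx_mul Wv linearZ.
by apply: contraNneq v0 => /(congr1 trmx); rewrite trmxK trmx0 => ->.
Qed.

(** A nonzero [mu] rules out the empty default of [eigenseq], so the sorted list of roots exists and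
    its two ends enclose every root. *)
Lemma mu_bounds n (W : 'M[R]_n.+1) c : mu n.+1 W != 0 -> root (char_poly W) c ->
  mu n.+1 W <= c <= mu 1 W.
Proof.
rewrite /mu/eigenseq /=; case: xgetP => [s _ [ss sW]|_]; last by rewrite nth_nil eqxx.
move=> _; rewrite sW root_prod_XsubC => cs.
have szs : size s = n.+1.
  by have := size_char_poly W; rewrite sW size_prod_XsubC => -[].
have /(nthP 0)[i ilt <-] := cs.
have tr : transitive (>=%R : rel R) by move=> x y z xy yz; exact: le_trans yz xy.
have := sorted_leq_nth tr (@lexx _ _) 0 ss.
move=> H; apply/andP; split; apply: H => //.
- by rewrite inE szs.
- by rewrite -ltnS -szs.
- by rewrite inE szs.
Qed.

(** The minimum of the quotient of the two forms is attained at an eigenvector of [Xi0^-1 Xi_i],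
    hence is at least [mu n]. The maximum comes from the same lemma applied to [- Xi_i]. *)
Lemma coherent_bounds eps n p (Xi0 : 'M[R]_n.+1) (Xi : 'I_p -> 'M[R]_n.+1) :
  0 < eps -> coherent eps Xi0 Xi -> (forall i, posdefmx (Xi i)) ->
  forall i u, eps * sqnorm_mx Xi0 u <= sqnorm_mx (Xi i) u <= eps^-1 * sqnorm_mx Xi0 u.
Proof.
move=> eps0 [Xi0pd H] Xipd i u; have [h1 h2 h3] := H i.
set W := invmx Xi0 *m Xi i in h1 h2 h3.
have u0 : Xi0 \in unitmx := posdef_unitmx Xi0pd.
have q0 : 0 <= sqnorm_mx Xi0 u.
  have [->|un0] := eqVneq u 0; last by rewrite ltW// (proj2 Xi0pd).
  by rewrite sqnorm_mxE dotcv0l.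
have mu0 : mu n.+1 W != 0 by rewrite gt_eqF// (lt_le_trans eps0).
apply/andP; split.
  have [c [v [v0 vc cmin]]] := generalized_rayleigh_min (proj1 (Xipd i)) Xi0pd.
  apply: (le_trans _ (cmin u)); rewrite ler_wpM2r// (le_trans h1)//.
  have /(mu_bounds mu0)/andP[]// : root (char_poly W) c.
  by apply: (eigen_root v0); rewrite -mulmxA vc -scalemxAr mulKmx.
have XiN : (- Xi i)^T = - Xi i by rewrite linearN /= (proj1 (Xipd i)).
have [c [v [v0 vc cmin]]] := generalized_rayleigh_min XiN Xi0pd.
have := cmin u; rewrite [X in _ <= X]sqnorm_mxE mulNmx dotcvNr -sqnorm_mxE lerNr -mulNr.
move=> /le_trans; apply; rewrite ler_wpM2r//.
have /(mu_bounds mu0)/andP[_] : root (char_poly W) (- c).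
  apply: (eigen_root v0); rewrite -mulmxA.
  have -> : Xi i *m v = (- c) *: (Xi0 *m v) by rewrite scaleNr -vc mulNmx opprK.
  by rewrite -scalemxAr mulKmx.
by move=> /le_trans; apply; rewrite -div1r.
Qed.

(** The Frobenius norm is such a bound; it shows that the supremum defining [opnorm] is taken over a
    bounded set. *)
Lemma opnorm_bound m n (A : 'M[R]_(m, n)) :
  exists2 C, 0 <= C & forall v, l2norm (A *m v) <= C * l2norm v.
Proof.
exists (Num.sqrt (\sum_i dotcv (row i A)^T (row i A)^T)); first exact: sqrtr_ge0.
move=> v; rewrite -[leLHS]mul1r ler_l2norm_sqr ?sqrtr_ge0// expr1n mul1r.
rewrite sqr_sqrtr ?sumr_ge0//; last by move=> i _; exact: dotcv_ge0.
rewrite dotcvvE mulr_suml; apply: ler_sum => i _.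
have -> : (A *m v) i 0 = dotcv (row i A)^T v.
  by rewrite dotcvE mxE; apply: eq_bigr => j _; rewrite !mxE.
exact: dotcv_CS.
Qed.

Lemma opnormP m n (A : 'M[R]_(m, n)) v : l2norm (A *m v) <= opnorm A * l2norm v.
Proof.
have [->|v0] := eqVneq v 0.
  by rewrite mulmx0 !l2normE !dotcv0l sqrtr0 mulr0.
have vv : 0 < l2norm v by rewrite l2norm_gt0.
rewrite -ler_pdivrMr//.
have [C C0 HC] := opnorm_bound A.
have h : l2norm ((l2norm v)^-1 *: v) = 1.
  by rewrite l2normZ ger0_norm ?invr_ge0 ?ltW// mulVf ?gt_eqF.
apply: (@ub_le_sup _ [set l2norm (A *m v) | v in [set v | l2norm v <= 1]]).
  exists C => _ [w w1 <-]; apply: (le_trans (HC w)).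
  by rewrite -[leRHS]mulr1 ler_wpM2l.
exists ((l2norm v)^-1 *: v); first by rewrite /= h.
by rewrite -scalemxAr l2normZ ger0_norm ?invr_ge0 ?ltW// mulrC.
Qed.

(** The matrix [Xi0^-1 Y] need not be symmetric, so its norm may exceed its spectral radius; but the
    largest quotient of the two forms is one of its eigenvalues, hence at most its norm. *)
Lemma sqnorm_le_opnorm n (Xi0 Y : 'M[R]_n.+1) u : posdefmx Xi0 -> posdefmx Y ->
  sqnorm_mx Y u <= opnorm (invmx Xi0 *m Y) * sqnorm_mx Xi0 u.
Proof.
move=> Xi0pd Ypd.
have q0 : 0 <= sqnorm_mx Xi0 u.
  have [->|un0] := eqVneq u 0; last by rewrite ltW// (proj2 Xi0pd).
  by rewrite sqnorm_mxE dotcv0l.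
have YN : (- Y)^T = - Y by rewrite linearN /= (proj1 Ypd).
have [c [v [v0 vc cmin]]] := generalized_rayleigh_min YN Xi0pd.
have := cmin u; rewrite [X in _ <= X]sqnorm_mxE mulNmx dotcvNr -sqnorm_mxE lerNr -mulNr.
move=> /le_trans; apply; rewrite ler_wpM2r//.
have := opnormP (invmx Xi0 *m Y) v; rewrite -mulmxA.
have -> : Y *m v = (- c) *: (Xi0 *m v) by rewrite scaleNr -vc mulNmx opprK.
rewrite -scalemxAr mulKmx ?posdef_unitmx// l2normZ ler_pM2r ?l2norm_gt0//.
by apply: le_trans; exact: ler_norm.
Qed.

End Rayleigh.

(** * A lattice net of the unit ball *)

Section Net.
Context {R : realType}.

(* The distance [|x - N|], through truncated subtraction. *)
Definition latdist (N x : nat) : nat := (x - N) + (N - x).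

(* Vectors of integers of l1-norm at most [K m], stored with an offset [K m]. *)
Definition lattice (m K : nat) : pred {ffun 'I_m -> 'I_((K * m).*2.+1)} :=
  [pred f : {ffun 'I_m -> 'I_((K * m).*2.+1)} |
    (\sum_i latdist (K * m) (f i) <= K * m)%N].

#[global] Arguments lattice : clear implicits.

(** The step [h / sqrt m] makes rounding in all [m] coordinates cost at most [h] in norm; the
    subtraction undoes the offset. *)
Definition latpt (h : R) m K (f : {ffun 'I_m -> 'I_((K * m).*2.+1)}) : 'cV[R]_m :=
  \col_i (h / Num.sqrt m%:R * ((f i)%:R - (K * m)%:R)).

Lemma geo_half (N : nat) : \sum_(i < N) (2^-1 : R) ^+ i.+1 = 1 - 2^-1 ^+ N.
Proof.
elim: N => [|N IH]; first by rewrite big_ord0 expr0 subrr.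
by rewrite big_ord_recr /= IH !exprS; field.
Qed.

(** A two-sided geometric series: the centre counts 1 and each side at most 1. *)
Lemma sum_latdist N : \sum_(x < N.*2.+1) (2^-1 : R) ^+ latdist N x <= 3.
Proof.
rewrite -(big_mkord xpredT (fun x => 2^-1 ^+ latdist N x)).
rewrite (@big_cat_nat _ _ _ N)//=; last by rewrite -addnn leqW// leq_addr.
rewrite big_nat_rev /= big_mkord add0n.
rewrite (eq_bigr (fun i : 'I_N => 2^-1 ^+ i.+1)); last first.
  move=> i _; congr (_ ^+ _); rewrite /latdist subKn//.
  have -> : (N - i.+1 - N = 0)%N by apply/eqP; rewrite subn_eq0 leq_subr.
  by [].
have -> : \sum_(N <= i < N.*2.+1) (2^-1 : R) ^+ latdist N i =
    \sum_(i < N.+1) 2^-1 ^+ latdist N (i + N).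
  by rewrite -{1}[N]add0n big_addn -addnn -addSn addnK big_mkord.
rewrite (eq_bigr (fun i : 'I_N.+1 => 2^-1 ^+ i)); last first.
  move=> i _; congr (_ ^+ _); rewrite /latdist addnK.
  have -> : (N - (i + N) = 0)%N by apply/eqP; rewrite subn_eq0 leq_addl.
  by rewrite addn0.
rewrite big_ord_recl expr0 (eq_bigr (fun i : 'I_N => 2^-1 ^+ i.+1))//.
rewrite geo_half; have : 0 <= (2^-1 : R) ^+ N by rewrite exprn_ge0.
lra.
Qed.

(* Every lattice point has weight at least 1 for [2^(Km) prod_i 2^(-|x_i|)], and the
   total weight factors over the coordinates. *)
Lemma card_lattice m K : (#|lattice m K|%:R : R) <= (3 * 2 ^+ K) ^+ m.
Proof.
rewrite -sum1_card natr_sum.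
apply: (@le_trans _ _ (\sum_(f : {ffun 'I_m -> 'I_((K * m).*2.+1)})
    2 ^+ (K * m) * \prod_(i < m) (2^-1 : R) ^+ latdist (K * m) (f i))).
  rewrite [leRHS](bigID (mem (lattice m K)))/= -[leLHS]addr0 lerD//.
    apply: ler_sum => f; rewrite inE => fK.
    rewrite prodrXr; apply: (@le_trans _ _ (2 ^+ (K * m) * 2^-1 ^+ (K * m))).
      by rewrite -exprMn divff ?expr1n// pnatr_eq0.
    by rewrite ler_wpM2l ?exprn_ge0// ler_wiXn2l// invf_le1// ler1n.
  by rewrite sumr_ge0// => f _; rewrite mulr_ge0 ?prodr_ge0// => *; rewrite exprn_ge0.
rewrite -mulr_sumr -(bigA_distr_bigA (fun _ (x : 'I_((K * m).*2.+1)) => (2^-1 : R) ^+ latdist (K * m) x)).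
rewrite prodr_const card_ord mulrC [leRHS]exprMn exprM ler_wpM2r ?exprn_ge0//.
by rewrite lerXn2r ?nnegrE ?sum_latdist ?sumr_ge0// => *; rewrite exprn_ge0.
Qed.

(** Round every coordinate down. The result has norm at most [1 + h], and since integers satisfy
    [|z| <= z^2], its l1-norm in lattice units is at most [m (1 + 1/h)^2 <= K m]. *)
Lemma lattice_cover m K (h : R) : 0 < h -> (1 + h^-1) ^+ 2 <= K%:R ->
  forall v : 'cV[R]_m, dotcv v v <= 1 ->
  exists2 f, f \in lattice m K & l2norm (v - latpt h f) <= h.
Proof.
move=> h0 hK v v1; case: (posnP m) => [m0|m0].
  have absurd (i : 'I_m) : false by rewrite -(ltn0 i) -m0.
  exists [ffun=> ord0]; first by rewrite inE big1// => i; have := absurd i.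
  by rewrite l2normE dotcvE big1 ?sqrtr0 ?ltW// => i; have := absurd i.
have sm : 0 < Num.sqrt m%:R :> R by rewrite sqrtr_gt0 ltr0n.
have [e eE] : exists e : R, e = h / Num.sqrt m%:R by eexists.
have e0 : 0 < e by rewrite eE divr_gt0.
have e2 : e ^+ 2 * m%:R = h ^+ 2.
  by rewrite eE exprMn exprVn sqr_sqrtr ?ler0n// -mulrA mulVf ?mulr1// pnatr_eq0 -lt0n.
pose z i : int := Num.floor (v i 0 / e).
pose w : 'cV[R]_m := \col_i (e * (z i)%:~R).
have vw : l2norm (v - w) <= h.
  rewrite -(@ler_pXn2r _ 2) ?nnegrE ?l2norm_ge0 ?(ltW h0)// l2norm_sqr.
  rewrite dotcvvE -e2.
  have -> : m%:R = \sum_(i < m) 1 :> R by rewrite sumr_const card_ord.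
  rewrite mulr_sumr; apply: ler_sum => i _; rewrite !mxE mulr1.
  have -> : v i 0 - e * (z i)%:~R = e * (v i 0 / e - (z i)%:~R).
    by rewrite mulrBr mulrCA divff ?mulr1// gt_eqF.
  rewrite exprMn -[leRHS]mulr1 ler_wpM2l ?sqr_ge0//.
  have := Num.Theory.floor_itv (v i 0 / e) => /andP[].
  rewrite -/(z i) intrD /= => z1 z2; rewrite expr_le1//; lra.
have nw : l2norm w <= 1 + h.
  have -> : w = v + -1 *: (v - w) by rewrite scaleN1r opprB addrC subrK.
  rewrite (le_trans (l2normD _ _))// l2normZ normrN1 mul1r lerD//.
  by rewrite l2normE -sqrtr1 ler_wsqrtr.
have sz : (\sum_i `|z i| <= K * m)%N.
  rewrite -(ler_nat R) natr_sum.
  apply: (@le_trans _ _ (\sum_i (z i)%:~R ^+ 2)).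
    apply: ler_sum => i _; rewrite -[_%:R]/(`|z i|%N%:~R) abszE intr_norm.
    rewrite -real_normK ?num_real// -intr_norm; case: (z i) => k.
      rewrite -abszE /= -natrX ler_nat; case: (k) => // k'.
      by rewrite -{1}[k'.+1]expn1 leq_pexp2l.
    rewrite -abszE /= -natrX ler_nat.
    by rewrite -{1}[k.+1]expn1 leq_pexp2l.
  have -> : \sum_i (z i)%:~R ^+ 2 = (e ^+ 2)^-1 * dotcv w w.
    rewrite dotcvvE mulr_sumr; apply: eq_bigr => i _.
    by rewrite !mxE exprMn mulKf// sqrf_eq0 gt_eqF.
  rewrite ler_pdivrMl ?exprn_gt0// natrM mulrCA e2 -l2norm_sqr.
  apply: (@le_trans _ _ ((1 + h) ^+ 2)).
    by rewrite ler_pXn2r ?nnegrE ?l2norm_ge0 ?addr_ge0// ltW.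
  rewrite -ler_pdivrMr ?exprn_gt0// -expr_div_n mulrDl mul1r divff ?gt_eqF//.
  by rewrite addrC.
have zlt i : (`|z i| <= K * m)%N.
  by apply: leq_trans sz; rewrite (bigD1 i)//= leq_addr.
have zP i : (`|(z i + (K * m)%N)%R| < (K * m).*2.+1)%N.
  rewrite ltnS -addnn; move: (zlt i); lia.
exists [ffun i => Ordinal (zP i)].
  rewrite inE; apply: leq_trans sz; apply: leq_sum => i _; rewrite ffunE /=.
  rewrite /latdist; move: (zlt i); lia.
suff -> : latpt h [ffun i => Ordinal (zP i)] = w by [].
apply/colP => i; rewrite !mxE ffunE /= -eE; congr (e * _).
have -> : (`|(z i + (K * m)%N)%R|%N%:R : R) = (z i + (K * m)%N)%:~R.
  rewrite -[LHS]/(`|(z i + (K * m)%N)%R|%N%:~R); congr (_%:~R).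
  by move: (zlt i); lia.
by rewrite intrD addrK.
Qed.

Lemma opnorm_le m n (A : 'M[R]_(m, n)) B :
  (forall v, l2norm v <= 1 -> l2norm (A *m v) <= B) -> opnorm A <= B.
Proof.
move=> AB; apply: ge_sup => [|_ [v v1 <-]]; last exact: AB.
exists (l2norm (A *m 0)); exists 0 => //=.
by rewrite l2normE dotcv0l sqrtr0.
Qed.

Lemma opnorm_ge0 m n (A : 'M[R]_(m, n)) : 0 <= opnorm A.
Proof.
have [C C0 HC] := opnorm_bound A.
apply: (@ub_le_sup _ [set l2norm (A *m v) | v in [set v | l2norm v <= 1]]).
  exists C => _ [w w1 <-]; apply: (le_trans (HC w)).
  by rewrite -[leRHS]mulr1 ler_wpM2l.
exists 0 => /=; first by rewrite l2normE dotcv0l sqrtr0.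
by rewrite mulmx0 l2normE dotcv0l sqrtr0.
Qed.

(** Write [v = w + (v - w)] with [w] in the net: [|L v| <= 3/2 g + |L| / 2]. The supremum over [v]
    absorbs the second term and leaves [3 g]. *)
Lemma opnorm_lattice m M K (h g : R) (L : 'M[R]_(M, m)) : 0 < h -> h <= 2^-1 ->
  (1 + h^-1) ^+ 2 <= K%:R -> 0 <= g ->
  (forall f, f \in lattice m K -> l2norm (L *m latpt h f) <= g * l2norm (latpt h f)) ->
  opnorm L <= 3 * g.
Proof.
move=> h0 h2 hK g0 H.
suff : opnorm L <= 3 / 2 * g + opnorm L / 2 by lra.
apply: opnorm_le => v v1.
have [|f fS vf] := lattice_cover h0 hK (v := v).
  by rewrite -l2norm_sqr expr_le1// l2norm_ge0.
set w := latpt h f in vf; have nw : l2norm w <= 3 / 2.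
  have -> : w = v + -1 *: (v - w) by rewrite scaleN1r opprB addrC subrK.
  rewrite (le_trans (l2normD _ _))// l2normZ normrN1 mul1r; lra.
have -> : v = w + (v - w) by rewrite addrC subrK.
rewrite mulmxDr (le_trans (l2normD _ _))// lerD//.
  by rewrite (le_trans (H _ fS))// mulrC ler_wpM2r.
by rewrite (le_trans (opnormP _ _))// ler_wpM2l ?opnorm_ge0// (le_trans vf).
Qed.

(** For a unit vector the net point nearby has norm at least 1/2, so [|L u| >= gl / 2 - 3 g h];
    [12 g h <= gl] makes the error at most [gl / 4]. *)
Lemma l2norm_ge_lattice m M K (h g gl : R) (L : 'M[R]_(M, m)) : 0 < h -> h <= 2^-1 ->
  (1 + h^-1) ^+ 2 <= K%:R -> 0 <= g -> 0 <= gl -> 12 * g * h <= gl ->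
  (forall f, f \in lattice m K -> l2norm (L *m latpt h f) <= g * l2norm (latpt h f)) ->
  (forall f, f \in lattice m K -> gl * l2norm (latpt h f) <= l2norm (L *m latpt h f)) ->
  forall v, gl / 4 * l2norm v <= l2norm (L *m v).
Proof.
move=> h0 h2 hK g0 gl0 ggl Hu Hl v.
have Lg := opnorm_lattice h0 h2 hK g0 Hu.
have [->|v0] := eqVneq v 0.
  by rewrite mulmx0 !l2normE dotcv0l sqrtr0 mulr0 dotcv0l sqrtr0.
have vv : 0 < l2norm v by rewrite l2norm_gt0.
set u := (l2norm v)^-1 *: v.
have nu : l2norm u = 1.
  by rewrite l2normZ ger0_norm ?invr_ge0 ?ltW// mulVf ?gt_eqF.
have -> : v = l2norm v *: u by rewrite scalerA mulfV ?scale1r// gt_eqF.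
rewrite -scalemxAr (l2normZ _ (L *m u)) (l2normZ _ u) -/u nu mulr1.
rewrite ger0_norm ?(ltW vv)// mulrC ler_wpM2l ?(ltW vv)//.
have [|f fS vf] := lattice_cover h0 hK (v := u).
  by rewrite -l2norm_sqr nu expr1n.
set w := latpt h f in vf; have nw : 2^-1 <= l2norm w.
  have uw : u = w + (u - w) by rewrite addrC subrK.
  have := l2normD w (u - w); rewrite -uw nu; lra.
have h1 := Hl _ fS; rewrite -/w in h1.
have h3 : gl / 2 <= gl * l2norm w by rewrite ler_wpM2l.
have h4 : l2norm (L *m (u - w)) <= 3 * g * h.
  rewrite (le_trans (opnormP _ _))// ler_pM ?opnorm_ge0 ?l2norm_ge0//.
have h5 : l2norm (L *m w) <= l2norm (L *m u) + l2norm (L *m (u - w)).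
  have -> : L *m w = L *m u + -1 *: (L *m (u - w)).
    by rewrite scaleN1r -mulmxN -mulmxDr opprB addrC subrK.
  by rewrite (le_trans (l2normD _ _))// l2normZ normrN1 mul1r.
have h6 : 3 * g * h <= gl / 4.
  have : 12 * g * h = 4 * (3 * g * h) by ring.
  lra.
lra.
Qed.

End Net.

(** * One-dimensional Gaussian integrals *)

Section Normal.
Context {R : realType}.
Local Notation mu := (@lebesgue_measure R).

(** The Radon-Nikodym derivative agrees almost everywhere with the density, as both have the same
    integral over every measurable set. *)
Lemma ge0_integral_normal_prob (m s : R) (f : R -> \bar R) : s != 0 ->
  (forall x, 0 <= f x)%E -> measurable_fun setT f ->
  (\int[normal_prob m s]_x f x = \int[mu]_x (f x * (normal_pdf m s x)%:E))%E.
Proof.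
move=> s0 f0 mf; have dom := @normal_prob_dominates R m s.
rewrite -(Radon_Nikodym_SigmaFinite.change_of_variables dom)//.
have iRN := Radon_Nikodym_SigmaFinite.f_integrable dom.
have mRN := measurable_int _ iRN.
have mpdf : measurable_fun setT (EFin \o normal_pdf m s).
  by apply/measurable_EFinP; exact: measurable_normal_pdf.
apply: ae_eq_integral => //; [exact: emeasurable_funM..|].
apply: ae_eqe_mul2l; apply: integral_ae_eq => // E _ mE.
by rewrite -Radon_Nikodym_SigmaFinite.f_integral.
Qed.

(** With [a = s^-2 - 2 c], completing the square turns integrand times density into a constant times
    the normal density of mean [- b / a] and variance [1 / a]. *)
Lemma integral_normal_exp_quad (s c b : R) : 0 < s -> 0 < s ^- 2 - 2 * c ->
  (\int[normal_prob 0 s]_x (expR (c * x ^+ 2 - b * x))%:E =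
   ((s * Num.sqrt (s ^- 2 - 2 * c))^-1 *
    expR (b ^+ 2 / (2 * (s ^- 2 - 2 * c))))%:E)%E.
Proof.
move=> s0; set a := _ - _ => a0; have sn0 : s != 0 by rewrite gt_eqF.
have sa : 0 < Num.sqrt a by rewrite sqrtr_gt0.
have mexp : measurable_fun setT (fun x : R => expR (c * x ^+ 2 - b * x)).
  apply: measurableT_comp => //; apply: measurable_funB.
    by apply: measurable_funM => //; exact: measurable_funX.
  exact: measurable_funM.
rewrite ge0_integral_normal_prob//; last first.
  exact/measurable_EFinP.
pose k := (s * Num.sqrt a)^-1 * expR (b ^+ 2 / (2 * a)).
have k0 : 0 <= k by rewrite mulr_ge0 ?expR_ge0// invr_ge0 mulr_ge0 ?sqrtr_ge0 ?ltW.
transitivity (\int[mu]_x (k%:E * (normal_pdf (- (b / a)) (Num.sqrt a)^-1 x)%:E))%E.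
  apply: eq_integral => x _; rewrite -!EFinM; congr (_%:E).
  have sa0 : (Num.sqrt a)^-1 != 0 by rewrite gt_eqF// invr_gt0.
  rewrite !normal_pdfE// /normal_fun /normal_peak exprVn sqr_sqrtr ?ltW// subr0.
  have -> : Num.sqrt (s ^+ 2 * pi *+ 2) = s * Num.sqrt a * Num.sqrt (a^-1 * pi *+ 2).
    have -> : s * Num.sqrt a = Num.sqrt (s ^+ 2 * a).
      by rewrite sqrtrM ?sqr_ge0// sqrtr_sqr gtr0_norm.
    rewrite -sqrtrM ?mulr_ge0 ?sqr_ge0 ?ltW//; congr Num.sqrt.
    by rewrite -!mulrnAr !mulrA mulfK// gt_eqF.
  rewrite /k invfM [LHS]mulrCA -!mulrA; congr (_ * _).
  rewrite [RHS]mulrCA; congr (_ * _); rewrite -!expRD; congr expR.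
  have -> : c = (s ^- 2 - a) / 2 by rewrite /a; field.
  by field; rewrite sn0 gt_eqF.
rewrite ge0_integralZl_EFin//.
- by rewrite integral_normal_pdf mule1.
- by move=> x _; rewrite lee_fin normal_pdf_ge0.
- by apply/measurable_EFinP; exact: measurable_normal_pdf.
Qed.

End Normal.

(** * Moments of Gaussian random variables *)

Section NormalRV.
Context {R : realType} {d : measure_display} {T : measurableType d}
  (P : probability T R).

Lemma ge0_integral_normal_rv (X : T -> R) m s (f : R -> \bar R) :
  normal_rv P X m s -> (forall x, 0 <= f x)%E -> measurable_fun setT f ->
  (\int[P]_t f (X t) = \int[normal_prob m s]_x f x)%E.
Proof.
move=> [mX XN] f0 mf.
pose X' : {RV P >-> measurableTypeR R} :=
  HB.pack (X : T -> measurableTypeR R) (isMeasurableFun.Build _ _ _ _ (X : T -> measurableTypeR R) mX).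
transitivity (\int[distribution P X']_x f x)%E.
  by rewrite ge0_integral_distribution.
apply: (@eq_measure_integral _ _ _ setT (normal_prob m s) (distribution P X') f).
by move=> A mA _; exact: XN.
Qed.

Lemma integral_normal_rv_exp_quad (X : T -> R) s c b :
  normal_rv P X 0 s -> 0 < s -> 0 < s ^- 2 - 2 * c ->
  (\int[P]_t (expR (c * X t ^+ 2 - b * X t))%:E =
   ((s * Num.sqrt (s ^- 2 - 2 * c))^-1 *
    expR (b ^+ 2 / (2 * (s ^- 2 - 2 * c))))%:E)%E.
Proof.
move=> XN s0 a0; rewrite -integral_normal_exp_quad//.
rewrite (ge0_integral_normal_rv (f := fun x => (expR (c * x ^+ 2 - b * x))%:E) XN)//.
apply/measurable_EFinP; apply: measurableT_comp => //; apply: measurable_funB.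
  by apply: measurable_funM => //; exact: measurable_funX.
exact: measurable_funM.
Qed.

Lemma integrable_normal_rv_exp_quad (X : T -> R) s c b :
  normal_rv P X 0 s -> 0 < s -> 0 < s ^- 2 - 2 * c ->
  P.-integrable setT (fun t => (expR (c * X t ^+ 2 - b * X t))%:E).
Proof.
move=> XN s0 a0; have mX := proj1 XN.
apply/integrableP; split.
  apply/measurable_EFinP; apply: measurableT_comp => //; apply: measurable_funB.
    by apply: measurable_funM => //; exact: measurable_funX.
  exact: measurable_funM.
under eq_integral do rewrite gee0_abs ?lee_fin ?expR_ge0//.
by rewrite (integral_normal_rv_exp_quad b XN)// ltry.
Qed.

(** Dominated by an exponential moment: [x^2 <= c^-1 exp (c x^2)], with [c = s^-2 / 4] small enough
    for integrability. *)
Lemma integrable_normal_rv_sqr (X : T -> R) s :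
  normal_rv P X 0 s -> 0 < s ->
  P.-integrable setT (fun t => (X t ^+ 2)%:E).
Proof.
move=> XN s0; have mX := proj1 XN.
have s2 : 0 < s ^- 2 by rewrite invr_gt0 exprn_gt0.
pose c := s ^- 2 / 4; have c0 : 0 < c by rewrite divr_gt0.
apply: (le_integrable _ _ _ (integrableZl _ c^-1
  (integrable_normal_rv_exp_quad (c := c) 0 XN s0 _))) => //.
- by apply/measurable_EFinP; exact: measurable_funX.
- move=> t _; rewrite /= lee_fin.
  rewrite !ger0_norm ?sqr_ge0 ?mulr_ge0 ?expR_ge0 ?invr_ge0 ?(ltW c0)//.
  rewrite ler_pdivlMl// mul0r subr0.
  by apply: le_trans (expR_ge1Dx _); rewrite lerDr.
- by rewrite /c; lra.
Qed.

Lemma integrable_normal_rv (X : T -> R) s :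
  normal_rv P X 0 s -> 0 < s -> P.-integrable setT (EFin \o X).
Proof.
move=> XN s0; have mX := proj1 XN.
have iX2 := integrable_normal_rv_sqr XN s0.
have i1 : P.-integrable setT (fun=> 1%:E : \bar R) by exact: finite_measure_integrable_cst.
apply: (le_integrable _ _ _ (integrableD measurableT i1 iX2)) => //.
  exact/measurable_EFinP.
move=> t _ /=; rewrite lee_fin [leRHS]ger0_norm ?addr_ge0 ?sqr_ge0//.
rewrite -(real_normK (num_real (X t))).
have := sqr_ge0 (`|X t| - 1); have := normr_ge0 (X t).
set y := `|X t|; nra.
Qed.

(** Read off from the Laplace transform: [1 - b m <= E exp (- b X) = exp (b^2 s^2 / 2)] for every
    [b], and the right side is [1 + O(b^2)], so a nonzero mean [m] is contradicted by a small
    [b = - t m]. *)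
Lemma normal_rv_mean0 (X : T -> R) s :
  normal_rv P X 0 s -> 0 < s -> (\int[P]_t (X t)%:E = 0)%E.
Proof.
move=> XN s0; have iX := integrable_normal_rv XN s0.
have i1 : P.-integrable setT (fun=> 1%:E : \bar R) by exact: finite_measure_integrable_cst.
have fX := integrable_fin_num measurableT iX.
rewrite -[LHS]fineK//; set m := fine _; congr (_%:E).
have s2 : 0 < s ^- 2 by rewrite invr_gt0 exprn_gt0.
have key b : 1 - b * m <= expR (b ^+ 2 * s ^+ 2 / 2).
  have a0 : 0 < s ^- 2 - 2 * 0 by rewrite mulr0 subr0.
  rewrite -lee_fin.
  have -> : (1 - b * m)%:E = (\int[P]_t (1 - b * X t)%:E)%E.
    under eq_integral do rewrite EFinB EFinM.
    rewrite integralB//=; last exact: integrableZl.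
    rewrite integralZl//= integral_cst//= probability_setT mul1e EFinB EFinM.
    by rewrite /m fineK.
  have -> : (expR (b ^+ 2 * s ^+ 2 / 2))%:E =
      (\int[P]_t (expR (0 * X t ^+ 2 - b * X t))%:E)%E.
    rewrite (integral_normal_rv_exp_quad b XN)// mulr0 subr0 -exprVn sqrtr_sqr.
    rewrite gtr0_norm ?invr_gt0// divff ?gt_eqF// invr1 mul1r exprVn.
    by congr (expR _)%:E; field; rewrite gt_eqF.
  apply: le_integral => //.
  - under [X in integrable _ _ X]funext do rewrite EFinB EFinM.
    by apply: integrableB => //; exact: integrableZl.
  - exact: (integrable_normal_rv_exp_quad b XN s0).
  - by move=> t _; rewrite lee_fin mul0r sub0r expR_ge1Dx.
have [//|m0] := eqVneq m 0.
have m2 : 0 < m ^+ 2 by rewrite exprn_even_gt0.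
have ss : 0 < s ^+ 2 by rewrite exprn_gt0.
(* [t = 1 / D] makes [t s^2], [t s^2 m^2] and [t] smaller than 1 at once. *)
pose D := 1 + s ^+ 2 + s ^+ 2 * m ^+ 2.
have D0 : 0 < D by rewrite /D; nra.
pose t := D^-1; have t0 : 0 < t by rewrite invr_gt0.
have tD : t * D = 1 by rewrite mulVf// gt_eqF.
have ts : t * s ^+ 2 < 1.
  by rewrite -tD ltr_pM2l// /D; nra.
have tsm : t * (s ^+ 2 * m ^+ 2) < 1.
  by rewrite -tD ltr_pM2l// /D; nra.
have t1 : t < 1 by rewrite -tD -{1}[t]mulr1 ltr_pM2l// /D; nra.
pose u := (- (t * m)) ^+ 2 * s ^+ 2 / 2.
have uE : u = t * (t * (s ^+ 2 * m ^+ 2)) / 2 by rewrite /u; field.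
have u1 : u <= 2^-1.
  rewrite uE ler_pdivrMr// mulVf//.
  have p0 : 0 <= t * (s ^+ 2 * m ^+ 2) by rewrite mulr_ge0 ?(ltW t0)// mulr_ge0 ?sqr_ge0.
  by rewrite mulr_ile1// ltW.
have e1 : 1 + t * m ^+ 2 <= expR u.
  by have := key (- (t * m)); rewrite -/u mulNr opprK -mulrA -expr2.
have e2 : expR u * (1 - u) <= 1.
  rewrite -[leRHS](expRxMexpNx_1 u) ler_wpM2l ?expR_ge0//.
  by rewrite (le_trans _ (expR_ge1Dx _)).
have tm : 0 < t * m ^+ 2 by rewrite mulr_gt0.
have e3 : (1 + t * m ^+ 2) * (1 - u) <= 1.
  by apply: le_trans e2; rewrite ler_wpM2r//; lra.
have : t * m ^+ 2 * (1 - t * s ^+ 2) <= 0.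
  have : t * m ^+ 2 * u <= t * m ^+ 2 * 2^-1 by rewrite ler_wpM2l// ltW.
  have : u = t * m ^+ 2 * (t * s ^+ 2) / 2 by rewrite uE; field.
  move: e3; set A := t * m ^+ 2; set B := t * s ^+ 2; set v := u; lra.
by rewrite leNgt mulr_gt0// subr_gt0.
Qed.

End NormalRV.

(** * Integrals over independent pairs *)

Section Indep.
Context {R : realType} {d : measure_display} {T : measurableType d}
  (P : probability T R).

Definition indep_maps d1 d2 (T1 : measurableType d1) (T2 : measurableType d2)
    (X : T -> T1) (Y : T -> T2) : Prop :=
  forall A B, measurable A -> measurable B ->
    P (X @^-1` A `&` Y @^-1` B) = (P (X @^-1` A) * P (Y @^-1` B))%E.

Section Maps.
Context d1 d2 (T1 : measurableType d1) (T2 : measurableType d2)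
  (X : T -> T1) (Y : T -> T2).
Hypotheses (mX : measurable_fun setT X) (mY : measurable_fun setT Y)
  (XY : indep_maps X Y).

Let X' : {RV P >-> T1} := HB.pack X (isMeasurableFun.Build _ _ _ _ X mX).
Let Y' : {RV P >-> T2} := HB.pack Y (isMeasurableFun.Build _ _ _ _ Y mY).
Let Zf t := (X t, Y t).
Let mZ : measurable_fun setT Zf. Proof. exact: measurable_fun_pair. Qed.
Let Z' : {RV P >-> (T1 * T2)%type} := HB.pack Zf (isMeasurableFun.Build _ _ _ _ Zf mZ).

Let lawZ A : measurable A ->
  (distribution P X' \x distribution P Y')%E A = distribution P Z' A.
Proof.
apply: (@product_measure_unique _ _ _ _ _ (distribution P X') (distribution P Y')
  (distribution P Z')) => B C mB mC.
exact: XY.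
Qed.

Lemma ge0_integral_indep (h : T1 * T2 -> \bar R) :
  measurable_fun setT h -> (forall z, 0 <= h z)%E ->
  (\int[P]_t h (X t, Y t) = \int[P]_s \int[P]_t h (X s, Y t))%E.
Proof.
move=> mh h0.
transitivity (\int[distribution P Z']_z h z)%E.
  by rewrite ge0_integral_distribution.
rewrite -(@eq_measure_integral _ _ _ setT (distribution P Z')
  (distribution P X' \x distribution P Y')%E h); last first.
  by move=> A mA _; exact: lawZ.
rewrite fubini_tonelli1// /fubini_F ge0_integral_distribution//.
- apply: eq_integral => s _ /=; rewrite ge0_integral_distribution//.
  by apply: measurableT_comp => //; exact: measurable_pair1.
- exact: measurable_fun_fubini_tonelli_F.
- by move=> s; exact: integral_ge0.
Qed.

Lemma integral_indep_prod (h : T1 * T2 -> R) : measurable_fun setT h ->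
    (\int[P]_s \int[P]_t `|h (X s, Y t)|%:E < +oo)%E ->
  P.-integrable setT (fun t => (h (X t, Y t))%:E) /\
  (\int[P]_t (h (X t, Y t))%:E =
   \int[distribution P X']_x \int[distribution P Y']_y (h (x, y))%:E)%E.
Proof.
move=> mh h2.
have mhE : measurable_fun setT (EFin \o h) by exact/measurable_EFinP.
have mnh : measurable_fun setT (fun z => `|h z|%:E).
  by apply/measurable_EFinP; exact: measurableT_comp.
have ih : P.-integrable setT (fun t => (h (X t, Y t))%:E).
  apply/integrableP; split; first exact: (measurableT_comp mhE).
  by have := ge0_integral_indep mnh (fun z => normr_ge0 (h z)); rewrite /= => ->.
split=> //.
have iprod : (distribution P X' \x distribution P Y')%E.-integrable setT (EFin \o h).
  apply/integrableP; split => //.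
  rewrite (@eq_measure_integral _ _ _ setT (distribution P Z')
    (distribution P X' \x distribution P Y')%E); last first.
    by move=> A mA _; exact: lawZ.
  by rewrite ge0_integral_distribution//; case/integrableP: ih.
transitivity (\int[distribution P Z']_z (h z)%:E)%E.
  by rewrite integral_distribution.
rewrite -(@eq_measure_integral _ _ _ setT (distribution P Z')
  (distribution P X' \x distribution P Y')%E (EFin \o h)); last first.
  by move=> A mA _; exact: lawZ.
by rewrite -integral12_prod_meas1.
Qed.

End Maps.

Lemma integral_indep_mul (U V : T -> R) :
  P.-integrable setT (EFin \o U) -> P.-integrable setT (EFin \o V) ->
  indep_maps U V ->
  P.-integrable setT (fun t => (U t * V t)%:E) /\
  (\int[P]_t (U t * V t)%:E = (\int[P]_t (U t)%:E) * (\int[P]_t (V t)%:E))%E.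
Proof.
move=> iU iV UV.
have mU : measurable_fun setT U by apply/measurable_EFinP; exact: measurable_int iU.
have mV : measurable_fun setT V by apply/measurable_EFinP; exact: measurable_int iV.
have fU := integrable_fin_num measurableT iU.
have fV := integrable_fin_num measurableT iV.
have mh : measurable_fun setT (fun z : R * R => z.1 * z.2).
  by apply: measurable_funM; [exact: measurable_fst|exact: measurable_snd].
have mnV : measurable_fun setT (fun t => `|V t|%:E).
  by apply/measurable_EFinP; exact: measurableT_comp.
have mnU : measurable_fun setT (fun t => `|U t|%:E).
  by apply/measurable_EFinP; exact: measurableT_comp.
have anV := integrable_fin_num measurableT (integrable_abse iV).
have anU := integrable_fin_num measurableT (integrable_abse iU).
have e1 : (\int[P]_s \int[P]_t `|U s * V t|%:E =
    (\int[P]_s `|(U s)%:E|) * (\int[P]_t `|(V t)%:E|))%E.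
  transitivity (\int[P]_s (`|(U s)%:E| * \int[P]_t `|(V t)%:E|))%E.
    apply: eq_integral => s _; under eq_integral do rewrite normrM EFinM.
    by rewrite ge0_integralZl_EFin//; exact: normr_ge0.
  by rewrite ge0_integralZr//; exact: integral_ge0.
have [|h1 h2] := integral_indep_prod mU mV UV mh.
  by rewrite /= e1 -(fineK anU) -(fineK anV) -EFinM ltry.
split=> //; rewrite h2/=.
rewrite -(fineK fV); set v := fine _.
transitivity (\int[P]_s ((U s)%:E * v%:E))%E; last first.
  by rewrite integralZr.
set U' := (X in distribution P X); set V' := (X in (\int[_]_x \int[distribution P X]_y _)%E).
transitivity (\int[distribution P U']_x (x%:E * v%:E))%E.
  apply: eq_integral => x _; under eq_integral do rewrite EFinM.
  have iV' : (distribution P V').-integrable setT (EFin : R -> \bar R).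
    apply/integrableP; split => //; rewrite ge0_integral_distribution//.
      by case/integrableP: iV.
    exact: measurableT_comp.
  rewrite integralZl//; congr (_ * _)%E.
  by rewrite integral_distribution//= /v fineK.
rewrite integral_distribution//=.
  exact: emeasurable_funM.
exact: integrableZr.
Qed.

End Indep.

(** * Measurability of random matrices *)

Section MeasurableMx.
Context {R : realType} {d : measure_display} {T : measurableType d}.

(** Entry by entry, this makes sense for any sigma-algebra on [T], in particular for the one
    generated by the design. *)
Definition mmx m n (A : T -> 'M[R]_(m, n)) : Prop :=
  forall i j, measurable_fun setT (fun t => A t i j).

Lemma mmx_cst m n (A : 'M[R]_(m, n)) : mmx (fun=> A).
Proof. by move=> i j; exact: measurable_cst. Qed.

Lemma mmx_trmx m n (A : T -> 'M[R]_(m, n)) : mmx A -> mmx (fun t => (A t)^T).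
Proof. by move=> mA i j; under eq_fun do rewrite mxE; exact: mA. Qed.

Lemma mmx_mul m n p (A : T -> 'M[R]_(m, n)) (B : T -> 'M[R]_(n, p)) :
  mmx A -> mmx B -> mmx (fun t => A t *m B t).
Proof.
move=> mA mB i j; under eq_fun do rewrite mxE.
by apply: measurable_sum => k; apply: measurable_funM; [exact: mA|exact: mB].
Qed.

Lemma mmx_add m n (A B : T -> 'M[R]_(m, n)) :
  mmx A -> mmx B -> mmx (fun t => A t + B t).
Proof.
move=> mA mB i j; under eq_fun do rewrite mxE.
by apply: measurable_funD; [exact: mA|exact: mB].
Qed.

Lemma mmx_opp m n (A : T -> 'M[R]_(m, n)) : mmx A -> mmx (fun t => - A t).
Proof.
move=> mA i j; under eq_fun do rewrite mxE.
by apply: measurableT_comp => //; exact: mA.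
Qed.

Lemma measurable_det n (A : T -> 'M[R]_n) :
  mmx A -> measurable_fun setT (fun t => \det (A t)).
Proof.
move=> mA; rewrite /determinant; apply: measurable_sum => s.
apply: measurable_funM => //; apply: measurable_prod => i _; exact: mA.
Qed.

Lemma measurable_funV (f : T -> R) :
  measurable_fun setT f -> measurable_fun setT (fun t => (f t)^-1).
Proof.
(* Since [0^-1 = 0], the identity also holds at zeros of [f]; the power function then only sees the
   nonnegative [f^2]. *)
move=> mf; have -> : (fun t => (f t)^-1) = (fun t => f t * (f t ^+ 2) `^ (-1)).
  apply/funext => t; rewrite powR_inv1 ?sqr_ge0//.
  have [->|f0] := eqVneq (f t) 0; first by rewrite invr0 mul0r.
  by rewrite expr2 invfM mulrA divff// mul1r.
apply: measurable_funM => //.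
by apply: (measurableT_comp (measurable_powR _)); exact: measurable_funX.
Qed.

Lemma mmx_invmx n (A : T -> 'M[R]_n) : mmx A -> mmx (fun t => invmx (A t)).
Proof.
move=> mA i j; have mdet := measurable_det mA.
(* [invmx] returns the matrix itself when it is singular, whence the first branch. *)
have -> : (fun t => invmx (A t) i j) = (fun t =>
   if \det (A t) == 0 then A t i j else (\det (A t))^-1 * \adj (A t) i j).
  apply/funext => t; rewrite /invmx unitmxE unitfE.
  by case: eqP => //= _; rewrite !mxE.
apply: measurable_fun_ifT; first exact: measurable_fun_eqr.
  exact: mA.
apply: measurable_funM.
  exact: measurable_funV.
under eq_fun do rewrite !mxE.
apply: measurable_funM => //; apply: measurable_det => k l.
by under eq_fun do rewrite !mxE; exact: mA.
Qed.

Lemma measurable_dotcv n (u v : T -> 'cV[R]_n) :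
  mmx u -> mmx v -> measurable_fun setT (fun t => dotcv (u t) (v t)).
Proof. by move=> mu mv; apply: (mmx_mul (mmx_trmx mu) mv). Qed.

Lemma measurable_sqnorm_mx n (A : 'M[R]_n) (u : T -> 'cV[R]_n) :
  mmx u -> measurable_fun setT (fun t => sqnorm_mx A (u t)).
Proof.
move=> mu; under eq_fun do rewrite sqnorm_mxE.
apply: measurable_dotcv => //; exact: (mmx_mul (mmx_cst _) mu).
Qed.

End MeasurableMx.

(** * Laplace transform of a Gaussian quadratic form *)

Section Gaussian.
Context {R : realType} {d : measure_display} {T : measurableType d}
  (P : probability T R).

Definition iid_normal (I : finType) (g : I -> T -> R) : Prop :=
  (forall i, normal_rv P (g i) 0 1) /\
  forall B : I -> set R, (forall i, measurable (B i)) ->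
    P (\bigcap_i (g i @^-1` B i)) = (\prod_i P (g i @^-1` B i))%E.

Section Cons.
Context {N : nat} (g : 'I_N.+1 -> T -> R) (gN : iid_normal g).

Let tl (i : 'I_N) := g (lift ord0 i).

Let mg i : measurable_fun setT (g i). Proof. by have [] := proj1 gN i. Qed.

Let mpre i B : measurable B -> measurable (g i @^-1` B).
Proof. by move=> mB; rewrite -[_ @^-1` _]setTI; exact: mg. Qed.

Lemma bigcap_ord_recl (A : 'I_N.+1 -> set T) :
  \bigcap_i A i = A ord0 `&` \bigcap_i A (lift ord0 i).
Proof.
apply/seteqP; split=> [t At|t [A0 At] i _]; first by split=> [|i _]; exact: At.
by case: (unliftP ord0 i) => [j|] ->//; exact: At.
Qed.

Let consB (B0 : set R) (B : 'I_N -> set R) i : set R :=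
  if unlift ord0 i is Some j then B j else B0.

Let iid_cons B0 B : measurable B0 -> (forall i, measurable (B i)) ->
  P (g ord0 @^-1` B0 `&` \bigcap_i (tl i @^-1` B i)) =
  (P (g ord0 @^-1` B0) * \prod_i P (tl i @^-1` B i))%E.
Proof.
move=> mB0 mB.
have := proj2 gN (consB B0 B).
rewrite bigcap_ord_recl big_ord_recl /consB unlift_none.
under eq_bigr do rewrite liftK.
under eq_bigcapr do rewrite liftK.
by apply=> i; case: unliftP.
Qed.

Lemma iid_normal_tail : iid_normal tl.
Proof.
split=> [i|B mB]; first exact: (proj1 gN).
have := iid_cons measurableT mB.
by rewrite preimage_setT setTI probability_setT mul1e.
Qed.

(** The cylinder events form a pi-system, on which the product rule with [g ord0] is known. *)
Let cyl : set_system T :=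
  [set A | exists2 B : 'I_N -> set R, (forall i, measurable (B i)) &
     A = \bigcap_i (tl i @^-1` B i)].

Let cylI : setI_closed cyl.
Proof.
move=> _ _ [B mB ->] [C mC ->]; exists (fun i => B i `&` C i).
  by move=> i; exact: measurableI.
apply/seteqP; split=> t => [[tB tC] i _|tBC].
  by split; [exact: tB|exact: tC].
by split=> i _; have [] := tBC i Logic.I.
Qed.

Let mcyl A : cyl A -> measurable A.
Proof.
move=> [B mB ->]; apply: fin_bigcap_measurable => // i _; exact: mpre.
Qed.

(** The identity map into this space stands for all tail variables together, which reduces
    independence of [N + 1] variables to independence of two maps. *)
Let T1 := g_sigma_algebraType cyl.

Let cylT : cyl setT.
Proof.
exists (fun=> setT) => //; apply/seteqP; split=> // t _ i _ //.
Qed.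

Let mtl i : measurable_fun setT (tl i : T1 -> R).
Proof.
move=> _ B mB; rewrite setTI; apply: sub_sigma_algebra.
exists (fun j => if j == i then B else setT) => [j|]; first by case: eqP.
apply/seteqP; split=> t.
  by move=> tB j _; case: eqP => // ->.
by move=> /(_ i Logic.I); rewrite eqxx.
Qed.

Let mid : measurable_fun setT (id : T -> T1).
Proof.
move=> _ A mA; rewrite setTI /=.
have := @smallest_sub _ (sigma_algebra setT) cyl measurable; apply => //.
exact: sigma_algebra_measurable.
Qed.

(** In [A], both sides are finite measures (a restriction and a multiple of [P]) that agree on the
    pi-system [cyl]. *)
Let indep_tl : indep_maps P (id : T -> T1) (g ord0).
Proof.
move=> A B mA mB; rewrite preimage_id.
have mgB := mpre ord0 mB.
have pB0 : 0 <= fine (P (g ord0 @^-1` B)) by exact: fine_ge0.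
have -> : P (A `&` g ord0 @^-1` B) = mscale (NngNum pB0) P A.
  rewrite -[LHS]/(mrestr P mgB A).
  apply: (g_sigma_algebra_measure_unique cyl mcyl (fun=> setT)) => //.
  - by apply/seteqP; split=> // t _; exists 0%N.
  - move=> _ [C mC ->].
    transitivity (P (\bigcap_i (tl i @^-1` C i) `&` g ord0 @^-1` B)); first by [].
    rewrite setIC iid_cons// -(proj2 iid_normal_tail)//.
    have pE : P (g ord0 @^-1` B) = (fine (P (g ord0 @^-1` B)))%:E.
      by rewrite fineK ?fin_num_measure.
    exact: (congr1 (fun x => x * P (\bigcap_i (tl i @^-1` C i)))%E pE).
  - move=> _; apply: (@le_lt_trans _ _ (P (g ord0 @^-1` B))).
      by apply: le_measure => //; rewrite ?inE// setTI.
    by rewrite ltey_eq fin_num_measure.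
by rewrite /mscale /= fineK ?fin_num_measure// muleC.
Qed.

(** Fubini for the first variable. With no sigma-algebra chosen on ['I_N -> R], measurability of [h]
    is asked after composition with measurable coordinates from any space; the instance used is
    [T1 * R]. *)
Lemma ge0_integral_iid_cons (h : ('I_N -> R) * R -> R) :
  (forall z, 0 <= h z) ->
  (forall d' (T' : measurableType d') (u : 'I_N -> T' -> R) (x : T' -> R),
    (forall i, measurable_fun setT (u i)) -> measurable_fun setT x ->
    measurable_fun setT (fun z => h (u ^~ z, x z))) ->
  (\int[P]_t (h (tl ^~ t, g ord0 t))%:E =
   \int[P]_s \int[P]_t (h (tl ^~ s, g ord0 t))%:E)%E.
Proof.
move=> h0 mh.
apply: (@ge0_integral_indep _ _ _ P _ _ T1 _ id (g ord0) mid (mg ord0) indep_tl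
  (fun z => (h (tl ^~ z.1, z.2))%:E)).
  apply/measurable_EFinP.
  apply: (mh _ (T1 * R)%type (fun i z => tl i z.1) snd) => [i|].
    apply: (measurableT_comp (mtl i)); exact: measurable_fst.
  exact: measurable_snd.
by move=> z; rewrite lee_fin; exact: h0.
Qed.

End Cons.

(* Induction on [N]: integrate out the first variable, which replaces [M] by its
   Schur complement and contributes the factor [M_00^(-1/2)]. *)
Lemma gaussian_laplace N (g : 'I_N -> T -> R) (M : 'M[R]_N) :
  iid_normal g -> posdefmx M ->
  (\int[P]_t (expR ((dotcv (\col_i g i t) (\col_i g i t)
                     - sqnorm_mx M (\col_i g i t)) / 2))%:E =
   ((Num.sqrt (\det M))^-1)%:E)%E.
Proof.
elim: N g M => [|N IH] g M gN Mpd.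
  under eq_integral.
    move=> t _; rewrite sqnorm_mxE !dotcvE !big_ord0 subrr mul0r expR0; over.
  by rewrite det_mx00 sqrtr1 invr1 integral_cst//= probability_setT mule1.
have MT := proj1 Mpd.
have {}Mpd : posdefmx (M : 'M[R]_(1 + N)) := Mpd.
have a0 := posdef_diag_gt0 Mpd; set a := M 0 0 in a0.
set S := schur (M : 'M[R]_(1 + N)).
set b := @dlsubmx _ 1 N 1 N M.
have tlN := iid_normal_tail gN.
have Spd : posdefmx S := posdef_schur Mpd.
(* The exponent as a function of the tail variables plus a quadratic polynomial in the first
   variable. *)
pose h (z : ('I_N -> R) * R) := expR (
  (dotcv (\col_i z.1 i) (\col_i z.1 i) - sqnorm_mx S (\col_i z.1 i)) / 2
  - dotcv b (\col_i z.1 i) ^+ 2 / (2 * a)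
  + ((1 - a) / 2 * z.2 ^+ 2 - dotcv b (\col_i z.1 i) * z.2)).
transitivity (\int[P]_t (h ((fun i => g (lift ord0 i) t), g ord0 t))%:E)%E.
  apply: eq_integral => t _; congr ((expR _)%:E).
  have -> : \col_i g i t = col_mx (g ord0 t)%:M (\col_i g (lift ord0 i) t)
      :> 'cV[R]_(1 + N).
    rewrite -[LHS](@vsubmxK _ 1 N); congr col_mx; apply/matrixP => i j.
      rewrite !mxE (ord1 i) (ord1 j) eqxx mulr1n; congr (g _ t); exact: val_inj.
    by rewrite !mxE; congr (g _ t); exact: val_inj.
  rewrite (@sqnorm_mx_schur _ N M)// ?gt_eqF// (@dotcv_col_mx _ 1 N).
  rewrite dotcvE big_ord1 !mxE eqxx mulr1n -/a -/b -/S /=.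
  set G := \col_i g _ t; set x := g ord0 t.
  by field; rewrite gt_eqF.
rewrite ge0_integral_iid_cons//; last 2 first.
- by move=> z; exact: expR_ge0.
- move=> d' T' u x mu mx; rewrite /h; apply: measurableT_comp => //=.
  have mG : mmx (fun z : T' => \col_i u i z).
    by move=> i j; under eq_fun do rewrite mxE; exact: mu.
  have mbG : measurable_fun setT (fun z => dotcv b (\col_i u i z)).
    apply: measurable_dotcv => //; exact: mmx_cst.
  apply: measurable_funD; [apply: measurable_funB|apply: measurable_funB].
  + apply: measurable_funM => //; apply: measurable_funB.
      exact: measurable_dotcv.
    exact: measurable_sqnorm_mx.
  + by apply: measurable_funM => //; exact: measurable_funX.
  + by apply: measurable_funM => //; exact: measurable_funX.
  + exact: measurable_funM.
have aE : 1 ^- 2 - 2 * ((1 - a) / 2) = a by rewrite expr1n invr1; field.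
(* The factor [exp (be^2 / (2 a))] produced by the inner integral cancels the term that [h]
   subtracts. *)
transitivity (\int[P]_s (((Num.sqrt a)^-1)%:E * (expR
    ((dotcv (\col_i g (lift ord0 i) s) (\col_i g (lift ord0 i) s)
     - sqnorm_mx S (\col_i g (lift ord0 i) s)) / 2))%:E))%E.
  apply: eq_integral => s _; rewrite /h /=.
  under eq_integral do rewrite expRD EFinM.
  have mg0 : measurable_fun setT (g ord0) by have [] := proj1 gN ord0.
  set be := dotcv b _; set c0 := _ / 2.
  have key := @integral_normal_rv_exp_quad _ _ _ P (g ord0) 1 ((1 - a) / 2) be
    (proj1 gN ord0) ltr01.
  rewrite ge0_integralZl_EFin ?expR_ge0//.
  - rewrite key ?aE// -!EFinM mul1r mulrCA -expRD subrK mulrC; congr (_ * _)%:E.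
  - apply/measurable_EFinP; apply: measurableT_comp => //; apply: measurable_funB.
      by apply: measurable_funM => //; exact: measurable_funX.
    exact: measurable_funM.
rewrite ge0_integralZl_EFin ?invr_ge0 ?sqrtr_ge0//; last first.
- apply/measurable_EFinP; apply: measurableT_comp => //=.
  have mG : mmx (fun z : T => \col_i g (lift ord0 i) z).
    by move=> i j; under eq_fun do rewrite mxE; have [] := proj1 gN (lift ord0 i).
  apply: measurable_funM => //; apply: measurable_funB.
    exact: measurable_dotcv.
  exact: measurable_sqnorm_mx.
rewrite (IH _ _ tlN Spd) -EFinM (@det_schur _ N M)// ?gt_eqF//.
by rewrite sqrtrM ?(ltW a0)// invfM.
Qed.

End Gaussian.

(** * Chernoff bounds for linear images of Gaussian vectors *)

Section Gram.
Context {R : realType} {d : measure_display} {T : measurableType d}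
  (P : probability T R).

(** [D D^T] and [D^T D] obey the same bound: with [y = D x], Cauchy-Schwarz gives [|y|^4 <= |x|^2
    <y, D D^T y> <= c |x|^2 |y|^2]. *)
Lemma mulmx_gram_le m N (D : 'M[R]_(m, N)) c : 0 <= c ->
  (forall w, sqnorm_mx (D *m D^T) w <= c * dotcv w w) ->
  forall x, dotcv (D *m x) (D *m x) <= c * dotcv x x.
Proof.
move=> c0 Dc x; set y := D *m x.
have [->|y0] := eqVneq y 0; first by rewrite dotcv0l mulr_ge0 ?dotcv_ge0.
have yy : 0 < dotcv y y by rewrite dotcv_gt0.
have h1 : dotcv y y ^+ 2 <= dotcv x x * sqnorm_mx (D *m D^T) y.
  rewrite sqnorm_mxE -mulmxA [X in _ * X]dotcv_mulmxr.
  have -> : dotcv y y = dotcv x (D^T *m y) by rewrite {1}/y dotcv_mulmxl.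
  exact: dotcv_CS.
have h2 := Dc y.
rewrite -(ler_pM2r yy) -expr2 (le_trans h1)// -mulrA mulrCA ler_wpM2l ?dotcv_ge0//.
Qed.

Lemma ge0_markov (A : set T) (f : T -> R) :
  measurable A -> measurable_fun setT f -> (forall t, 0 <= f t) ->
  (forall t, A t -> 1 <= f t) -> (P A <= \int[P]_t (f t)%:E)%E.
Proof.
move=> mA mf f0 f1; rewrite -(setIT A) -integral_indic//.
apply: ge0_le_integral => //; try by move=> t _; rewrite lee_fin.
- exact/measurable_EFinP.
- exact/measurable_EFinP.
- move=> t _; rewrite lee_fin indicE; case: (boolP (t \in A)) => //= /set_mem.
  exact: f1.
Qed.

Variables (I : finType) (g : I -> T -> R).
Hypothesis gN : iid_normal P g.

Let gE (i : 'I_#|I|) := g (enum_val i).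

Let gEN : iid_normal P gE.
Proof.
split=> [i|B mB]; first exact: (proj1 gN).
have := proj2 gN (fun i => B (enum_rank i)) (fun i => mB _).
have -> : \bigcap_i (g i @^-1` B (enum_rank i)) = \bigcap_i (gE i @^-1` B i).
  apply/seteqP; split=> t H i _.
    by have := H (enum_val i) Logic.I; rewrite /= enum_valK.
  by have := H (enum_rank i) Logic.I; rewrite /= /gE enum_rankK.
move=> ->; rewrite (reindex (@enum_val I xpredT)) /=; last first.
  by exists enum_rank => i _; [exact: enum_valK|exact: enum_rankK].
by apply: eq_bigr => i _; rewrite enum_valK.
Qed.

Variables (m : nat) (D : 'I_m -> I -> R) (S : 'M[R]_m).
Hypothesis DS : forall r s, S r s = \sum_a D r a * D s a.

(** By [DS], a centred Gaussian vector with covariance [S]. *)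
Definition lincomb (t : T) : 'cV[R]_m := \col_r \sum_a D r a * g a t.

Let DE : 'M[R]_(m, #|I|) := \matrix_(r, a) D r (enum_val a).

Let DES : DE *m DE^T = S.
Proof.
apply/matrixP => r s; rewrite mxE DS [RHS](reindex (@enum_val I xpredT)) /=.
  by apply: eq_bigr => a _; rewrite !mxE.
by exists enum_rank => i _; [exact: enum_valK|exact: enum_rankK].
Qed.

Let lincombE t : lincomb t = DE *m \col_a gE a t.
Proof.
apply/colP => r; rewrite !mxE (reindex (@enum_val I xpredT)) /=.
  by apply: eq_bigr => a _; rewrite !mxE.
by exists enum_rank => i _; [exact: enum_valK|exact: enum_rankK].
Qed.

Lemma measurable_lincomb : mmx lincomb.
Proof.
move=> r j; under eq_fun do rewrite mxE; apply: measurable_sum => a.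
by apply: measurable_funM => //; have [] := proj1 gN a.
Qed.

(** The Gaussian integral yields a determinant in [D^T D], of size [#|I|]; Sylvester's identity
    turns it into one in the covariance [S = D D^T]. *)
Lemma gram_laplace x : posdefmx (1%:M + (2 * x) *: (DE^T *m DE)) ->
  (\int[P]_t (expR (- x * dotcv (lincomb t) (lincomb t)))%:E =
   ((Num.sqrt (\det (1%:M + (2 * x) *: S)))^-1)%:E)%E.
Proof.
move=> Mpd.
have -> : 1%:M + (2 * x) *: S = 1%:M + DE *m ((2 * x) *: DE^T).
  by rewrite -scalemxAr DES.
rewrite det_one_add_mulC -scalemxAl -(gaussian_laplace gEN Mpd).
apply: eq_integral => t _; congr ((expR _)%:E).
rewrite lincombE; set G := \col_a _.
rewrite sqnorm_mxE mulmxDl mul1mx dotcvDr -scalemxAl dotcvZr -mulmxA (dotcv_mulmxr DE^T).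
by rewrite trmxK; field.
Qed.

Let DED_sym x : (1%:M + x *: (DE^T *m DE))^T = 1%:M + x *: (DE^T *m DE).
Proof. by rewrite linearD linearZ /= trmx_mul trmxK trmx1. Qed.

Let DEDE x v : sqnorm_mx (1%:M + x *: (DE^T *m DE)) v =
  dotcv v v + x * dotcv (DE *m v) (DE *m v).
Proof.
by rewrite sqnorm_mxE mulmxDl mul1mx dotcvDr -scalemxAl dotcvZr -mulmxA
  (dotcv_mulmxr DE^T) trmxK.
Qed.

Lemma measurable_lincomb_sqr :
  measurable_fun setT (fun t => dotcv (lincomb t) (lincomb t)).
Proof. by apply: measurable_dotcv; exact: measurable_lincomb. Qed.

Lemma lincomb_lower_tail x z B : 0 <= x -> 0 < B ->
  B <= \det (1%:M + (2 * x) *: S) ->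
  (P [set t | (dotcv (lincomb t) (lincomb t) <= z)%R] <=
   (expR (x * z) * (Num.sqrt B)^-1)%:E)%E.
Proof.
move=> x0 B0 SB.
have pd : posdefmx (1%:M + (2 * x) *: (DE^T *m DE)).
  split=> // v v0; rewrite DEDE ltr_wpDr ?dotcv_gt0// mulr_ge0 ?dotcv_ge0//.
  by rewrite mulr_ge0.
have mQ := measurable_lincomb_sqr.
apply: (@le_trans _ _ (\int[P]_t (expR (x * z) *
    expR (- x * dotcv (lincomb t) (lincomb t)))%:E)%E).
  apply: ge0_markov.
  - by rewrite -[X in measurable X]setTI; apply: measurable_fun_le.
  - apply: measurable_funM => //; apply: measurableT_comp => //.
    exact: measurable_funM.
  - by move=> t; rewrite mulr_ge0 ?expR_ge0.
  - move=> t /= tz; rewrite -expRD -expR0 ler_expR mulNr subr_ge0.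
    by rewrite ler_wpM2l.
under eq_integral do rewrite EFinM.
rewrite ge0_integralZl_EFin ?expR_ge0//; last first.
  apply/measurable_EFinP; apply: measurableT_comp => //.
  exact: measurable_funM.
rewrite gram_laplace// -EFinM lee_fin ler_wpM2l ?expR_ge0//.
by rewrite lef_pV2 ?posrE ?sqrtr_gt0 ?ler_wsqrtr//; exact: lt_le_trans SB.
Qed.

Lemma lincomb_upper_tail x z c B : 0 <= x -> 0 <= c -> 2 * x * c < 1 ->
  (forall w, sqnorm_mx S w <= c * dotcv w w) ->
  0 < B -> B <= \det (1%:M - (2 * x) *: S) ->
  (P [set t | (z <= dotcv (lincomb t) (lincomb t))%R] <=
   (expR (- (x * z)) * (Num.sqrt B)^-1)%:E)%E.
Proof.
move=> x0 c0 xc Sc B0 SB.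
(* [2 x c < 1] is what keeps this matrix positive definite, so that the exponential moment is
   finite. *)
have pd : posdefmx (1%:M + (2 * - x) *: (DE^T *m DE)).
  split=> // v v0; rewrite DEDE mulrN mulNr subr_gt0.
  have h := @mulmx_gram_le _ _ DE c c0; rewrite DES in h.
  apply: (@le_lt_trans _ _ (2 * x * (c * dotcv v v))).
    by rewrite ler_wpM2l ?h// mulr_ge0.
  by rewrite mulrA -[ltRHS]mul1r ltr_pM2r// dotcv_gt0.
have mQ := measurable_lincomb_sqr.
apply: (@le_trans _ _ (\int[P]_t (expR (- (x * z)) *
    expR (- - x * dotcv (lincomb t) (lincomb t)))%:E)%E).
  apply: ge0_markov.
  - by rewrite -[X in measurable X]setTI; apply: measurable_fun_le.
  - apply: measurable_funM => //; apply: measurableT_comp => //.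
    exact: measurable_funM.
  - by move=> t; rewrite mulr_ge0 ?expR_ge0.
  - move=> t /= tz; rewrite -expRD -expR0 ler_expR opprK addrC subr_ge0.
    by rewrite ler_wpM2l.
under eq_integral do rewrite EFinM.
rewrite ge0_integralZl_EFin ?expR_ge0//; last first.
  apply/measurable_EFinP; apply: measurableT_comp => //.
  exact: measurable_funM.
rewrite gram_laplace// -EFinM lee_fin ler_wpM2l ?expR_ge0//.
rewrite mulrN scaleNr.
by rewrite lef_pV2 ?posrE ?sqrtr_gt0 ?ler_wsqrtr//; exact: lt_le_trans SB.
Qed.

End Gram.

(** * Deviation bounds for the whitened design in a fixed direction *)

Section Columns.
Context {R : realType} {d : measure_display} {T : measurableType d}
  (P : probability T R).
Variable eps : R.
Hypotheses (eps0 : 0 < eps) (eps1 : eps <= 1).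

Lemma sqrtr_expR (a : R) : Num.sqrt (expR a) = expR (a / 2).
Proof.
have -> : a = a / 2 * 2%:R by field.
by rewrite mulfK// expRM_natr sqrtr_sqr ger0_norm// expR_ge0.
Qed.

Lemma expR_le1D2x (y : R) : y <= 2^-1 -> 0 <= y -> expR y <= 1 + 2 * y.
Proof.
move=> y2 y0; have y1 : 0 < 1 - y by lra.
have h1 : expR y * (1 - y) <= 1.
  rewrite -[leRHS](expRxMexpNx_1 y) ler_wpM2l ?expR_ge0//.
  by rewrite (le_trans _ (expR_ge1Dx _)).
have h2 : 1 <= (1 + 2 * y) * (1 - y).
  have : 0 <= y * (1 - 2 * y) by rewrite mulr_ge0//; lra.
  lra.
by rewrite -(ler_pM2r y1) (le_trans h1).
Qed.

Lemma expRN2x_le (y : R) : y <= 2^-1 -> 0 <= y -> expR (- (2 * y)) <= 1 - y.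
Proof.
move=> y2 y0; have y1 : 0 < 1 + 2 * y by lra.
have h1 : (1 + 2 * y) * expR (- (2 * y)) <= 1.
  by rewrite -[leRHS](expRxMexpNx_1 (2 * y)) ler_wpM2r ?expR_ge0// expR_ge1Dx.
have h2 : 1 <= (1 + 2 * y) * (1 - y).
  have : 0 <= y * (1 - 2 * y) by rewrite mulr_ge0//; lra.
  lra.
by rewrite -(ler_pM2l y1) (le_trans h1).
Qed.

Section Tails.
Variables (I : finType) (g : I -> T -> R) (gN : iid_normal P g).
Variables (m : nat) (D : 'I_m -> I -> R) (S : 'M[R]_m).
Hypothesis DS : forall r s, S r s = \sum_a D r a * D s a.
Variables (kappa U : R).
Hypotheses (kappa0 : 0 <= kappa) (U0 : 0 < U).

(** Here [U] is the scale of the covariance and [kappa] an effective dimension. Chernoff at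
    [2 x = 1 / U] has exponent [eps kappa / 8 - eps kappa / 4]. *)
Lemma lincomb_lower_exp : expR (eps * kappa / 2) <= \det (1%:M + U^-1 *: S) ->
  (P [set t | (dotcv (lincomb g D t) (lincomb g D t) <= eps / 4 * kappa * U)%R] <=
   (expR (- (eps * kappa / 8)))%:E)%E.
Proof.
move=> detS; pose x := U^-1 / 2.
have x0 : 0 <= x by rewrite divr_ge0// invr_ge0 ltW.
have x2 : 2 * x = U^-1 by rewrite /x; field; rewrite gt_eqF.
have := lincomb_lower_tail gN DS (eps / 4 * kappa * U) x0 (expR_gt0 (eps * kappa / 2)).
rewrite x2 => /(_ detS)/le_trans; apply; rewrite lee_fin sqrtr_expR -expRN -expRD ler_expR.
by rewrite [leLHS](_ : _ = - (eps * kappa / 8))// /x; field; rewrite gt_eqF.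
Qed.

(** Chernoff at [2 x = eps / (2 U)], half of the admissible range as [S <= U / eps]; the exponent is
    [- 3 kappa / 2 + kappa / 2]. *)
Lemma lincomb_upper_exp :
  (forall w, sqnorm_mx S w <= U / eps * dotcv w w) ->
  expR (- kappa) <= \det (1%:M - (eps / (2 * U)) *: S) ->
  (P [set t | (6 / eps * kappa * U <= dotcv (lincomb g D t) (lincomb g D t))%R] <=
   (expR (- (eps * kappa / 8)))%:E)%E.
Proof.
move=> Sle detS; pose x := eps / (4 * U).
have x0 : 0 <= x by rewrite divr_ge0// ltW// mulr_gt0.
have x2 : 2 * x = eps / (2 * U) by rewrite /x; field; rewrite gt_eqF.
have c0 : 0 <= U / eps by rewrite divr_ge0 ?ltW.
have xc : 2 * x * (U / eps) < 1.
  have -> : 2 * x * (U / eps) = 2^-1 by rewrite /x; field; rewrite !gt_eqF.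
  by rewrite invf_lt1// ltr1n.
have := lincomb_upper_tail gN DS (6 / eps * kappa * U) x0 c0 xc Sle (expR_gt0 (- kappa)).
rewrite x2 => /(_ detS)/le_trans; apply; rewrite lee_fin sqrtr_expR -expRN -expRD ler_expR.
have -> : - (x * (6 / eps * kappa * U)) - - kappa / 2 = - kappa.
  by rewrite /x; field; rewrite !gt_eqF.
rewrite lerN2; have : 0 <= kappa * (1 - eps) by rewrite mulr_ge0// subr_ge0.
by move: kappa0; lra.
Qed.

End Tails.

Variables (n p : nat) (B : 'I_p -> 'M[R]_n) (z : 'I_p -> T -> 'cV[R]_n).
Hypothesis zN : iid_normal P (fun (ji : 'I_p * 'I_n) t => z ji.1 t ji.2 0).
Hypothesis BB : forall j w,
  eps * dotcv w w <= sqnorm_mx (B j *m (B j)^T) w <= eps^-1 * dotcv w w.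

Definition whitened (t : T) : 'M[R]_(n, p) := \matrix_(i, j) (B j *m z j t) i 0.

Local Notation Z := whitened.

Let expR_half_eps : expR (eps / 2) <= 1 + eps.
Proof.
have -> : 1 + eps = 1 + 2 * (eps / 2) by field.
by apply: expR_le1D2x; move: eps0 eps1; lra.
Qed.

Let le_sub_half (a x : R) : x <= 2^-1 * a -> 2^-1 * a <= a - x.
Proof. lra. Qed.

Section Comb.
Variable u : 'cV[R]_p.
Hypothesis u0 : u != 0.

Let U := dotcv u u.
Let U0 : 0 < U. Proof. by rewrite dotcv_gt0. Qed.
Let D (r : 'I_n) (ji : 'I_p * 'I_n) := u ji.1 0 * B ji.1 r ji.2.
Let S : 'M[R]_n := \sum_j u j 0 ^+ 2 *: (B j *m (B j)^T).

Let DS r s : S r s = \sum_a D r a * D s a.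
Proof.
rewrite summxE -(pair_bigA _ (fun j i => D r (j, i) * D s (j, i))) /=.
apply: eq_bigr => j _; rewrite !mxE mulr_sumr; apply: eq_bigr => i _.
by rewrite /D /= !mxE; ring.
Qed.

Let lincombE t : lincomb (fun (ji : 'I_p * 'I_n) t => z ji.1 t ji.2 0) D t = Z t *m u.
Proof.
apply/colP => r; rewrite !mxE.
rewrite -(pair_bigA _ (fun j i => D r (j, i) * z j t i 0)) /=.
apply: eq_bigr => j _; rewrite !mxE mulr_suml; apply: eq_bigr => i _.
by rewrite /D /=; ring.
Qed.

Let sqnormS w : sqnorm_mx S w = \sum_j u j 0 ^+ 2 * sqnorm_mx (B j *m (B j)^T) w.
Proof.
rewrite sqnorm_mxE mulmx_suml (big_morph (dotcv w) (dotcvDr w) (dotcv0r w)).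
by apply: eq_bigr => j _; rewrite -scalemxAl dotcvZr sqnorm_mxE.
Qed.

Let S_ge w : eps * U * dotcv w w <= sqnorm_mx S w.
Proof.
rewrite sqnormS /U [dotcv u u]dotcvvE mulr_sumr mulr_suml; apply: ler_sum => j _.
have /andP[h _] := BB j w.
have -> : eps * u j 0 ^+ 2 * dotcv w w = u j 0 ^+ 2 * (eps * dotcv w w) by ring.
by rewrite ler_wpM2l ?sqr_ge0.
Qed.

Let S_le w : sqnorm_mx S w <= U / eps * dotcv w w.
Proof.
rewrite sqnormS /U [dotcv u u]dotcvvE !mulr_suml; apply: ler_sum => j _.
have /andP[_ h] := BB j w.
by rewrite -mulrA ler_wpM2l ?sqr_ge0.
Qed.

Let S_sym : S^T = S.
Proof.
rewrite /S linear_sum; apply: eq_bigr => j _.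
by rewrite linearZ /= trmx_mul trmxK.
Qed.

(** The covariance of [Z u] is [n]-dimensional and at least [eps |u|^2], so the effective dimension
    is [n] and the determinant is at least [(1 + eps)^n >= exp (eps n / 2)]. *)
Lemma comb_lower :
  (P [set t | (dotcv (Z t *m u) (Z t *m u) <= eps / 4 * n%:R * dotcv u u)%R] <=
   (expR (- (eps * n%:R / 8)))%:E)%E.
Proof.
under eq_set do rewrite -lincombE.
apply: (lincomb_lower_exp zN DS) => //.
apply: (@le_trans _ _ ((1 + eps) ^+ n)).
  rewrite -mulrA [n%:R / 2]mulrC mulrA expRM_natr lerXn2r ?nnegrE ?expR_ge0//.
    by rewrite addr_ge0// ltW.
apply: det_ge_expr.
- by rewrite linearD linearZ /= S_sym trmx1.
- by rewrite addr_gt0.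
- move=> v; rewrite sqnorm_mxE mulmxDl mul1mx dotcvDr -scalemxAl dotcvZr -sqnorm_mxE.
  rewrite mulrDl mul1r lerD2l -(ler_pM2l U0) [leRHS]mulrA divff ?gt_eqF// mul1r.
  by rewrite mulrA (mulrC U).
Qed.

Lemma comb_upper :
  (P [set t | (6 / eps * n%:R * dotcv u u <= dotcv (Z t *m u) (Z t *m u))%R] <=
   (expR (- (eps * n%:R / 8)))%:E)%E.
Proof.
under eq_set do rewrite -lincombE.
apply: (lincomb_upper_exp zN DS) => //.
apply: (@le_trans _ _ (2^-1 ^+ n)).
  rewrite -mulN1r expRM_natr lerXn2r ?nnegrE ?expR_ge0//.
  have := @expRN2x_le (2^-1) (lexx _).
  have -> : 2 * 2^-1 = 1 :> R by field.
  have -> : 1 - 2^-1 = 2^-1 :> R by field.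
  exact.
apply: det_ge_expr => //.
- by rewrite linearB linearZ /= S_sym trmx1.
- move=> v; rewrite sqnorm_mxE mulmxBl mul1mx dotcvDr dotcvNr -scalemxAl dotcvZr -sqnorm_mxE.
  apply: le_sub_half.
    have -> : 2^-1 * dotcv v v = eps / (2 * U) * (U / eps * dotcv v v).
      by field; rewrite !gt_eqF.
    by rewrite ler_wpM2l// divr_ge0// ltW// mulr_gt0.
Qed.

End Comb.

Section Tail.
Variables (l : 'I_p -> R) (lmax : R) (v : 'cV[R]_n).
Hypotheses (l0 : forall j, 0 <= l j) (llmax : forall j, l j <= lmax).
Hypotheses (lmax0 : 0 < lmax) (v0 : v != 0).

Let U := lmax * dotcv v v.
Let U0 : 0 < U. Proof. by rewrite mulr_gt0// dotcv_gt0. Qed.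
Let kappa := (\sum_j l j) / lmax.
Let kappa0 : 0 <= kappa.
Proof. by rewrite divr_ge0 ?sumr_ge0// ltW. Qed.

Let D (r : 'I_p) (ji : 'I_p * 'I_n) :=
  if r == ji.1 then Num.sqrt (l r) * ((B r)^T *m v) ji.2 0 else 0.
Let w j := sqnorm_mx (B j *m (B j)^T) v.
Let S : 'M[R]_p := diag_mx (\row_j (l j * w j)).

(** Its squared norm is [v^T Z diag(l) Z^T v]. Its coordinates are independent because the columns
    of [Z] are, so the covariance is diagonal. *)
Definition tail_vec (t : T) : 'cV[R]_p :=
  diag_mx (\row_j Num.sqrt (l j)) *m (Z t)^T *m v.

Let DS r s : S r s = \sum_a D r a * D s a.
Proof.
rewrite -(pair_bigA _ (fun j i => D r (j, i) * D s (j, i))) /=.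
rewrite (bigD1 r)//= [X in _ + X]big1 ?addr0; last first.
  move=> j jr; rewrite big1// => i _; rewrite /D /= eq_sym (negbTE jr).
  by rewrite mul0r.
rewrite !mxE; have [<-|rs] := eqVneq r s; last first.
  by rewrite mulr0n big1// => i _; rewrite /D /= [s == r]eq_sym (negbTE rs) mulr0.
rewrite mulr1n /w sqnorm_mxE -mulmxA (dotcv_mulmxr (B r)) dotcvE mulr_sumr.
apply: eq_bigr => i _; rewrite /D /= eqxx.
by rewrite [RHS]mulrACA -[X in _ = X * _]expr2 sqr_sqrtr.
Qed.

Let lincombE t : lincomb (fun (ji : 'I_p * 'I_n) t => z ji.1 t ji.2 0) D t = tail_vec t.
Proof.
apply/colP => r; rewrite /tail_vec -mulmxA mul_diag_mx !mxE.
rewrite -(pair_bigA _ (fun j i => D r (j, i) * z j t i 0)) /=.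
rewrite (bigD1 r)//= [X in _ + X]big1 ?addr0; last first.
  move=> j jr; rewrite big1// => i _; rewrite /D /= eq_sym (negbTE jr).
  by rewrite mul0r.
have -> : \sum_j (Z t)^T r j * v j 0 = dotcv (B r *m z r t) v.
  by rewrite dotcvE; apply: eq_bigr => j _; rewrite 2!mxE.
rewrite dotcv_mulmxl dotcvE mulr_sumr; apply: eq_bigr => i _.
by rewrite /D /= eqxx; ring.
Qed.

Let w_bounds j : eps * dotcv v v <= w j <= eps^-1 * dotcv v v.
Proof. exact: BB. Qed.

Let sum_expR (a : 'I_p -> R) : \prod_j expR (a j) = expR (\sum_j a j).
Proof. by rewrite (big_morph _ (@expRD R) (@expR0 R)). Qed.

(** Each diagonal factor is at least [1 + eps l_j / lmax >= exp (eps l_j / (2 lmax))]. The exponents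
    add up to [eps kappa / 2], where [kappa] is the effective rank, equal to [r_k] for the truncated
    spectrum. *)
Lemma tail_lower :
  (P [set t | (dotcv (tail_vec t) (tail_vec t) <=
       eps / 4 * (\sum_j l j) * dotcv v v)%R] <=
   (expR (- (eps * kappa / 8)))%:E)%E.
Proof.
under eq_set do rewrite -lincombE.
have -> : eps / 4 * (\sum_j l j) * dotcv v v = eps / 4 * kappa * U.
  by rewrite /kappa /U; field; rewrite gt_eqF.
apply: (lincomb_lower_exp zN DS) => //.
have -> : 1%:M + U^-1 *: S = diag_mx (\row_j (1 + U^-1 * (l j * w j))).
  apply/matrixP => i j; rewrite !mxE; case: eqP => _; first by rewrite !mulr1n.
  by rewrite !mulr0n mulr0 addr0.
rewrite det_diag.
have -> : eps * kappa / 2 = \sum_j (eps * l j / (2 * lmax)).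
  rewrite -mulr_suml -mulr_sumr /kappa; field; rewrite gt_eqF//.
rewrite -sum_expR; apply: ler_prod => j _; rewrite expR_ge0 /= mxE.
have lj : 0 <= eps * l j / (2 * lmax) <= 2^-1.
  rewrite divr_ge0 ?mulr_ge0 ?(ltW eps0) ?(ltW lmax0)//=.
  rewrite ler_pdivrMr ?mulr_gt0// mulKf// -[leRHS]mul1r.
  by rewrite ler_pM ?(ltW eps0).
have /andP[lj0 lj1] := lj.
apply: (le_trans (expR_le1D2x lj1 lj0)); rewrite lerD2l.
have -> : 2 * (eps * l j / (2 * lmax)) = U^-1 * (l j * (eps * dotcv v v)).
  by rewrite /U; field; rewrite !gt_eqF ?dotcv_gt0.
rewrite ler_wpM2l ?invr_ge0 ?(ltW U0)// ler_wpM2l//.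
by have /andP[] := w_bounds j.
Qed.

Lemma tail_upper :
  (P [set t | (6 / eps * (\sum_j l j) * dotcv v v <=
       dotcv (tail_vec t) (tail_vec t))%R] <=
   (expR (- (eps * kappa / 8)))%:E)%E.
Proof.
under eq_set do rewrite -lincombE.
have -> : 6 / eps * (\sum_j l j) * dotcv v v = 6 / eps * kappa * U.
  by rewrite /kappa /U; field; rewrite !gt_eqF.
apply: (lincomb_upper_exp zN DS) => //.
  move=> x; rewrite sqnorm_mxE mul_diag_mx [leLHS]dotcvE [dotcv x x]dotcvE mulr_sumr.
  apply: ler_sum => j _; rewrite !mxE.
  have -> : x j 0 * (l j * w j * x j 0) = l j * w j * (x j 0) ^+ 2 by ring.
  rewrite -expr2 ler_wpM2r ?sqr_ge0// /U -mulrA [_ / eps]mulrC.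
  have /andP[h1 h2] := w_bounds j.
  rewrite ler_pM//; apply: le_trans h1.
  by rewrite mulr_ge0 ?dotcv_ge0 ?ltW.
have -> : 1%:M - (eps / (2 * U)) *: S = diag_mx (\row_j (1 - (eps / (2 * U)) * (l j * w j))).
  apply/matrixP => i j; rewrite !mxE; case: eqP => _; first by rewrite !mulr1n.
  by rewrite !mulr0n mulr0 subr0.
rewrite det_diag.
have -> : - kappa = \sum_j (- (2 * (l j / (2 * lmax)))).
  rewrite sumrN -mulr_sumr -mulr_suml /kappa; congr (- _); field; rewrite gt_eqF//.
rewrite -sum_expR; apply: ler_prod => j _; rewrite expR_ge0 /= mxE.
have lj : 0 <= l j / (2 * lmax) <= 2^-1.
  rewrite divr_ge0 ?mulr_ge0 ?(ltW lmax0)//=.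
  by rewrite ler_pdivrMr ?mulr_gt0// mulKf.
have /andP[lj0 lj1] := lj.
apply: (le_trans (expRN2x_le lj1 lj0)); rewrite lerD2l lerN2.
have -> : l j / (2 * lmax) = eps / (2 * U) * (l j * (eps^-1 * dotcv v v)).
  by rewrite /U; field; rewrite !gt_eqF ?dotcv_gt0.
have k0 : 0 <= eps / (2 * U) by rewrite divr_ge0 ?(ltW eps0)// mulr_ge0// ltW.
rewrite ler_wpM2l// ler_wpM2l//.
by have /andP[] := w_bounds j.
Qed.

End Tail.
End Columns.

(** * From fixed directions to all directions *)

Section NetEvent.
Context {R : realType}.

(** Restricted to the finite net, hence measurable; the bounds in all directions follow
    deterministically. *)
Definition net_event (T : Type) M m (h lo up : R) K (L : T -> 'M[R]_(M, m)) : set T :=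
  [set t | forall f, f \in lattice m K ->
    lo * dotcv (latpt h f) (latpt h f) <= dotcv (L t *m latpt h f) (L t *m latpt h f) /\
    dotcv (L t *m latpt h f) (L t *m latpt h f) <= up * dotcv (latpt h f) (latpt h f)].

Lemma measurable_net_event d (T : measurableType d) M m h lo up K
    (L : T -> 'M[R]_(M, m)) : mmx L -> measurable (net_event h lo up K L).
Proof.
move=> mL.
have -> : net_event h lo up K L = \bigcap_(f in [set f | f \in lattice m K])
    ([set t | lo * dotcv (latpt h f) (latpt h f) <=
       dotcv (L t *m latpt h f) (L t *m latpt h f)] `&`
     [set t | dotcv (L t *m latpt h f) (L t *m latpt h f) <=
       up * dotcv (latpt h f) (latpt h f)]).
  by [].
apply: fin_bigcap_measurable => [|f _]; first exact: finite_finset.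
have mLf : measurable_fun setT (fun t => dotcv (L t *m latpt h f) (L t *m latpt h f)).
  by apply: measurable_dotcv; apply: mmx_mul => //; exact: mmx_cst.
by apply: measurableI; rewrite -[X in measurable X]setTI; apply: measurable_fun_le.
Qed.

Lemma probability_bigsetU_le d (T : measurableType d) (P : probability T R)
    (I : Type) (s : seq I) (A : I -> set T) : (forall i, measurable (A i)) ->
  (P (\big[setU/set0]_(i <- s) A i) <= \sum_(i <- s) P (A i))%E.
Proof.
move=> mA; elim: s => [|i s IH]; first by rewrite !big_nil measure0.
rewrite !big_cons (le_trans (measureU2 _ _ _))//; last exact: leeD2l.
exact: bigsetU_measurable.
Qed.

Lemma net_event_prob d (T : measurableType d) (P : probability T R) M m (h lo up rho : R) K
    (L : T -> 'M[R]_(M, m)) : mmx L -> 0 <= rho ->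
  (forall w : 'cV[R]_m, w != 0 ->
    (P [set t | (dotcv (L t *m w) (L t *m w) <= lo * dotcv w w)%R] <= rho%:E)%E) ->
  (forall w : 'cV[R]_m, w != 0 ->
    (P [set t | (up * dotcv w w <= dotcv (L t *m w) (L t *m w))%R] <= rho%:E)%E) ->
  (P (~` net_event h lo up K L) <= ((3 * 2 ^+ K) ^+ m * (2 * rho))%:E)%E.
Proof.
move=> mL rho0 Hlo Hup.
(* The lattice contains the zero vector, where both bounds hold trivially but the strict tail events
   do not exclude failure. *)
pose bad (f : {ffun 'I_m -> 'I_((K * m).*2.+1)}) := [set t | latpt h f != 0 /\
   (dotcv (L t *m latpt h f) (L t *m latpt h f) <= lo * dotcv (latpt h f) (latpt h f) \/
    up * dotcv (latpt h f) (latpt h f) <= dotcv (L t *m latpt h f) (L t *m latpt h f))].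
have mQ w : measurable_fun setT (fun t => dotcv (L t *m w) (L t *m w)).
  by apply: measurable_dotcv; apply: mmx_mul => //; exact: mmx_cst.
have mlo w : measurable [set t | dotcv (L t *m w) (L t *m w) <= lo * dotcv w w].
  by rewrite -[X in measurable X]setTI; apply: measurable_fun_le.
have mup w : measurable [set t | up * dotcv w w <= dotcv (L t *m w) (L t *m w)].
  by rewrite -[X in measurable X]setTI; apply: measurable_fun_le.
have badE f : bad f = if latpt h f == 0 then set0 else
    [set t | dotcv (L t *m latpt h f) (L t *m latpt h f) <= lo * dotcv (latpt h f) (latpt h f)]
    `|` [set t | up * dotcv (latpt h f) (latpt h f) <= dotcv (L t *m latpt h f) (L t *m latpt h f)].
  rewrite /bad; case: eqP => w0; apply/seteqP; split=> t //=.
  - by case.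
  - by case.
have mbad f : measurable (bad f).
  by rewrite badE; case: eqP => // _; exact: measurableU.
have Pbad f : (P (bad f) <= (2 * rho)%:E)%E.
  rewrite badE; case: eqP => [_|/eqP w0]; first by rewrite measure0 lee_fin mulr_ge0.
  apply: (le_trans (measureU2 _ _ _)) => //.
  have -> : 2 * rho = rho + rho by ring.
  by rewrite EFinD leeD// ?Hlo ?Hup.
apply: (@le_trans _ _ (P (\big[setU/set0]_(f <- enum (lattice m K)) bad f))).
  apply: le_measure; rewrite ?inE.
  - exact/measurableC/measurable_net_event.
  - exact: bigsetU_measurable.
  move=> t; rewrite -bigcup_seq => /existsNP[f /not_implyP[fS H]].
  exists f; first by rewrite /= mem_enum.
  have w0 : latpt h f != 0.
    apply/eqP => w0; apply: H; rewrite w0 mulmx0 !dotcv0l !mulr0; by split.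
  split=> //; case: (lerP (up * dotcv (latpt h f) (latpt h f))
    (dotcv (L t *m latpt h f) (L t *m latpt h f))) => h1; first by right.
  left; case: (lerP (dotcv (L t *m latpt h f) (L t *m latpt h f))
    (lo * dotcv (latpt h f) (latpt h f))) => // h2.
  by exfalso; apply: H; split; exact: ltW.
apply: (le_trans (probability_bigsetU_le _ _ mbad)).
apply: (@le_trans _ _ (\sum_(f <- enum (lattice m K)) (2 * rho)%:E)).
  by apply: lee_sum => f _; exact: Pbad.
rewrite sumEFin big_enum sumr_const /= lee_fin -[_ *+ #|_|]mulr_natl ler_wpM2r ?mulr_ge0//.
exact: card_lattice.
Qed.

(** The net bounds for norms, squared: [1/4] becomes [1/16], [3] becomes [9], and [12 g h <= gl]
    becomes [144 up h^2 <= lo]. *)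
Lemma net_event_bounds (T : Type) M m h lo up K (L : T -> 'M[R]_(M, m)) t :
  0 < h -> h <= 2^-1 -> (1 + h^-1) ^+ 2 <= K%:R -> 0 <= lo -> 0 <= up ->
  144 * up * h ^+ 2 <= lo -> net_event h lo up K L t ->
  forall v, lo / 16 * dotcv v v <= dotcv (L t *m v) (L t *m v) <= 9 * up * dotcv v v.
Proof.
move=> h0 h2 hK lo0 up0 loup H v.
have sl : Num.sqrt lo ^+ 2 = lo by rewrite sqr_sqrtr.
have su : Num.sqrt up ^+ 2 = up by rewrite sqr_sqrtr.
have Hup f : f \in lattice m K ->
    l2norm (L t *m latpt h f) <= Num.sqrt up * l2norm (latpt h f).
  move=> fS; rewrite -[leLHS]mul1r ler_l2norm_sqr ?sqrtr_ge0// su expr1n mul1r.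
  by have [] := H f fS.
have Hlo f : f \in lattice m K ->
    Num.sqrt lo * l2norm (latpt h f) <= l2norm (L t *m latpt h f).
  move=> fS; rewrite -[leRHS]mul1r ler_l2norm_sqr ?sqrtr_ge0// sl expr1n mul1r.
  by have [] := H f fS.
apply/andP; split.
  have : Num.sqrt lo / 4 * l2norm v <= 1 * l2norm (L t *m v).
    rewrite mul1r; apply: (l2norm_ge_lattice h0 h2 hK _ _ _ Hup Hlo); rewrite ?sqrtr_ge0//.
    rewrite -(@ler_pXn2r _ 2) ?nnegrE ?mulr_ge0 ?sqrtr_ge0 ?(ltW h0)//.
    by rewrite !exprMn su sl -natrX.
  rewrite ler_l2norm_sqr ?divr_ge0 ?sqrtr_ge0// expr1n mul1r exprMn sl exprVn -natrX.
  by [].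
have L3 := opnorm_lattice h0 h2 hK (sqrtr_ge0 _) Hup.
have : 1 * l2norm (L t *m v) <= 3 * Num.sqrt up * l2norm v.
  by rewrite mul1r (le_trans (opnormP _ _))// ler_wpM2r ?l2norm_ge0.
rewrite ler_l2norm_sqr ?mulr_ge0 ?sqrtr_ge0// expr1n mul1r exprMn su -natrX.
by [].
Qed.

End NetEvent.

(** * Elementary inequalities for the deterministic bound *)

Section Arithmetic.
Context {R : realType}.
Implicit Types a b c e : R.

Lemma arith_N2 (A B C D E F G H : R) : E = A - B - C -> - B <= E / 4 + F ->
  D <= E / 8 -> A <= D + G -> - C <= D + H -> E <= 2 * G + 2 * H + 2 * F.
Proof. lra. Qed.

Lemma arith_parallelogram a b c : 0 <= b - a + (- a - - c) -> b + a + (a + c) <= 2 * (b + c).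
Proof. lra. Qed.

Lemma sqr_subB_le a b e : (a - b - e) ^+ 2 <= 3 * a ^+ 2 + 3 * b ^+ 2 + 3 * e ^+ 2.
Proof.
have := sqr_ge0 (a + b); have := sqr_ge0 (a + e); have := sqr_ge0 (b - e); lra.
Qed.

Lemma arith_final (kap Q A X1 X2 X3 X4 T Psi : R) :
  A <= 3 * T + (6 * X1 + 6 * X2) + 3 * Psi -> Q <= kap * X1 ->
  (kap + 6) * X1 <= (kap + 6) * (X3 + 2 * X2) ->
  (2 * kap + 18) * X2 <= (2 * kap + 18) * X4 ->
  Q + A <= 3 * T + (kap + 6) * X3 + (2 * kap + 18) * X4 + 3 * Psi.
Proof. lra. Qed.

End Arithmetic.

(** * Deterministic risk bound for the interpolator *)

Section Deterministic.
Context {R : realType} {n p : nat}.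
Variables (k : nat) (Z : 'M[R]_(n, p)) (lam : 'rV[R]_p).
Hypothesis lam0 : forall j, 0 < lam 0 j.
Variables (s c1 C1 c2 nn : R).
Hypotheses (s0 : 0 < s) (c10 : 0 < c1) (C10 : 0 < C1) (c20 : 0 < c2) (nn0 : 0 < nn).

Definition tail_lam (j : 'I_p) : R := if (k <= j)%N then lam 0 j else 0.
Local Notation l := tail_lam.

Definition tail_gram : 'M[R]_n := Z *m diag_mx (\row_j l j) *m Z^T.
Local Notation A1 := tail_gram.

Lemma tail_lam_ge0 j : 0 <= l j.
Proof. by rewrite /l; case: ifP => // _; exact: ltW. Qed.

Let Bm : 'M[R]_(n, p) := Z *m diag_mx (\row_j Num.sqrt (l j)).

Let BmE : A1 = Bm *m Bm^T.
Proof.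
rewrite /Bm trmx_mul tr_diag_mx mulmxA -(mulmxA Z) mulmx_diag /A1; congr (_ *m _ *m _).
by congr diag_mx; apply/rowP => j; rewrite !mxE -expr2 sqr_sqrtr ?tail_lam_ge0.
Qed.

Hypothesis A1l : forall v, c1 * s * dotcv v v <= sqnorm_mx A1 v.
Hypothesis A1u : forall v, sqnorm_mx A1 v <= C1 * s * dotcv v v.
Hypothesis Zl : forall q : 'cV[R]_p, (forall j : 'I_p, (k <= j)%N -> q j 0 = 0) ->
  c2 * nn * dotcv q q <= dotcv (Z *m q) (Z *m q).
Hypothesis lmax : forall j, l j <= s / nn.

Lemma posdef_tail_gram : posdefmx A1.
Proof.
split; first by rewrite BmE trmx_mul trmxK.
by move=> v v0; rewrite (lt_le_trans _ (A1l v))// mulr_gt0 ?dotcv_gt0// mulr_gt0.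
Qed.

Variables (theta delta : 'cV[R]_p) (w f : 'cV[R]_n).
(** [deltaE] expresses that the estimator lies in the row space of the design, with dual vector [w];
    [Zdelta] expresses that it interpolates. *)
Hypothesis deltaE : forall j, delta j 0 = theta j 0 - Num.sqrt (lam 0 j) * (Z^T *m w) j 0.
Hypothesis Zdelta : Z *m (\col_j (Num.sqrt (lam 0 j) * delta j 0)) = - f.

Definition tail_signal : 'cV[R]_n := Z *m \col_j (Num.sqrt (l j) * theta j 0).
Definition proj_noise : 'cV[R]_p := Z^T *m (invmx A1 *m f).

Let q : 'cV[R]_p := \col_j (if (j < k)%N then Num.sqrt (lam 0 j) * delta j 0 else 0).
Let g := tail_signal.
(** The dual vector will split as [w = x + y + u], caused by head error, tail signal and noise. *)
Let x := invmx A1 *m (Z *m q).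
Let y := invmx A1 *m g.
Let u := invmx A1 *m f.
Let a2 := \sum_(j < p | (j < k)%N) theta j 0 ^+ 2 / lam 0 j.
Let phi2 := \sum_(j < p | (j < k)%N) proj_noise j 0 ^+ 2.
Let psi2 := \sum_j (l j * proj_noise j 0) ^+ 2.
Let T2 := \sum_j l j * theta j 0 ^+ 2.
Let N2 := dotcv (Bm^T *m x) (Bm^T *m x).
Let Y2 := dotcv (Bm^T *m y) (Bm^T *m y).
Let Q2 := dotcv q q.
Let rho := C1 * s / (c2 * nn).

Let A1unit : A1 \in unitmx. Proof. exact/posdef_unitmx/posdef_tail_gram. Qed.

Let A1x : A1 *m x = Z *m q. Proof. by rewrite mulKVmx. Qed.
Let A1y : A1 *m y = g. Proof. by rewrite mulKVmx. Qed.

Let sl_sqr j : Num.sqrt (l j) ^+ 2 = l j.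
Proof. by rewrite sqr_sqrtr// tail_lam_ge0. Qed.

Let slam_sqr j : Num.sqrt (lam 0 j) ^+ 2 = lam 0 j.
Proof. by rewrite sqr_sqrtr// ltW. Qed.

(** In a tail coordinate, [sqrt lam_j delta_j] contains [- lam_j (Z^T w)_j]; together these terms
    form [- A1 w], which is moved to the left. *)
Let A1w : A1 *m w = Z *m q + g + f.
Proof.
have -> : f = - (Z *m (\col_j (Num.sqrt (lam 0 j) * delta j 0))) by rewrite Zdelta opprK.
have -> : \col_j (Num.sqrt (lam 0 j) * delta j 0) = q + \col_j (Num.sqrt (l j) * theta j 0)
    - diag_mx (\row_j l j) *m (Z^T *m w).
  apply/colP => j; rewrite mul_diag_mx !mxE deltaE /l mxE.
  have := slam_sqr j; set r := Num.sqrt (lam 0 j) => rE.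
  case: ltnP => jk; first by rewrite sqrtr0 !mul0r subr0 addr0.
  by rewrite add0r -/r -rE; ring.
rewrite mulmxBr mulmxDr -/g opprB [RHS]addrC subrK /A1 !mulmxA.
by [].
Qed.

Let wE : w = x + y + u.
Proof. by rewrite -[LHS](mulKmx A1unit) A1w !mulmxDr. Qed.

Let A1dot v v' : dotcv (A1 *m v) v' = dotcv (Bm^T *m v) (Bm^T *m v').
Proof. by rewrite BmE -mulmxA dotcv_mulmxl. Qed.

Let rho0 : 0 < rho. Proof. by rewrite divr_gt0// mulr_gt0. Qed.

(** The chain [c2 n |q|^2 <= |Z q|^2 = |A1 x|^2 <= C1 s |B^T x|^2]. *)
Let Q2_le : Q2 <= rho * N2.
Proof.
rewrite /rho mulrAC ler_pdivlMr ?mulr_gt0// mulrC.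
apply: (@le_trans _ _ (dotcv (Z *m q) (Z *m q))).
  by apply: Zl => j kj; rewrite mxE ltnNge kj.
rewrite -A1x BmE -mulmxA.
apply: (mulmx_gram_le _ _ (Bm^T *m x)) => [|v]; first by rewrite mulr_ge0 ?ltW.
by rewrite -BmE.
Qed.

(** Young's inequality, weighted so that for [t = rho] the first term sums to at most [N2 / 8] and
    can be absorbed. *)
Let amgm (t a b : R) : 0 < t -> a * b <= a ^+ 2 / (8 * t) + 2 * t * b ^+ 2.
Proof.
move=> t0; have := sqr_ge0 (a / (4 * t) - b) => h.
have : 0 <= 2 * t * (a / (4 * t) - b) ^+ 2 by rewrite mulr_ge0// mulr_ge0 ?ltW.
have -> : 2 * t * (a / (4 * t) - b) ^+ 2 = a ^+ 2 / (8 * t) + 2 * t * b ^+ 2 - a * b.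
  by field; rewrite gt_eqF.
by rewrite subr_ge0.
Qed.

Let qE (j : 'I_p) : (k <= j)%N -> q j 0 = 0.
Proof. by move=> kj; rewrite mxE ltnNge kj. Qed.

Let Q2E : Q2 = \sum_(j < p | (j < k)%N) q j 0 ^+ 2.
Proof.
rewrite /Q2 dotcvvE [LHS](bigID (fun j : 'I_p => (j < k)%N)) /= [X in _ + X]big1 ?addr0//.
by move=> j; rewrite -leqNgt => /qE ->; rewrite expr0n.
Qed.

Let dot_q_le (al : 'I_p -> R) (c : 'cV[R]_p) :
  (forall j : 'I_p, (j < k)%N -> q j 0 * c j 0 <= q j 0 * al j) ->
  dotcv q c <= Q2 / (8 * rho) + 2 * rho * \sum_(j < p | (j < k)%N) al j ^+ 2.
Proof.
move=> H; rewrite Q2E mulr_suml mulr_sumr -big_split /= dotcvE.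
rewrite [leLHS](bigID (fun j : 'I_p => (j < k)%N)) /= [X in _ + X]big1 ?addr0; last first.
  by move=> j; rewrite -leqNgt => /qE ->; rewrite mul0r.
by apply: ler_sum => j jk; rewrite (le_trans (H j jk))// amgm.
Qed.

Let qw_le : dotcv (Z *m q) w <= Q2 / (8 * rho) + 2 * rho * a2.
Proof.
rewrite dotcv_mulmxl.
have -> : a2 = \sum_(j < p | (j < k)%N) (theta j 0 / Num.sqrt (lam 0 j)) ^+ 2.
  by apply: eq_bigr => j _; rewrite exprMn exprVn slam_sqr.
apply: dot_q_le => j jk; rewrite mxE jk deltaE.
have sl0 : 0 < Num.sqrt (lam 0 j) by rewrite sqrtr_gt0.
set r := Num.sqrt _ in sl0 *; set z := (Z^T *m w) j 0; set th := theta j 0.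
rewrite -subr_ge0.
have -> : r * (th - r * z) * (th / r) - r * (th - r * z) * z = (th - r * z) ^+ 2.
  by field; rewrite gt_eqF.
exact: sqr_ge0.
Qed.

Let qu_le : - dotcv (Z *m q) u <= Q2 / (8 * rho) + 2 * rho * phi2.
Proof.
rewrite dotcv_mulmxl -dotcvNr.
have -> : phi2 = \sum_(j < p | (j < k)%N) (- proj_noise j 0) ^+ 2.
  by apply: eq_bigr => j _; rewrite sqrrN.
apply: dot_q_le => j jk.
by rewrite (_ : (- (Z^T *m u)) j 0 = - proj_noise j 0)// mxE.
Qed.

(** Pair [w = x + y + u] with [A1 x = Z q]. On the right [N2] returns with weights [1/4], [1/8] and
    [1/8], so half of it is absorbed. *)
Let N2_le : N2 <= 4 * rho * (a2 + phi2) + 2 * Y2.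
Proof.
have e1 : N2 = dotcv (Z *m q) w - dotcv (Z *m q) y - dotcv (Z *m q) u.
  have -> : N2 = dotcv (Z *m q) x by rewrite -A1x A1dot.
  by rewrite wE !dotcvDr; ring.
have e2 : - dotcv (Z *m q) y <= N2 / 4 + Y2.
  rewrite -A1x A1dot; have := dotcv_ge0 (2^-1 *: (Bm^T *m x) + Bm^T *m y).
  rewrite !(dotcvDl, dotcvDr, dotcvZl, dotcvZr) (dotcvC (Bm^T *m y) (Bm^T *m x)).
  rewrite -/N2 -/Y2; set a := dotcv _ _; set b := N2; set c := Y2 => h.
  have -> : b / 4 + c = (- a) + (2^-1 * (2^-1 * b) + 2^-1 * a + (2^-1 * a + c)) by field.
  by rewrite lerDl.
have e3 : Q2 / (8 * rho) <= N2 / 8.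
  rewrite invfM mulrA ler_pdivrMr// mulrAC ler_wpM2r ?invr_ge0//.
  by rewrite mulrC.
move: e1 e2 e3 qw_le qu_le.
set A := dotcv _ w; set B := dotcv _ y; set C := dotcv _ u; set D := Q2 / _.
set E := N2; set F := Y2.
have -> : 4 * rho * (a2 + phi2) = 2 * (2 * rho * a2) + 2 * (2 * rho * phi2) by ring.
set G := 2 * rho * a2; set H := 2 * rho * phi2.
exact: arith_N2.
Qed.

(** This is [<g, A1^-1 g> <= |g|^2 / (c1 s)]: Cauchy-Schwarz and [c1 s |y|^2 <= Y2] give a quadratic
    inequality in [Y2], from which one factor cancels. *)
Let Y2_le : Y2 <= dotcv g g / (c1 * s).
Proof.
have cs : 0 < c1 * s by rewrite mulr_gt0.
have Y2E : Y2 = dotcv g y by rewrite /Y2 -A1dot A1y.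
have [Y0|Y0] := eqVneq Y2 0; first by rewrite Y0 divr_ge0 ?dotcv_ge0// ltW.
have {}Y0 : 0 < Y2 by rewrite lt_def Y0 dotcv_ge0.
rewrite ler_pdivlMr// -(ler_pM2r Y0).
have h1 : Y2 ^+ 2 <= dotcv g g * dotcv y y by rewrite Y2E; exact: dotcv_CS.
have h2 : c1 * s * dotcv y y <= Y2.
  by rewrite (le_trans (A1l y))// sqnorm_mxE dotcvC A1dot.
apply: (@le_trans _ _ (c1 * s * (dotcv g g * dotcv y y))).
  by rewrite mulrAC -expr2 mulrC ler_wpM2l// ltW.
by rewrite mulrCA ler_wpM2l ?dotcv_ge0.
Qed.

(** Each tail coordinate of the error has a signal, a design and a noise part. One factor [l_j] of
    the design part is spent on [l_j <= s / n], which leaves [|B^T (x + y)|^2]. *)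
Let tail_le : \sum_(j < p | (k <= j)%N) lam 0 j * delta j 0 ^+ 2 <=
  3 * T2 + 6 * (s / nn) * (N2 + Y2) + 3 * psi2.
Proof.
have sn0 : 0 < s / nn by rewrite divr_gt0.
pose c := Bm^T *m (x + y).
have cE j : c j 0 = Num.sqrt (l j) * (Z^T *m (x + y)) j 0.
  by rewrite /c /Bm trmx_mul tr_diag_mx -mulmxA mul_diag_mx !mxE.
have c2_le : dotcv c c <= 2 * (N2 + Y2).
  rewrite /c mulmxDr -/N2 -/Y2.
  have := dotcv_ge0 (Bm^T *m x - Bm^T *m y).
  rewrite !(dotcvDl, dotcvDr, dotcvNl, dotcvNr) (dotcvC (Bm^T *m y) (Bm^T *m x)).
  rewrite -/N2 -/Y2 => h; exact: arith_parallelogram.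
apply: (@le_trans _ _ (\sum_j (3 * (l j * theta j 0 ^+ 2) + 3 * (s / nn) * c j 0 ^+ 2
    + 3 * (l j * proj_noise j 0) ^+ 2))).
  rewrite big_mkcond /=; apply: ler_sum => j _.
  case: ifPn => kj; last first.
    have s3 : 0 <= 3 * (s / nn) by rewrite mulr_ge0// ltW.
    apply: addr_ge0; last by rewrite mulr_ge0 ?sqr_ge0.
    apply: addr_ge0; last by rewrite mulr_ge0 ?sqr_ge0.
    by rewrite mulr_ge0// mulr_ge0 ?sqr_ge0 ?tail_lam_ge0.
  have ll : lam 0 j = l j by rewrite /l kj.
  have lj0 := tail_lam_ge0 j; have lj1 := lmax j.
  have -> : delta j 0 = theta j 0 - Num.sqrt (l j) * (Z^T *m (x + y)) j 0
     - Num.sqrt (l j) * proj_noise j 0.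
    by rewrite deltaE wE mulmxDr [in LHS]mxE ll mulrDr opprD addrA.
  rewrite cE ll !exprMn; have := sl_sqr j.
  set r := Num.sqrt (l j); set a := theta j 0; set b := (Z^T *m _) j 0.
  set e := proj_noise j 0 => rE.
  have h1 : (a - r * b - r * e) ^+ 2 <= 3 * a ^+ 2 + 3 * (r * b) ^+ 2 + 3 * (r * e) ^+ 2.
    exact: sqr_subB_le.
  apply: (@le_trans _ _ (l j * (3 * a ^+ 2 + 3 * (r * b) ^+ 2 + 3 * (r * e) ^+ 2))).
    by rewrite ler_wpM2l.
  rewrite !exprMn rE.
  have h2 : l j * (l j * b ^+ 2) <= s / nn * (l j * b ^+ 2).
    by rewrite ler_wpM2r// mulr_ge0 ?sqr_ge0.
  have -> : l j * (3 * a ^+ 2 + 3 * (l j * b ^+ 2) + 3 * (l j * e ^+ 2)) =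
    3 * (l j * a ^+ 2) + 3 * (l j * (l j * b ^+ 2)) + 3 * (l j ^+ 2 * e ^+ 2) by ring.
  rewrite lerD2r lerD2l -[leRHS]mulrA ler_wpM2l//.
rewrite !big_split /= -!mulr_sumr -/T2 -/psi2 lerD2r lerD2l -dotcvvE.
have -> : 6 * (s / nn) * (N2 + Y2) = 3 * (s / nn) * (2 * (N2 + Y2)) by ring.
by rewrite ler_wpM2l// mulr_ge0// ltW.
Qed.

Lemma deterministic_risk_bound :
  \sum_j lam 0 j * delta j 0 ^+ 2 <=
    3 * T2 + 4 * (C1 / c2) * (C1 / c2 + 6) * ((s / nn) ^+ 2 * (a2 + phi2))
    + (2 * (C1 / c2) + 18) / c1 * (dotcv g g / nn) + 3 * psi2.
Proof.
have sn0 : 0 < s / nn by rewrite divr_gt0.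
set kap := C1 / c2; have kap0 : 0 < kap by rewrite divr_gt0.
have rhoE : rho = kap * (s / nn) by rewrite /rho /kap; field; rewrite !gt_eqF.
rewrite (bigID (fun j : 'I_p => (j < k)%N)) /=.
have -> : \sum_(j < p | (j < k)%N) lam 0 j * delta j 0 ^+ 2 = Q2.
  rewrite Q2E; apply: eq_bigr => j jk; rewrite mxE jk exprMn.
  by rewrite sqr_sqrtr// ltW.
under eq_bigl do rewrite -leqNgt.
have h1 := Q2_le; have h2 := N2_le; have h3 := Y2_le; have h4 := tail_le.
rewrite rhoE in h1 h2.
set W := s / nn in sn0 h1 h2 h4 *.
have h5 : W * Y2 <= c1^-1 * (dotcv g g / nn).
  have -> : c1^-1 * (dotcv g g / nn) = W * (dotcv g g / (c1 * s)).
    by rewrite /W; field; rewrite !gt_eqF.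
  by rewrite ler_wpM2l// ltW.
have h6 : W * N2 <= 4 * kap * (W ^+ 2 * (a2 + phi2)) + 2 * (W * Y2).
  have -> : 4 * kap * (W ^+ 2 * (a2 + phi2)) + 2 * (W * Y2) =
    W * (4 * (kap * W) * (a2 + phi2) + 2 * Y2) by ring.
  by rewrite ler_wpM2l// ltW.
have h7 : Q2 <= kap * (W * N2) by rewrite [leRHS]mulrA.
have h8 : (kap + 6) * (W * N2) <= (kap + 6) * (4 * kap * (W ^+ 2 * (a2 + phi2)) + 2 * (W * Y2)).
  by rewrite ler_wpM2l// addr_ge0// ltW.
have h9 : (2 * kap + 18) * (W * Y2) <= (2 * kap + 18) * (c1^-1 * (dotcv g g / nn)).
  by rewrite ler_wpM2l// addr_ge0// mulr_ge0// ltW.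
move: h4 h7 h8 h9.
have -> : 6 * W * (N2 + Y2) = 6 * (W * N2) + 6 * (W * Y2) by ring.
have -> : (2 * kap + 18) / c1 * (dotcv g g / nn) = (2 * kap + 18) * (c1^-1 * (dotcv g g / nn)).
  by rewrite -[LHS]mulrA.
have -> : 4 * kap * (kap + 6) * (W ^+ 2 * (a2 + phi2)) = (kap + 6) * (4 * kap * (W ^+ 2 * (a2 + phi2))).
  by ring.
exact: arith_final.
Qed.

End Deterministic.

(** * Second moments under independence *)

Section SigmaMx.
Context {R : realType} {d : measure_display} {T : measurableType d}
  (P : probability T R).

(* [T] with the sigma-algebra generated by the entries of [X]. *)
Definition sigma_type m n (X : T -> 'M[R]_(m, n)) :=
  g_sigma_algebraType (\bigcup_(ij : 'I_m * 'I_n)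
    preimage_set_system setT (fun t => X t ij.1 ij.2) measurable).

Lemma mmx_sigma_type m n (X : T -> 'M[R]_(m, n)) : mmx (X : sigma_type X -> 'M[R]_(m, n)).
Proof.
move=> i j _ B mB; apply: sub_sigma_algebra; exists (i, j) => //.
by exists B.
Qed.

Lemma sigma_type_measurable m n (X : T -> 'M[R]_(m, n)) (A : set T) :
  mmx X -> measurable (A : set (sigma_type X)) -> measurable A.
Proof.
move=> mX mA; have := @smallest_sub _ (sigma_algebra setT)
  (\bigcup_(ij : 'I_m * 'I_n) preimage_set_system setT
    (fun t => X t ij.1 ij.2) measurable) measurable; apply => //.
  exact: sigma_algebra_measurable.
by move=> _ [[i j] _ [B mB <-]]; exact: mX.
Qed.

Lemma sigma_type_measurable_fun m n (X : T -> 'M[R]_(m, n)) (f : T -> R) :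
  mmx X -> measurable_fun setT (f : sigma_type X -> R) -> measurable_fun setT f.
Proof.
move=> mX mf _ B mB; apply: (sigma_type_measurable mX).
exact: (mf measurableT B mB).
Qed.

Lemma sigma_mx_preimage m n (X : T -> 'M[R]_(m, n)) (f : T -> R) B :
  measurable_fun setT (f : sigma_type X -> R) -> measurable B ->
  sigma_mx X (f @^-1` B).
Proof. by move=> mf mB; rewrite -[_ @^-1` _]setTI; exact: mf. Qed.

Lemma sigma_rv_preimage (X : T -> R) B : measurable B -> sigma_rv X (X @^-1` B).
Proof.
move=> mB; apply: sub_sigma_algebra; exists tt => //; exists B => //.
by rewrite setTI.
Qed.

Lemma indep2_maps m n m' n' (X : T -> 'M[R]_(m, n)) (Y : T -> 'M[R]_(m', n')) (f g : T -> R) :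
  indep2 P (sigma_mx X) (sigma_mx Y) ->
  measurable_fun setT (f : sigma_type X -> R) ->
  measurable_fun setT (g : sigma_type Y -> R) -> indep_maps P f g.
Proof.
by move=> XY mf mg A B mA mB; apply: XY; exact: sigma_mx_preimage.
Qed.

Lemma mutual_indep_pair (I : finType) (F : I -> set_system T) i j A B :
  mutual_indep P F -> (forall k, F k setT) -> i != j -> F i A -> F j B ->
  P (A `&` B) = (P A * P B)%E.
Proof.
move=> indF FT ij FA FB.
pose C k := if k == i then A else if k == j then B else setT.
have := indF C; have CE : \bigcap_k C k = A `&` B.
  apply/seteqP; split=> t.
    move=> Ct; split; first by have := Ct i Logic.I; rewrite /C eqxx.
    by have := Ct j Logic.I; rewrite /C eqxx eq_sym (negbTE ij).
  by move=> [At Bt] k _; rewrite /C; case: eqP => // _; case: eqP.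
rewrite CE (bigD1 i)//= (bigD1 j) ?[j == i]eq_sym//= big1 ?mule1.
  by rewrite /C eqxx [j == i]eq_sym (negbTE ij) eqxx; apply => k; case: eqP => [->//|_]; case: eqP => [->|].
by move=> k /andP[/negbTE ki /negbTE kj]; rewrite /C ki kj probability_setT.
Qed.

(* This is 1; since it only enters the constants, its value is not needed. *)
Definition gauss_m2 : R := fine (\int[normal_prob (0 : R) 1]_x (x ^+ 2)%:E).

Lemma integral_normal_rv_sqr (X : T -> R) : normal_rv P X 0 1 ->
  (\int[P]_t (X t ^+ 2)%:E = gauss_m2%:E)%E.
Proof.
move=> XN; have := integrable_fin_num measurableT (integrable_normal_rv_sqr XN ltr01).
rewrite (ge0_integral_normal_rv (f := fun x => (x ^+ 2)%:E) XN) => [/fineK ->//|x|].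
  by rewrite lee_fin sqr_ge0.
by apply/measurable_EFinP; exact: measurable_funX.
Qed.

Lemma gauss_m2_ge0 : 0 <= gauss_m2.
Proof. by rewrite fine_ge0// integral_ge0// => x _; rewrite lee_fin sqr_ge0. Qed.

Lemma std_normal_vec_moment2 n (Z : T -> 'cV[R]_n) a b : std_normal_vec P Z ->
  P.-integrable setT (fun t => (Z t a 0 * Z t b 0)%:E) /\
  (\int[P]_t (Z t a 0 * Z t b 0)%:E = (gauss_m2 *+ (a == b))%:E)%E.
Proof.
move=> [ZN Zind]; have [<-|ab] := eqVneq a b.
  under eq_fun do rewrite -expr2; split.
    exact: integrable_normal_rv_sqr (ZN a) ltr01.
  by rewrite mulr1n; exact: integral_normal_rv_sqr.
have ia c := integrable_normal_rv (ZN c) ltr01.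
have [|h1 h2] := integral_indep_mul (ia a) (ia b).
  move=> A B mA mB; apply: (mutual_indep_pair Zind _ ab).
  - move=> k; rewrite -(preimage_setT (fun t => Z t k 0)); exact: sigma_rv_preimage.
  - exact: sigma_rv_preimage.
  - exact: sigma_rv_preimage.
by split=> //; rewrite h2 (normal_rv_mean0 (ZN a) ltr01) mul0e mulr0n.
Qed.

Lemma integral_fin_sum (I : finType) (f : I -> T -> R) (c : I -> R) :
  (forall i, P.-integrable setT (fun t => (f i t)%:E)) ->
  (forall i, (\int[P]_t (f i t)%:E = (c i)%:E)%E) ->
  P.-integrable setT (fun t => (\sum_i f i t)%:E) /\
  (\int[P]_t (\sum_i f i t)%:E = (\sum_i c i)%:E)%E.
Proof.
move=> fi fc; split.
  under eq_fun do rewrite -sumEFin; exact: integrable_sum.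
under eq_integral do rewrite -sumEFin.
by rewrite integral_sum// -sumEFin; apply: eq_bigr => i _; exact: fc.
Qed.

Lemma integral_quad_form n (W : T -> 'cV[R]_n) (mu C : 'M[R]_n) :
  (forall a b, P.-integrable setT (fun t => (W t a 0 * W t b 0)%:E) /\
     (\int[P]_t (W t a 0 * W t b 0)%:E = (mu a b)%:E)%E) ->
  P.-integrable setT (fun t => (\sum_a \sum_b C a b * (W t a 0 * W t b 0))%:E) /\
  (\int[P]_t (\sum_a \sum_b C a b * (W t a 0 * W t b 0))%:E =
     (\sum_a \sum_b C a b * mu a b)%:E)%E.
Proof.
move=> H.
have H2 a b : P.-integrable setT (fun t => (C a b * (W t a 0 * W t b 0))%:E) /\
    (\int[P]_t (C a b * (W t a 0 * W t b 0))%:E = (C a b * mu a b)%:E)%E.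
  have [h1 h2] := H a b; split.
    by under eq_fun do rewrite EFinM; exact: integrableZl.
  by under eq_integral do rewrite EFinM; rewrite integralZl// h2.
have H1 a := @integral_fin_sum _ _ _ (fun b => (H2 a b).1) (fun b => (H2 a b).2).
exact: (@integral_fin_sum _ _ _ (fun a => (H1 a).1) (fun a => (H1 a).2)).
Qed.

Lemma normal_vec_moment2 n (V : T -> 'cV[R]_n) (S : 'M[R]_n) a b : normal_vec P V S ->
  P.-integrable setT (fun t => (V t a 0 * V t b 0)%:E) /\
  (\int[P]_t (V t a 0 * V t b 0)%:E = (gauss_m2 * S a b)%:E)%E.
Proof.
move=> [A [Z [AS ZN VE]]].
have [h1 h2] := @integral_quad_form _ Z (\matrix_(c, e) (gauss_m2 *+ (c == e)))
  (\matrix_(c, e) (A a c * A b e)) (fun c e => ltac:(rewrite mxE; exact: std_normal_vec_moment2 ZN)).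
have VV t : V t a 0 * V t b 0 =
    \sum_c \sum_e (\matrix_(c, e) (A a c * A b e)) c e * (Z t c 0 * Z t e 0).
  rewrite VE !mxE mulr_suml; apply: eq_bigr => c _.
  by rewrite mulr_sumr; apply: eq_bigr => e _; rewrite mxE; ring.
under eq_fun do rewrite VV; split=> //; rewrite h2; congr (_%:E).
rewrite -AS mxE mulr_sumr; apply: eq_bigr => c _.
rewrite (bigD1 c)//= big1 ?addr0; last first.
  by move=> e ec; rewrite !mxE eq_sym (negbTE ec) mulr0n mulr0.
by rewrite !mxE eqxx mulr1n mulrC.
Qed.

Lemma normal_vec_mulmx n (V : T -> 'cV[R]_n) (S B : 'M[R]_n) :
  normal_vec P V S -> normal_vec P (fun t => B *m V t) (B *m S *m B^T).
Proof.
move=> [A [Z [AS ZN VE]]]; exists (B *m A), Z; split=> //.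
  by rewrite trmx_mul -AS !mulmxA.
by move=> t; rewrite VE mulmxA.
Qed.

(** A conditional expectation given the design, done by hand: the square expands into
    [sum_ab H_ab f_a f_b] with [H_ab] a function of the design, and each product factors by
    independence. The bound [M] on [h] makes [H_ab] integrable. *)
Lemma noise_second_moment m n k q (E : T -> 'cV[R]_k) (X : T -> 'M[R]_(m, n)) r
    (f : T -> 'cV[R]_r) (S : 'M[R]_r) (h : 'I_q -> T -> 'cV[R]_r) (M c : R) :
  mmx X -> indep2 P (sigma_mx E) (sigma_mx X) ->
  mmx (f : sigma_type E -> 'cV[R]_r) -> normal_vec P f S ->
  (forall i, mmx (h i : sigma_type X -> 'cV[R]_r)) ->
  (forall i t a, `|h i t a 0| <= M) ->
  (forall t, \sum_i sqnorm_mx S (h i t) <= c) ->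
  (\int[P]_t (\sum_i dotcv (h i t) (f t) ^+ 2)%:E <= (gauss_m2 * c)%:E)%E.
Proof.
move=> mX EX mf fN mh hM hc.
pose H a b t := \sum_i h i t a 0 * h i t b 0.
have mHX a b : measurable_fun setT (H a b : sigma_type X -> R).
  apply: measurable_sum => i; apply: measurable_funM; exact: mh.
have mH a b : measurable_fun setT (H a b) by exact: sigma_type_measurable_fun (mHX a b).
have iH a b : P.-integrable setT (EFin \o H a b).
  have i1 : P.-integrable setT (fun=> (q%:R * M ^+ 2)%:E : \bar R).
    exact: finite_measure_integrable_cst.
  apply: (le_integrable _ _ _ i1) => //; first exact/measurable_EFinP.
  move=> t _ /=; rewrite lee_fin.
  have qM : 0 <= q%:R * M ^+ 2 by apply: mulr_ge0 => //; exact: sqr_ge0.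
  rewrite (ger0_norm qM) (le_trans (ler_norm_sum _ _ _))//.
  apply: (@le_trans _ _ (\sum_(i < q) M ^+ 2)).
    by apply: ler_sum => i _; rewrite normrM expr2 ler_pM.
  by rewrite sumr_const card_ord mulr_natl.
have mff a b : measurable_fun setT ((fun t => f t a 0 * f t b 0) : sigma_type E -> R).
  by apply: measurable_funM; exact: mf.
have key a b : P.-integrable setT (fun t => (H a b t * (f t a 0 * f t b 0))%:E) /\
    (\int[P]_t (H a b t * (f t a 0 * f t b 0))%:E =
     (fine (\int[P]_t (H a b t)%:E) * (gauss_m2 * S a b))%:E)%E.
  have [i1 i2] := normal_vec_moment2 a b fN.
  have ind := indep2_maps EX (mff a b) (mHX a b).
  have [h1 h2] := integral_indep_mul i1 (iH a b) ind.
  split; first by under eq_fun do rewrite mulrC.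
  under eq_integral do rewrite mulrC.
  by rewrite h2 i2 muleC EFinM fineK//; exact: (integrable_fin_num measurableT (iH a b)).
have key1 := fun a => @integral_fin_sum _ _ _ (fun b => (key a b).1) (fun b => (key a b).2).
have [k1 k2] := @integral_fin_sum _ _ _ (fun a => (key1 a).1) (fun a => (key1 a).2).
have sqE t : \sum_i dotcv (h i t) (f t) ^+ 2 =
    \sum_a \sum_b H a b t * (f t a 0 * f t b 0).
  transitivity (\sum_i \sum_a \sum_b h i t a 0 * h i t b 0 * (f t a 0 * f t b 0)).
    apply: eq_bigr => i _; rewrite expr2 dotcvE mulr_suml; apply: eq_bigr => a _.
    by rewrite mulr_sumr; apply: eq_bigr => b _; ring.
  rewrite exchange_big /=; apply: eq_bigr => a _; rewrite exchange_big /=.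
  by apply: eq_bigr => b _; rewrite mulr_suml.
under eq_integral do rewrite sqE.
rewrite k2.
(* The products of expectations are folded back into a single integral, where the pointwise bound
   [hc] applies. *)
have key' a b : P.-integrable setT (fun t => (H a b t * (gauss_m2 * S a b))%:E) /\
    (\int[P]_t (H a b t * (gauss_m2 * S a b))%:E =
     (fine (\int[P]_t (H a b t)%:E) * (gauss_m2 * S a b))%:E)%E.
  split; first by under eq_fun do rewrite EFinM; exact: (integrableZr measurableT _ (iH a b)).
  under eq_integral do rewrite EFinM.
  rewrite (integralZr measurableT (iH a b)) [RHS]EFinM fineK//.
  exact: (integrable_fin_num measurableT (iH a b)).
have key1' := fun a => @integral_fin_sum _ _ _ (fun b => (key' a b).1) (fun b => (key' a b).2).
have [k1' <-] := @integral_fin_sum _ _ _ (fun a => (key1' a).1) (fun a => (key1' a).2).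
have -> : (gauss_m2 * c)%:E = (\int[P]_t (gauss_m2 * c)%:E)%E.
  by rewrite integral_cst//= probability_setT mule1.
apply: le_integral => //; first exact: finite_measure_integrable_cst.
move=> t _; rewrite lee_fin.
have -> : \sum_a \sum_b H a b t * (gauss_m2 * S a b) = gauss_m2 * \sum_i sqnorm_mx S (h i t).
  rewrite mulr_sumr.
  transitivity (\sum_i \sum_a \sum_b gauss_m2 * (h i t a 0 * (S a b * h i t b 0))).
    rewrite [RHS]exchange_big /=; apply: eq_bigr => a _; rewrite [RHS]exchange_big /=.
    apply: eq_bigr => b _; rewrite mulr_suml; apply: eq_bigr => i _; ring.
  apply: eq_bigr => i _; rewrite sqnorm_mxE dotcvE mulr_sumr; apply: eq_bigr => a _.
  by rewrite mxE !mulr_sumr; apply: eq_bigr => b _.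
by rewrite ler_wpM2l ?gauss_m2_ge0.
Qed.

End SigmaMx.

(** * The risk as a quadratic form in the estimation error *)

Section Risk.
Context {R : realType}.

Lemma normal_vec_mmx d (T : measurableType d) (P : probability T R) n
    (V : T -> 'cV[R]_n) S : normal_vec P V S -> mmx V.
Proof.
move=> [A [Z [_ [ZN _] VE]]] i j; under eq_fun do rewrite VE.
apply: (mmx_mul (mmx_cst A)) => a b; rewrite (ord1 b).
by have [] := ZN a.
Qed.

(** With [D = <beta - b, x>] at the test point [x] and test noise [e], the difference of squares is
    [D^2 + 2 D e], and the cross term has mean zero by independence. *)
Lemma risk_quad n p (M : linear_model R n p) (b : 'cV[R]_p) :
  risk M b = (gauss_m2 * sqnorm_mx (lm_Sigma M) (lm_beta M - b))%:E.
Proof.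
pose P := lm_P M; pose v := lm_beta M - b.
pose D (t : lm_T M) := dotcv v (lm_xs t); pose e := @lm_eps _ _ _ M.
have mxs : mmx (@lm_xs _ _ _ M) := normal_vec_mmx (lm_xs_normal M).
have mD : measurable_fun setT D by apply: measurable_dotcv => //; exact: mmx_cst.
have vvE i j : (v *m v^T) i j = v i 0 * v j 0.
  by rewrite [LHS]mxE big_ord1 [v^T _ _]mxE.
have D2E t : D t ^+ 2 = \sum_i \sum_j (v *m v^T) i j * (lm_xs t i 0 * lm_xs t j 0).
  rewrite expr2 /D dotcvE mulr_suml; apply: eq_bigr => i _.
  by rewrite mulr_sumr; apply: eq_bigr => j _; rewrite vvE; ring.
have [|iD2 ED2] := @integral_quad_form _ _ _ P _ (@lm_xs _ _ _ M) (gauss_m2 *: lm_Sigma M) (v *m v^T).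
  by move=> i j; rewrite mxE; exact: (normal_vec_moment2 _ _ (lm_xs_normal M)).
have {}iD2 : P.-integrable setT (fun t => (D t ^+ 2)%:E).
  by under eq_fun do rewrite D2E.
have i1 : P.-integrable setT (fun=> 1%:E : \bar R) by exact: finite_measure_integrable_cst.
have iD : P.-integrable setT (EFin \o D).
  apply: (le_integrable _ _ _ (integrableD measurableT i1 iD2)) => //.
    exact/measurable_EFinP.
  move=> t _ /=; rewrite lee_fin [leRHS]ger0_norm ?addr_ge0 ?sqr_ge0//.
  rewrite -(real_normK (num_real (D t))).
  have := sqr_ge0 (`|D t| - 1); have := normr_ge0 (D t).
  by move: `|D t| => y; nra.
have ie : P.-integrable setT (EFin \o e).
  exact: (integrable_normal_rv (lm_eps_normal M) (lm_sigma_eps_gt0 M)).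
have [|ieD EeD] := integral_indep_mul iD ie.
  move=> A B mA mB; apply: (lm_xs_eps_indep (l := M)).
    apply: sigma_mx_preimage => //.
    apply: measurable_dotcv; [exact: mmx_cst|exact: mmx_sigma_type].
  exact: sigma_rv_preimage.
rewrite /risk unlock.
transitivity (\int[P]_t ((D t ^+ 2)%:E + 2%:E * (D t * e t)%:E))%E.
  apply: eq_integral => t _; rewrite -EFinM -EFinD; congr (_%:E).
  rewrite /ystar /D /v dotcvDl dotcvNl /e.
  set a := dotcv (lm_beta M) _; set c := dotcv b _; ring.
rewrite integralD//; last exact: integrableZl.
rewrite integralZl// EeD (normal_rv_mean0 (lm_eps_normal M) (lm_sigma_eps_gt0 M)).
rewrite mule0 mule0 adde0.
under eq_integral do rewrite D2E.
rewrite ED2; congr (_%:E).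
rewrite sqnorm_mxE dotcvE mulr_sumr; apply: eq_bigr => i _.
rewrite -/v [(_ *m v) i 0]mxE !mulr_sumr; apply: eq_bigr => j _.
have sE : (gauss_m2 *: lm_Sigma M) i j = gauss_m2 * lm_Sigma M i j by rewrite mxE.
by rewrite vvE sE; ring.
Qed.

Lemma sqnorm_mx_spectral p (Sigma U : 'M[R]_p) lam v :
  is_spectral_decomp Sigma U lam ->
  sqnorm_mx Sigma v = \sum_j lam 0 j * (U^T *m v) j 0 ^+ 2.
Proof.
move=> [_ _ _ ->]; rewrite sqnorm_mxE -!mulmxA dotcv_mulmxr dotcvE.
by apply: eq_bigr => j _; rewrite mul_diag_mx [X in _ * X]mxE; ring.
Qed.

Lemma abse_risk n p (M : linear_model R n p) (b : 'cV[R]_p) :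
  (`|risk M b|%E = (gauss_m2 *
     \sum_j lm_lam M 0 j * ((lm_U M)^T *m (lm_beta M - b)) j 0 ^+ 2)%:E)%E.
Proof.
rewrite risk_quad (sqnorm_mx_spectral _ (lm_spectralP M)) gee0_abs// lee_fin.
rewrite mulr_ge0 ?gauss_m2_ge0// sumr_ge0// => j _.
have [_ _ l0 _] := lm_spectralP M.
by rewrite mulr_ge0 ?sqr_ge0// ltW.
Qed.

End Risk.

(** * Whitening the model *)

Section Model.
Context {R : realType} {n p : nat} (M : linear_model R n p).
Local Notation P := (lm_P M).
Local Notation lam := (lm_lam M).
Local Notation U := (lm_U M).
Local Notation X := (@lm_X _ _ _ M).

Lemma model_iid : iid_normal P (fun (ji : 'I_p * 'I_n) t => @lm_z _ _ _ M ji.1 t ji.2 0).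
Proof.
split=> [[j i]|B mB]; first exact: ((lm_z_normal M j).1 i).
pose A j := \bigcap_i ((fun t => @lm_z _ _ _ M j t i 0) @^-1` B (j, i)).
have -> : \bigcap_i ((fun t => @lm_z _ _ _ M i.1 t i.2 0) @^-1` B i) = \bigcap_j A j.
  apply/seteqP; split=> t H; first by move=> j _ i _; exact: (H (j, i)).
  by move=> [j i] _; exact: (H j Logic.I i).
rewrite (lm_z_indep (A := A)); last first.
  move=> j.
  have := @fin_bigcap_measurable _ (sigma_type (@lm_z _ _ _ M j)) _ setT
    (fun i => (fun t => @lm_z _ _ _ M j t i 0) @^-1` B (j, i)).
  apply => // i _; rewrite -[X in measurable X]setTI.
  exact: (@mmx_sigma_type _ _ _ _ _ (@lm_z _ _ _ M j) i 0 measurableT _ (mB (j, i))).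
transitivity (\prod_j \prod_i P ((fun t => @lm_z _ _ _ M j t i (0 : 'I_1)%R) @^-1` B (j, i)))%E.
  apply: eq_bigr => j _; apply: (lm_z_normal M j).2 => i.
  exact: sigma_rv_preimage.
by rewrite pair_bigA; apply: eq_bigr => -[].
Qed.

Lemma lam_gt0 j : 0 < lam 0 j.
Proof. by have [_ _ + _] := lm_spectralP M; apply. Qed.

Lemma UTU : U^T *m U = 1%:M.
Proof. by have [] := lm_spectralP M. Qed.

Variables (L : 'M[R]_n).
Hypothesis Lu : L \in unitmx.

Definition model_B (j : 'I_p) : 'M[R]_n := invmx L *m lm_Xih M j.
Definition model_Z : lm_T M -> 'M[R]_(n, p) := whitened model_B (@lm_z _ _ _ M).
Definition model_f (t : lm_T M) : 'cV[R]_n := invmx L *m lm_E t.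
Local Notation Z := model_Z.
Local Notation D := (diag_mx (map_mx Num.sqrt lam)).

Lemma model_BBT j v : sqnorm_mx (model_B j *m (model_B j)^T) v =
  sqnorm_mx (lm_Xi M j) ((invmx L)^T *m v).
Proof.
have [[XihT _] XihE] := lm_XihP M j.
rewrite !sqnorm_mxE /model_B trmx_mul XihT -!mulmxA dotcv_mulmxr; congr dotcv.
by rewrite -XihE !mulmxA.
Qed.

Lemma model_XE t : X t = L *m Z t *m D *m U^T.
Proof.
rewrite /lm_X /design_mx; congr (_ *m _ *m _).
rewrite -[LHS](mulKVmx Lu); congr (_ *m _); apply/matrixP => i j.
rewrite [RHS]mxE /model_B -mulmxA !mxE; apply: eq_bigr => a _.
by rewrite !mxE.
Qed.

(** Recovers [Z] from [X], so that functions of [Z] are measurable for the sigma-algebra of the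
    design, which is the one independent of the noise. *)
Lemma model_ZE t : Z t = invmx L *m X t *m U *m diag_mx (map_mx (fun x => (Num.sqrt x)^-1) lam).
Proof.
rewrite model_XE -!mulmxA (mulmxA U^T) UTU mul1mx mulmx_diag.
rewrite [X in diag_mx X](_ : _ = const_mx 1); last first.
  apply/rowP => j; rewrite !mxE mulfV// gt_eqF// sqrtr_gt0 lam_gt0 //.
by rewrite diag_const_mx mulmx1 mulKmx.
Qed.

Lemma mmx_model_Z_sigma : mmx (Z : sigma_type X -> 'M[R]_(n, p)).
Proof.
have -> : model_Z = (fun t => invmx L *m X t *m U *m
    diag_mx (map_mx (fun x => (Num.sqrt x)^-1) lam)).
  by apply/funext => t; exact: model_ZE.
apply: mmx_mul; last exact: mmx_cst.
apply: mmx_mul; last exact: mmx_cst.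
apply: mmx_mul; first exact: mmx_cst.
exact: mmx_sigma_type.
Qed.

Lemma mmx_model_Z : mmx Z.
Proof.
move=> i j; under eq_fun do rewrite mxE.
apply: (mmx_mul (mmx_cst _)) => a b; rewrite (ord1 b).
by have [] := (lm_z_normal M j).1 a.
Qed.

Lemma mmx_model_X : mmx X.
Proof.
have -> : X = (fun t => L *m Z t *m D *m U^T).
  by apply/funext => t; exact: model_XE.
apply: mmx_mul; last exact: mmx_cst.
apply: mmx_mul; last exact: mmx_cst.
apply: mmx_mul; first exact: mmx_cst.
exact: mmx_model_Z.
Qed.

Lemma mmx_beta_hat : mmx (fun t : lm_T M => beta_hat t).
Proof.
have mX := mmx_model_X.
apply: mmx_mul.
  apply: mmx_mul; first exact: mmx_trmx.
  by apply: mmx_invmx; apply: mmx_mul => //; exact: mmx_trmx.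
apply: mmx_add; first by apply: mmx_mul => //; exact: mmx_cst.
exact: normal_vec_mmx (lm_E_normal M).
Qed.

Lemma model_f_normal : normal_vec P model_f (invmx L *m lm_Upsilon M *m (invmx L)^T).
Proof. exact/normal_vec_mulmx/lm_E_normal. Qed.

Lemma mmx_model_f_sigma : mmx (model_f : sigma_type (@lm_E _ _ _ M) -> 'cV[R]_n).
Proof. apply: mmx_mul; [exact: mmx_cst|exact: mmx_sigma_type]. Qed.

Definition model_delta (t : lm_T M) : 'cV[R]_p := U^T *m (lm_beta M - beta_hat t).
Definition model_theta : 'cV[R]_p := U^T *m lm_beta M.
(** The dual vector: [beta_hat = X^T L^-T w]. *)
Definition model_w (t : lm_T M) : 'cV[R]_n := L^T *m (invmx (X t *m (X t)^T) *m lm_Y t).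

Lemma model_deltaE t j : model_delta t j 0 =
  model_theta j 0 - Num.sqrt (lam 0 j) * ((Z t)^T *m model_w t) j 0.
Proof.
rewrite /model_delta /model_theta mulmxBr; rewrite [LHS]mxE [X in _ + X]mxE; congr (_ - _).
rewrite /beta_hat /model_w {1}model_XE !trmx_mul trmxK tr_diag_mx.
rewrite -!mulmxA (mulmxA U^T) UTU mul1mx mul_diag_mx !mxE.
by rewrite !mulmxA.
Qed.

Lemma model_Zdelta t : X t *m (X t)^T \in unitmx ->
  Z t *m (\col_j (Num.sqrt (lam 0 j) * model_delta t j 0)) = - model_f t.
Proof.
move=> XXu.
have -> : \col_j (Num.sqrt (lam 0 j) * model_delta t j 0) = D *m model_delta t.
  by apply/colP => j; rewrite mul_diag_mx !mxE.
apply: (can_inj (mulKmx Lu)).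
rewrite mulmxN /model_f mulKVmx//.
have -> : L *m (Z t *m (D *m model_delta t)) = X t *m (lm_beta M - beta_hat t).
  by rewrite model_XE /model_delta !mulmxA.
rewrite mulmxBr /beta_hat.
have -> : X t *m ((X t)^T *m invmx (X t *m (X t)^T) *m lm_Y t) = lm_Y t.
  by rewrite !mulmxA mulmxV// mul1mx.
by rewrite /lm_Y opprD addrA subrr sub0r.
Qed.

End Model.

Lemma arith_risk (R : realFieldType) (r T A F S ca g6 : R) : 0 <= T -> 0 <= A ->
  0 <= F -> 0 <= S -> 0 <= ca -> 0 <= g6 ->
  r <= 3 * T + ca * (A + F) + g6 * T + 3 * S ->
  r <= (3 + g6 + ca) * (T + A + (F + S)).
Proof.
move=> T0 A0 F0 S0 ca0 g60 /le_trans; apply; rewrite -subr_ge0.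
have -> : (3 + g6 + ca) * (T + A + (F + S)) - (3 * T + ca * (A + F) + g6 * T + 3 * S) =
  3 * A + 3 * F + g6 * A + g6 * F + g6 * S + ca * T + ca * S by ring.
have := mulr_ge0 g60 A0; have := mulr_ge0 g60 F0; have := mulr_ge0 g60 S0.
have := mulr_ge0 ca0 T0; have := mulr_ge0 ca0 S0; lra.
Qed.

Lemma arith_split (R : realFieldType) (T A B N k : R) : 0 <= T -> 0 <= A -> 0 <= B ->
  0 <= k -> N <= k * B -> T + A + N <= (1 + k) * (T + A + B).
Proof.
move=> T0 A0 B0 k0 NB; rewrite -subr_ge0.
have -> : (1 + k) * (T + A + B) - (T + A + N) = B + k * T + k * A + (k * B - N) by ring.
have := mulr_ge0 k0 T0; have := mulr_ge0 k0 A0; lra.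
Qed.

Lemma sqnorm_mx_sum_col (R : realType) p (U : 'M[R]_p) (Q : pred 'I_p) (c : 'I_p -> R) v :
  sqnorm_mx (\sum_(i < p | Q i) c i *: (col i U *m (col i U)^T)) v =
  \sum_(i < p | Q i) c i * (U^T *m v) i 0 ^+ 2.
Proof.
rewrite sqnorm_mxE mulmx_suml (big_morph (dotcv v) (dotcvDr v) (dotcv0r v)).
apply: eq_bigr => i _; rewrite -scalemxAl dotcvZr -mulmxA dotcv_mulmxr; congr (_ * _).
rewrite dotcvE big_ord1 -expr2; congr (_ ^+ 2).
by rewrite !mxE; apply: eq_bigr => j _; rewrite !mxE.
Qed.

(** * Finite-sample bound *)

Section Bound.
Context {R : realType} (eps : R) (K : nat).
Hypotheses (eps0 : 0 < eps) (eps1 : eps <= 1).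
Let h := eps / 60.
Hypothesis hK : (1 + h^-1) ^+ 2 <= K%:R.
(** [c1] and [C1] are the tail-bound constants [eps / 4] and [6 / eps] after the losses [1/16] and
    [9] of [net_event_bounds]. *)
Let c1 := eps / 64.
Let C1 := 9 * (6 / eps).

Context {n' p : nat} (M : linear_model R n'.+1 p).
Local Notation n := n'.+1.
Local Notation P := (lm_P M).
Local Notation lam := (lm_lam M).
Local Notation U := (lm_U M).
Local Notation X := (@lm_X _ _ _ M).
Variables (Xi0 L : 'M[R]_n).
Hypotheses (cohM : coherent eps Xi0 (@lm_Xi _ _ _ M)).
Hypotheses (Lu : L \in unitmx) (LL : L *m L^T = Xi0).
Variable k : nat.
Hypothesis kp : (k < p)%N.

Let s := tail_sum lam k.
Let rk := r_eff lam k.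
Let nn : R := n%:R.
Hypothesis rk_ge : nn <= rk.
Local Notation l := (tail_lam k lam).
Local Notation Z := (model_Z (M := M) L).
Local Notation Bm := (model_B M L).

Let lk := lam 0 (Ordinal kp).
Let lk0 : 0 < lk. Proof. exact: lam_gt0. Qed.
Let nn0 : 0 < nn. Proof. by rewrite ltr0n. Qed.

Let rkE : rk = s / lk.
Proof. by rewrite /rk /r_eff /eigv insubT. Qed.

Let sumlE : \sum_j l j = s.
Proof. by rewrite /s /tail_sum [RHS]big_mkcond. Qed.

Let l_le j : l j <= lk.
Proof.
rewrite /l; case: ifPn => kj; last exact: ltW.
by have [_ + _ _] := lm_spectralP M; apply.
Qed.

Let s0 : 0 < s.
Proof.
rewrite -sumlE (bigD1 (Ordinal kp))//= ltr_wpDr//.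
  by rewrite sumr_ge0// => j _; apply: tail_lam_ge0 => i; exact: lam_gt0.
by rewrite /l /= leqnn; exact: lam_gt0.
Qed.

Let lk_le : lk <= s / nn.
Proof. by rewrite ler_pdivlMr// mulrC -ler_pdivlMr// -rkE. Qed.

Let Xi0pd : posdefmx Xi0. Proof. by have [] := cohM. Qed.

Let LXi0 v : sqnorm_mx Xi0 ((invmx L)^T *m v) = dotcv v v.
Proof.
rewrite -LL sqnorm_mxE -!mulmxA dotcv_mulmxr (mulmxA L^T) -trmx_mul mulVmx// trmx1.
by rewrite mul1mx.
Qed.

Let BB j v : eps * dotcv v v <= sqnorm_mx (Bm j *m (Bm j)^T) v <= eps^-1 * dotcv v v.
Proof.
rewrite model_BBT -LXi0; apply: (coherent_bounds eps0 cohM).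
exact: lm_XiP.
Qed.

(** [|L1 v|^2] is the form of the tail Gram matrix, to be controlled on a net in dimension [n]; [L2]
    keeps the first [k] columns of [Z], so its net has dimension [k] only. *)
Let L1 t : 'M[R]_(p, n) := diag_mx (\row_j Num.sqrt (l j)) *m (Z t)^T.
Let L2 t : 'M[R]_(n, k) := Z t *m pid_mx k.

Let E8n := expR (- (eps * nn / 8)).
Let E8r := expR (- (eps * rk / 8)).

Let G1 := net_event h (eps / 4 * s) (6 / eps * s) K L1.
Let G2 := net_event h (eps / 4 * nn) (6 / eps * nn) K L2.

Let h0 : 0 < h. Proof. by rewrite divr_gt0. Qed.
Let h2 : h <= 2^-1.
Proof. by rewrite /h ler_pdivrMr//; move: eps1; lra. Qed.

(* The mesh [h = eps / 60] is chosen for this inequality. *)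
Let up_lo (x : R) : 0 <= x -> 144 * (6 / eps * x) * h ^+ 2 <= eps / 4 * x.
Proof.
move=> x0; rewrite /h.
have -> : 144 * (6 / eps * x) * (eps / 60) ^+ 2 = 24 / 100 * (eps * x).
  by field; rewrite gt_eqF.
have : 0 <= eps * x by rewrite mulr_ge0// ltW.
have -> : eps / 4 * x = eps * x / 4 by field.
by set y := eps * x; lra.
Qed.

Let mL1 : mmx L1.
Proof. by apply: mmx_mul; [exact: mmx_cst|apply: mmx_trmx; exact: mmx_model_Z]. Qed.
Let mL2 : mmx L2.
Proof. by apply: mmx_mul; [exact: mmx_model_Z|exact: mmx_cst]. Qed.

Let l_ge0 j : 0 <= l j. Proof. by apply: tail_lam_ge0 => i; exact: lam_gt0. Qed.

Let PG1 : (P (~` G1) <= ((3 * 2 ^+ K) ^+ n * (2 * E8r))%:E)%E.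
Proof.
apply: net_event_prob; rewrite ?expR_ge0// => w w0.
- have := tail_lower eps0 eps1 (model_iid M) BB l_ge0 l_le lk0 w0.
  by rewrite sumlE -rkE.
- have := tail_upper eps0 eps1 (model_iid M) BB l_ge0 l_le lk0 w0.
  by rewrite sumlE -rkE.
Qed.

Let pidK (w : 'cV[R]_k) : dotcv (pid_mx k *m w : 'cV[R]_p) (pid_mx k *m w) = dotcv w w.
Proof.
rewrite dotcv_mulmxl mulmxA tr_pid_mx mul_pid_mx minnn (minn_idPr (ltnW kp)) pid_mx_1.
by rewrite mul1mx.
Qed.

Let pid_neq0 (w : 'cV[R]_k) : w != 0 -> pid_mx k *m w != 0 :> 'cV[R]_p.
Proof. by rewrite -!dotcv_gt0 pidK. Qed.

Let PG2 : (P (~` G2) <= ((3 * 2 ^+ K) ^+ k * (2 * E8n))%:E)%E.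
Proof.
apply: net_event_prob; rewrite ?expR_ge0// => w w0.
- under eq_set do rewrite /L2 -mulmxA.
  by have := comb_lower eps0 eps1 (model_iid M) BB (pid_neq0 w0); rewrite pidK.
- under eq_set do rewrite /L2 -mulmxA.
  by have := comb_upper eps0 eps1 (model_iid M) BB (pid_neq0 w0); rewrite pidK.
Qed.

Let theta := model_theta M.
Let sq : 'cV[R]_p := \col_j (Num.sqrt (l j) * theta j 0).
Let T2 := \sum_j l j * theta j 0 ^+ 2.
Let sqE : dotcv sq sq = T2.
Proof.
by rewrite dotcvvE; apply: eq_bigr => j _; rewrite mxE exprMn sqr_sqrtr.
Qed.

(** The tail signal is one fixed direction, so a single deviation bound suffices instead of a
    net. *)
Let G3 := [set t | dotcv (Z t *m sq) (Z t *m sq) <= 6 / eps * nn * T2].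

Let mG3fun : measurable_fun setT (fun t => dotcv (Z t *m sq) (Z t *m sq)).
Proof.
by apply: measurable_dotcv; apply: mmx_mul; [exact: mmx_model_Z|exact: mmx_cst|
  exact: mmx_model_Z|exact: mmx_cst].
Qed.

Let PG3 : (P (~` G3) <= E8n%:E)%E.
Proof.
have [sq0|sq0] := eqVneq sq 0.
  rewrite (_ : ~` G3 = set0) ?measure0 ?lee_fin ?expR_ge0//.
  apply/seteqP; split=> // t; apply; rewrite /G3 /=.
  by rewrite -sqE sq0 mulmx0 !dotcv0l mulr0.
apply: (le_trans _ (comb_upper eps0 eps1 (model_iid M) BB sq0)).
apply: le_measure; rewrite ?inE.
- apply: measurableC; rewrite -[X in measurable X]setTI; exact: measurable_fun_le.
- rewrite -[X in measurable X]setTI; apply: measurable_fun_le => //.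
- move=> t /negP; rewrite -ltNge => /ltW.
  by rewrite /= sqE.
Qed.

(* With these weights, [NV] below collects both noise terms of
   [deterministic_risk_bound] in a single sum. *)
Let coef (j : 'I_p) : R := if (j < k)%N then s / nn else lam 0 j.
(** As [A1] is at least [c1 s], the weighted columns [coef_j A1^-1 Z_j] have squared norms summing
    to at most [W / c1^2]. *)
Let W t := \sum_j (coef j / s) ^+ 2 * dotcv (col j (Z t)) (col j (Z t)).

Let eta_r : R := Num.max (k%:R / nn) (nn / R_eff lam k).

(** The origin of [eta]: the head weights contribute [k / n] and the tail weights [n / R_k]. *)
Let sum_coef : nn * \sum_j (coef j / s) ^+ 2 <= 2 * eta_r.
Proof.
rewrite (bigID (fun j : 'I_p => (j < k)%N)) /=.
have -> : \sum_(j < p | (j < k)%N) (coef j / s) ^+ 2 = k%:R / nn ^+ 2.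
  rewrite (eq_bigr (fun=> nn ^- 2)) => [|j jk]; last first.
    by rewrite /coef jk; field; rewrite !gt_eqF.
  rewrite -(big_ord_widen _ (fun=> nn ^- 2) (ltnW kp)) sumr_const card_ord.
  by rewrite mulr_natl.
have -> : \sum_(j < p | ~~ (j < k)%N) (coef j / s) ^+ 2 = (R_eff lam k)^-1.
  rewrite /R_eff -/s invf_div mulr_suml; apply: eq_big => j; first by rewrite -leqNgt.
  by move=> /negbTE jk; rewrite /coef jk exprMn exprVn.
have -> : nn * (k%:R / nn ^+ 2 + (R_eff lam k)^-1) = k%:R / nn + nn / R_eff lam k.
  by rewrite mulrDr; congr (_ + _); field; rewrite gt_eqF.
have -> : 2 * eta_r = eta_r + eta_r by ring.
by apply: lerD; rewrite le_max lexx ?orbT.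
Qed.

Let eta0 : 0 < eta_r.
Proof.
rewrite lt_max; apply/orP; right; rewrite divr_gt0// /R_eff divr_gt0 ?exprn_gt0//.
rewrite (bigD1 (Ordinal kp))//= ltr_wpDr ?exprn_gt0 ?lam_gt0//.
by rewrite sumr_ge0// => j _; rewrite sqr_ge0.
Qed.

(** Thresholds for Markov's inequality: [kap] for the design quantity [W], [kap2] for the noise. *)
Variables (kap kap2 : R).
Hypotheses (kap0 : 0 < kap) (kap20 : 0 < kap2).

Let G4 := [set t | W t <= kap * eta_r].

Let mW : measurable_fun setT W.
Proof.
apply: measurable_sum => j; apply: measurable_funM => //.
have mc : mmx (fun t => col j (Z t)).
  by move=> a b; under eq_fun do rewrite mxE; exact: mmx_model_Z.
exact: measurable_dotcv.
Qed.

Let colZ j t : col j (Z t) = Bm j *m lm_z j t.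
Proof. by apply/colP => i; rewrite 2!mxE. Qed.

(** Markov's inequality for [W'], which dominates [W] through [B_j^T B_j <= 1 / eps] and has
    expectation [n sum_j (coef_j / s)^2 gauss_m2 / eps]. *)
Let PG4 : (P (~` G4) <= (2 * gauss_m2 / (eps * kap))%:E)%E.
Proof.
pose W' (t : lm_T M) := \sum_j \sum_i (coef j / s) ^+ 2 / eps * (lm_z j t i 0) ^+ 2.
have zN j i : normal_rv P (fun t => @lm_z _ _ _ M j t i 0) 0 1 := (lm_z_normal M j).1 i.
have WW' t : W t <= W' t.
  apply: ler_sum => j _; rewrite -mulr_sumr -mulrA ler_wpM2l ?sqr_ge0// -dotcvvE colZ.
  apply: mulmx_gram_le => [|v]; first by rewrite invr_ge0 ltW.
  by have /andP[] := BB j v.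
have W'0 t : 0 <= W' t.
  apply: le_trans (WW' t); apply: sumr_ge0 => j _.
  by rewrite mulr_ge0 ?sqr_ge0 ?dotcv_ge0.
have key j i : P.-integrable setT (fun t => ((coef j / s) ^+ 2 / eps * (lm_z j t i 0) ^+ 2)%:E) /\
   (\int[P]_t ((coef j / s) ^+ 2 / eps * (lm_z j t i 0) ^+ 2)%:E =
    ((coef j / s) ^+ 2 / eps * gauss_m2)%:E)%E.
  have iz := integrable_normal_rv_sqr (zN j i) ltr01.
  split; first by under eq_fun do rewrite EFinM; exact: (integrableZl measurableT _ iz).
  under eq_integral do rewrite EFinM.
  by rewrite (integralZl measurableT iz) (integral_normal_rv_sqr (zN j i)).
have key1 := fun j => @integral_fin_sum _ _ _ P _ _ _ (fun i => (key j i).1) (fun i => (key j i).2).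
have [iW' EW'] := @integral_fin_sum _ _ _ P _ _ _ (fun j => (key1 j).1) (fun j => (key1 j).2).
have mW' : measurable_fun setT W' by apply/measurable_EFinP; exact: measurable_int iW'.
have ke0 : 0 < kap * eta_r by rewrite mulr_gt0.
apply: (@le_trans _ _ (\int[P]_t ((kap * eta_r)^-1 * W' t)%:E)%E).
  apply: ge0_markov.
  - apply: measurableC; rewrite -[X in measurable X]setTI; exact: measurable_fun_le.
  - exact: measurable_funM.
  - by move=> t; rewrite mulr_ge0// invr_ge0 ltW.
  - move=> t /negP; rewrite -ltNge => h1; rewrite ler_pdivlMl// mulr1.
    by rewrite ltW// (lt_le_trans h1).
under eq_integral do rewrite EFinM.
rewrite (integralZl measurableT iW') EW' -EFinM lee_fin ler_pdivrMl//.
have -> : \sum_j \sum_(i < n) (coef j / s) ^+ 2 / eps * gauss_m2 =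
   (nn * \sum_j (coef j / s) ^+ 2) * (gauss_m2 / eps).
  rewrite mulr_sumr mulr_suml; apply: eq_bigr => j _.
  by rewrite sumr_const card_ord -[_ *+ n]mulr_natl -/nn; ring.
apply: (@le_trans _ _ (2 * eta_r * (gauss_m2 / eps))).
  by rewrite ler_wpM2r// divr_ge0 ?gauss_m2_ge0// ltW.
by rewrite [leRHS](_ : _ = 2 * eta_r * (gauss_m2 / eps))//; field; rewrite !gt_eqF.
Qed.

Let G := G1 `&` G2 `&` G3 `&` G4.

Let mZX : mmx (Z : sigma_type X -> 'M[R]_(n, p)) := mmx_model_Z_sigma Lu.

(** Measurability for the sigma-algebra of the design, so that multiplying by the indicator of [G]
    preserves independence from the noise. *)
Let mGX : measurable (G : set (sigma_type X)).
Proof.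
apply: measurableI; [apply: measurableI; [apply: measurableI|]|].
- apply: measurable_net_event; apply: mmx_mul; [exact: mmx_cst|exact: mmx_trmx].
- apply: measurable_net_event; apply: mmx_mul => //; exact: mmx_cst.
- rewrite -[X in measurable X]setTI; apply: measurable_fun_le => //.
  by apply: measurable_dotcv; apply: mmx_mul => //; exact: mmx_cst.
- rewrite -[X in measurable X]setTI; apply: measurable_fun_le => //.
  apply: measurable_sum => j; apply: measurable_funM => //.
  have mc : mmx ((fun t => col j (Z t)) : sigma_type X -> 'cV[R]_n).
    move=> a b.
    have -> : (fun t => col j (Z t) a b) = (fun t => Z t a j).
      by apply/funext => t; rewrite mxE.
    exact: mZX.
  exact: measurable_dotcv.
Qed.

Let mG : measurable G.
Proof. exact: (sigma_type_measurable (mmx_model_X Lu) mGX). Qed.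

Let PG : (P (~` G) <= ((3 * 2 ^+ K) ^+ n * (2 * E8r) + (3 * 2 ^+ K) ^+ k * (2 * E8n)
  + E8n + 2 * gauss_m2 / (eps * kap))%:E)%E.
Proof.
have mG1 : measurable G1 by exact: measurable_net_event.
have mG2 : measurable G2 by exact: measurable_net_event.
have mG3 : measurable G3.
  by rewrite -[X in measurable X]setTI; apply: measurable_fun_le.
have mG4 : measurable G4.
  by rewrite -[X in measurable X]setTI; apply: measurable_fun_le.
rewrite /G !setCI !EFinD.
apply: (le_trans (measureU2 _ _ _)); [|exact: measurableC|].
  by apply: measurableU; [apply: measurableU|]; exact: measurableC.
apply: leeD => //.
apply: (le_trans (measureU2 _ _ _)); [|exact: measurableC|].
  by apply: measurableU; exact: measurableC.
apply: leeD => //.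
by apply: (le_trans (measureU2 _ _ _)); [exact: measurableC|exact: measurableC|apply: leeD].
Qed.

Local Notation A1 t := (tail_gram k (Z t) lam).

Let A1E t v : sqnorm_mx (A1 t) v = dotcv (L1 t *m v) (L1 t *m v).
Proof.
rewrite sqnorm_mxE /tail_gram /L1 -!mulmxA dotcv_mulmxr.
set y := (Z t)^T *m v; rewrite dotcv_mulmxl tr_diag_mx mulmxA mulmx_diag.
congr (dotcv _ (diag_mx _ *m _)).
by apply/rowP => j; rewrite !mxE -expr2 sqr_sqrtr.
Qed.

Let A1_bounds t : G t -> forall v,
  c1 * s * dotcv v v <= sqnorm_mx (A1 t) v <= C1 * s * dotcv v v.
Proof.
move=> [[[g1 _] _] _] v; rewrite A1E.
have lo0 : 0 <= eps / 4 * s by rewrite !mulr_ge0 ?invr_ge0 ?ltW.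
have up0 : 0 <= 6 / eps * s by rewrite !mulr_ge0 ?invr_ge0 ?ltW.
have := net_event_bounds h0 h2 hK lo0 up0 (up_lo (ltW s0)) g1 v.
have -> : eps / 4 * s / 16 = c1 * s by rewrite /c1; field.
by rewrite mulrA.
Qed.

Let Zl_bound t : G t -> forall q : 'cV[R]_p,
  (forall j : 'I_p, (k <= j)%N -> q j 0 = 0) ->
  c1 * nn * dotcv q q <= dotcv (Z t *m q) (Z t *m q).
Proof.
move=> [[[_ g2] _] _] q q0.
have lo0 : 0 <= eps / 4 * nn by rewrite !mulr_ge0 ?invr_ge0 ?ltW.
have up0 : 0 <= 6 / eps * nn by rewrite !mulr_ge0 ?invr_ge0 ?ltW.
pose w : 'cV[R]_k := (pid_mx k)^T *m q.
have qw : q = pid_mx k *m w.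
  rewrite /w tr_pid_mx mulmxA mul_pid_mx minnn (minn_idPr _) ?leqnn//.
  apply/colP => i; rewrite mxE (bigD1 i)//= big1 ?addr0.
    rewrite mxE eqxx /=; case: ltnP => ki; first by rewrite mul1r.
    by rewrite mul0r q0.
  by move=> j ji; rewrite mxE eq_sym (negbTE (ji : (j != i :> nat))) mul0r.
have /andP[+ _] := net_event_bounds h0 h2 hK lo0 up0 (up_lo (ltW nn0)) g2 w.
rewrite /L2 -mulmxA -qw -pidK -qw.
by have -> : eps / 4 * nn / 16 = c1 * nn by rewrite /c1; field.
Qed.

Let l_le_sn j : l j <= s / nn. Proof. exact: le_trans (l_le j) lk_le. Qed.

Let c10 : 0 < c1. Proof. by rewrite divr_gt0. Qed.
Let C10 : 0 < C1. Proof. by rewrite mulr_gt0// divr_gt0. Qed.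

Let A1pd t : G t -> posdefmx (A1 t).
Proof.
move=> Gt; apply: (@posdef_tail_gram _ _ _ k (Z t) lam (lam_gt0 M) s c1) => //.
by move=> v; have /andP[] := A1_bounds Gt v.
Qed.

(** Up to congruence by [L], [X X^T] dominates the tail Gram matrix, because dropping the head
    eigenvalues only decreases the form. So [invmx] is a true inverse on [G]. *)
Let XXunit t : G t -> X t *m (X t)^T \in unitmx.
Proof.
move=> Gt; apply: posdef_unitmx; split; first by rewrite trmx_mul trmxK.
move=> v v0; rewrite sqnorm_mxE -mulmxA dotcv_mulmxr.
rewrite (model_XE Lu) !trmx_mul trmxK tr_diag_mx -!mulmxA.
set y := L^T *m v; have y0 : y != 0.
  apply: contraNneq v0 => /(congr1 (mulmx (invmx L)^T)).
  by rewrite /y mulmxA -trmx_mul mulmxV// trmx1 mul1mx mulmx0 => ->.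
rewrite dotcv_mulmxl (mulmxA U^T) UTU mul1mx.
apply: (lt_le_trans (proj2 (A1pd Gt) y y0)).
rewrite A1E /L1 -mulmxA; set b := (Z t)^T *m y.
rewrite !mul_diag_mx !dotcvvE; apply: ler_sum => j _; rewrite !mxE !exprMn.
rewrite ler_wpM2r ?sqr_ge0// !sqr_sqrtr ?(ltW (lam_gt0 M j))//.
by rewrite /tail_lam; case: ifP => // _; exact/ltW/lam_gt0.
Qed.

Let nu := opnorm (invmx Xi0 *m lm_Upsilon M).
Let f := model_f (M := M) L.
Let Sf := invmx L *m lm_Upsilon M *m (invmx L)^T.

Let Sf_le w : sqnorm_mx Sf w <= nu * dotcv w w.
Proof.
rewrite -LXi0 (le_trans _ (sqnorm_le_opnorm _ Xi0pd (lm_UpsilonP M)))//.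
by rewrite !sqnorm_mxE /Sf -!mulmxA (dotcv_mulmxr (invmx L)).
Qed.

Let nu0 : 0 < nu.
Proof.
have e1 : (const_mx 1 : 'cV[R]_n) != 0.
  by apply/eqP => /matrixP/(_ 0 0); rewrite !mxE => /eqP; rewrite oner_eq0.
have := sqnorm_le_opnorm (const_mx 1) Xi0pd (lm_UpsilonP M).
have := proj2 (lm_UpsilonP M) _ e1 => y0 /(lt_le_trans y0).
by rewrite pmulr_lgt0// (proj2 Xi0pd).
Qed.

(* The indicator of [G], which depends on the design only, keeps [hvec] bounded, so
   that independence of design and noise can be used. *)
Let hvec (j : 'I_p) t : 'cV[R]_n := (\1_G t * coef j) *: (invmx (A1 t) *m col j (Z t)).

Let mhvec j : mmx (hvec j : sigma_type X -> 'cV[R]_n).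
Proof.
move=> a b.
have -> : (fun t => hvec j t a b) =
    (fun t => \1_G t * coef j * (invmx (A1 t) *m col j (Z t)) a b).
  by apply/funext => t; rewrite [LHS]mxE.
apply: measurable_funM.
  by apply: measurable_funM => //; exact: measurable_indic.
apply: mmx_mul.
  apply: mmx_invmx; apply: mmx_mul; last exact: mmx_trmx.
  by apply: mmx_mul => //; exact: mmx_cst.
move=> c e.
have -> : (fun t => col j (Z t) c e) = (fun t => Z t c j).
  by apply/funext => t; rewrite mxE.
exact: mZX.
Qed.

Let csum := c1 ^- 2 * (kap * eta_r).
Let csum0 : 0 <= csum.
Proof. by rewrite mulr_ge0 ?invr_ge0 ?sqr_ge0// mulr_ge0// ltW. Qed.

(** With [x = A1^-1 y]: [c1 s |x|^2 <= <x, y> <= |x| |y|]. *)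
Let invA1_le t y : G t -> dotcv (invmx (A1 t) *m y) (invmx (A1 t) *m y) <=
  (c1 * s) ^- 2 * dotcv y y.
Proof.
move=> Gt; set x := invmx _ *m y.
have cs : 0 < c1 * s by rewrite mulr_gt0.
have yE : y = A1 t *m x by rewrite (mulKVmx (posdef_unitmx (A1pd Gt))).
have [->|x0] := eqVneq x 0.
  by rewrite dotcv0l mulr_ge0 ?dotcv_ge0// invr_ge0 sqr_ge0.
have xx : 0 < dotcv x x by rewrite dotcv_gt0.
have /andP[h1 _] := A1_bounds Gt x.
have h3 : sqnorm_mx (A1 t) x ^+ 2 <= dotcv x x * dotcv y y.
  by rewrite sqnorm_mxE -yE; exact: dotcv_CS.
rewrite ler_pdivlMl ?exprn_gt0// -(ler_pM2r xx) [leRHS]mulrC.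
apply: le_trans h3.
have -> : (c1 * s) ^+ 2 * dotcv x x * dotcv x x = (c1 * s * dotcv x x) ^+ 2 by ring.
have p1 : 0 <= c1 * s * dotcv x x := mulr_ge0 (ltW cs) (ltW xx).
by rewrite ler_pXn2r ?nnegrE// (le_trans p1).
Qed.

Let hvec_sum t : \sum_j dotcv (hvec j t) (hvec j t) <= csum.
Proof.
have [Gt|Gt] := pselect (G t); last first.
  rewrite big1// => j _; rewrite /hvec indicE memNset// mul0r scale0r.
  exact: dotcv0l.
have [_ g4] := Gt.
apply: (@le_trans _ _ (c1 ^- 2 * W t)); last first.
  by rewrite ler_wpM2l// invr_ge0 sqr_ge0.
rewrite mulr_sumr; apply: ler_sum => j _.
rewrite /hvec indicE mem_set// mul1r dotcvZl dotcvZr mulrA -expr2.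
apply: (le_trans (ler_wpM2l (sqr_ge0 _) (invA1_le _ Gt))).
rewrite [leLHS](_ : _ = c1 ^- 2 * ((coef j / s) ^+ 2 * dotcv (col j (Z t)) (col j (Z t))))//.
by field; rewrite !gt_eqF.
Qed.

Let NV t := \sum_j dotcv (hvec j t) (f t) ^+ 2.

Let NV_integral : (\int[P]_t (NV t)%:E <= (gauss_m2 * (nu * csum))%:E)%E.
Proof.
(* Each entry [y] of [hvec] has [y^2 <= csum], and [|y| <= 1 + y^2], whence [M = 1 + csum]. *)
apply: (noise_second_moment (M := 1 + csum) (mmx_model_X Lu) (@lm_E_indep _ _ _ M)
  (mmx_model_f_sigma (M:=M) L) (model_f_normal M L) mhvec).
- move=> j t a.
  have : (hvec j t a 0) ^+ 2 <= csum.
    apply: le_trans (hvec_sum t); rewrite (bigD1 j)//= ler_wpDr//.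
      by rewrite sumr_ge0// => i _; exact: dotcv_ge0.
    rewrite dotcvvE (bigD1 a)//= lerDl sumr_ge0// => i _; exact: sqr_ge0.
  rewrite -(real_normK (num_real (hvec j t a 0))).
  by have := sqr_ge0 (`|hvec j t a 0| - 1); move: `|hvec j t a 0| csum0 => y; nra.
- move=> t; apply: (@le_trans _ _ (nu * \sum_j dotcv (hvec j t) (hvec j t))).
    by rewrite mulr_sumr; apply: ler_sum => j _; exact: Sf_le.
  by rewrite ler_wpM2l// ltW.
Qed.

Let mNV : measurable_fun setT NV.
Proof.
apply: measurable_sum => j; apply: measurable_funX; apply: measurable_dotcv.
  move=> a b; apply: (sigma_type_measurable_fun (mmx_model_X Lu)); exact: mhvec.
exact: normal_vec_mmx (model_f_normal M L).
Qed.

Let Bad := [set t | kap2 * nu * eta_r <= NV t].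

Let PBad : (P Bad <= (gauss_m2 * kap / (c1 ^+ 2 * kap2))%:E)%E.
Proof.
have c0 : 0 < kap2 * nu * eta_r by rewrite !mulr_gt0.
have NV0 t : 0 <= NV t by rewrite sumr_ge0// => j _; exact: sqr_ge0.
apply: (@le_trans _ _ (\int[P]_t ((kap2 * nu * eta_r)^-1 * NV t)%:E)%E).
  apply: ge0_markov.
  - by rewrite -[X in measurable X]setTI; apply: measurable_fun_le.
  - exact: measurable_funM.
  - by move=> t; rewrite mulr_ge0// invr_ge0 ltW.
  - by move=> t; rewrite /Bad /= ler_pdivlMl// mulr1.
under eq_integral do rewrite EFinM.
rewrite ge0_integralZl_EFin ?invr_ge0 ?(ltW c0)//; last 2 first.
- by move=> t _; rewrite lee_fin.
- exact/measurable_EFinP.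
apply: (@le_trans _ _ (((kap2 * nu * eta_r)^-1)%:E * (gauss_m2 * (nu * csum))%:E)%E).
  by apply: lee_wpmul2l => //; rewrite lee_fin invr_ge0 ltW.
rewrite -EFinM lee_fin /csum.
rewrite [leLHS](_ : _ = gauss_m2 * kap / (c1 ^+ 2 * kap2))//.
by field; rewrite !gt_eqF.
Qed.

Let NV_E t : G t -> NV t = (s / nn) ^+ 2 * (\sum_(j < p | (j < k)%N)
    proj_noise k (Z t) lam (f t) j 0 ^+ 2)
  + \sum_j (l j * proj_noise k (Z t) lam (f t) j 0) ^+ 2.
Proof.
move=> Gt.
have dE j : dotcv (hvec j t) (f t) = coef j * proj_noise k (Z t) lam (f t) j 0.
  rewrite /hvec indicE mem_set// mul1r dotcvZl; congr (_ * _).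
  rewrite dotcv_mulmxl trmx_inv (proj1 (A1pd Gt)).
  rewrite dotcvE /proj_noise [RHS]mxE; apply: eq_bigr => i _.
  by rewrite !mxE.
rewrite /NV (bigID (fun j : 'I_p => (j < k)%N)) /=; congr (_ + _).
  rewrite mulr_sumr; apply: eq_bigr => j jk.
  by rewrite dE /coef jk exprMn.
rewrite [RHS](bigID (fun j : 'I_p => (j < k)%N)) /= [X in _ = X + _]big1 ?add0r.
  apply: eq_bigr => j jk; rewrite dE /coef (negbTE jk) /tail_lam leqNgt jk.
  by [].
by move=> j jk; rewrite /tail_lam leqNgt jk mul0r expr0n.
Qed.

Let a2 := \sum_(j < p | (j < k)%N) theta j 0 ^+ 2 / lam 0 j.
Let kapC := C1 / c1.
Let ca := 4 * kapC * (kapC + 6).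
Let cg := (2 * kapC + 18) / c1.
Definition risk_const : R := gauss_m2 * ((3 + cg * (6 / eps) + ca) * (1 + kap2)).

Let risk_le t : G t -> ~ Bad t ->
  gauss_m2 * (\sum_j lam 0 j * model_delta t j 0 ^+ 2) <=
  risk_const * (T2 + a2 * (s / nn) ^+ 2 + nu * eta_r).
Proof.
move=> Gt /negP; rewrite -ltNge => /ltW NVle.
have kapC0 : 0 < kapC by rewrite divr_gt0.
have ca0 : 0 < ca by apply: mulr_gt0; [exact: mulr_gt0|exact: addr_gt0].
have cg0 : 0 < cg by rewrite divr_gt0// addr_gt0// mulr_gt0.
have [[[_ _] g3] _] := Gt.
have := deterministic_risk_bound (lam_gt0 M) s0 c10 C10 c10 nn0
  (fun v => (andP (A1_bounds Gt v)).1) (fun v => (andP (A1_bounds Gt v)).2)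
  (Zl_bound Gt) l_le_sn (model_deltaE Lu t) (model_Zdelta Lu (XXunit Gt)).
rewrite -/f -/theta -/T2 -/a2 -/kapC -/ca -/cg.
have -> : tail_signal k (Z t) lam theta = Z t *m sq by [].
have := NV_E Gt.
set ph := \sum_(j < p | _) proj_noise _ _ _ _ j 0 ^+ 2.
set ps := \sum_j (l j * _) ^+ 2.
set risk := \sum_j _ => NVE dle.
have W0 : 0 <= (s / nn) ^+ 2 by exact: sqr_ge0.
have ph0 : 0 <= ph by apply: sumr_ge0 => j _; exact: sqr_ge0.
have ps0 : 0 <= ps by apply: sumr_ge0 => j _; exact: sqr_ge0.
have T20 : 0 <= T2 by apply: sumr_ge0 => j _; rewrite mulr_ge0 ?sqr_ge0.
have a20 : 0 <= a2 by apply: sumr_ge0 => j _; rewrite divr_ge0 ?sqr_ge0// ltW// lam_gt0.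
have ne0 : 0 <= nu * eta_r by rewrite mulr_ge0// ltW.
have gg : dotcv (Z t *m sq) (Z t *m sq) / nn <= 6 / eps * T2.
  by rewrite ler_pdivrMr// mulrAC.
have e60 : 0 < 6 / eps by rewrite divr_gt0.
set Dd := 3 + cg * (6 / eps) + ca.
rewrite /risk_const -/Dd -[leRHS]mulrA ler_wpM2l ?gauss_m2_ge0//.
have cge0 : 0 <= cg * (6 / eps) := ltW (mulr_gt0 cg0 e60).
have Dd0 : 0 <= Dd := addr_ge0 (addr_ge0 (ler0n _ 3) cge0) (ltW ca0).
apply: (@le_trans _ _ (Dd * (T2 + a2 * (s / nn) ^+ 2 + NV t))); last first.
  rewrite -mulrA ler_wpM2l//.
  apply: arith_split => //; [exact: mulr_ge0|exact: ltW|by rewrite mulrA].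
rewrite NVE; apply: arith_risk => //; [exact: mulr_ge0|exact: mulr_ge0|exact: ltW|].
apply: (le_trans dle); rewrite lerD2r lerD//.
  by rewrite lerD2l mulrDr [_ * a2]mulrC.
by rewrite -[leRHS]mulrA ler_wpM2l// ltW.
Qed.

Lemma finite_sample_bound C : risk_const <= C ->
  (P [set t | (C * ((sqnorm_mx (Sigma_tail U lam k) (lm_beta M)
        + sqnorm_mx (Sigma_head_pinv U lam k) (lm_beta M) * (s / nn) ^+ 2)
        + nu * eta_r))%:E < `|risk M (beta_hat t)|]
   <= ((3 * 2 ^+ K) ^+ n * (2 * E8r) + (3 * 2 ^+ K) ^+ k * (2 * E8n)
       + E8n + 2 * gauss_m2 / (eps * kap) + gauss_m2 * kap / (c1 ^+ 2 * kap2))%:E)%E.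
Proof.
move=> riskC.
have -> : sqnorm_mx (Sigma_tail U lam k) (lm_beta M) = T2.
  rewrite sqnorm_mx_sum_col [LHS]big_mkcond; apply: eq_bigr => j _.
  by rewrite /tail_lam; case: ifP => // _; rewrite mul0r.
have -> : sqnorm_mx (Sigma_head_pinv U lam k) (lm_beta M) = a2.
  by rewrite sqnorm_mx_sum_col; apply: eq_bigr => j _; rewrite mulrC.
have mB : measurable Bad.
  by rewrite -[X in measurable X]setTI; apply: measurable_fun_le.
apply: (@le_trans _ _ (P (~` G `|` Bad))); last first.
  rewrite EFinD; apply: (le_trans (measureU2 _ _ _)) => //; first exact: measurableC.
  exact: leeD.
have mrisk : measurable_fun setT (fun t : lm_T M => gauss_m2 *
    \sum_j lam 0 j * model_delta t j 0 ^+ 2).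
  apply: measurable_funM => //; apply: measurable_sum => j; apply: measurable_funM => //.
  apply: measurable_funX; apply: mmx_mul; first exact: mmx_cst.
  apply: mmx_add; first exact: mmx_cst.
  apply: mmx_opp; exact: (mmx_beta_hat Lu).
apply: le_measure; rewrite ?inE.
- under eq_set do rewrite abse_risk lte_fin.
  set c := C * _; set g := fun t : lm_T M => gauss_m2 * _ in mrisk.
  rewrite (_ : [set t | _] = ~` [set t | g t <= c]).
    by apply: measurableC; rewrite -[X in measurable X]setTI; apply: measurable_fun_le.
  by apply/seteqP; split=> t /=; rewrite ltNge => /negP.
- by apply: measurableU => //; exact: measurableC.
move=> t /=; rewrite abse_risk lte_fin => ht.
have [Gt|Gt] := pselect (G t); last by left.
have [Bt|Bt] := pselect (Bad t); first by right.
move: ht; rewrite ltNge (le_trans (risk_le Gt Bt))// ler_wpM2r//.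
have T20 : 0 <= T2 by apply: sumr_ge0 => j _; rewrite mulr_ge0 ?sqr_ge0.
have a20 : 0 <= a2 by apply: sumr_ge0 => j _; rewrite divr_ge0 ?sqr_ge0// ltW// lam_gt0.
apply: addr_ge0; last exact: mulr_ge0 (ltW nu0) (ltW eta0).
by apply: addr_ge0 => //; rewrite mulr_ge0 ?sqr_ge0.
Qed.

End Bound.

(** * Choice of constants and conclusion *)

Lemma expRN_le_inv (R : realType) (x : R) : 0 < x -> expR (- x) <= x^-1.
Proof.
move=> x0; rewrite expRN lef_pV2 ?posrE ?expR_gt0//.
by rewrite (le_trans _ (expR_ge1Dx x))// lerDr.
Qed.

(** Let [x = eps n / 16]. The first product is at most [2 exp (- x)] by the lower bound on [r], the
    second because [m ln G <= x] while its deviation exponent is [2 x]. Large [n] gives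
    [exp (- x) <= 1 / x <= delta / 10], and five such terms occur. *)
Lemma concentration_terms_le (R : realType) (eps G delta r k : R) n m : 0 < eps -> eps <= 1 ->
  1 < G -> 0 < delta -> (0 < n)%N ->
  8 * (ln G + 1) / eps * n%:R <= r -> k = m%:R -> k / n%:R < eps / (16 * ln G) ->
  160 / (eps * delta) <= n%:R ->
  G ^+ n * (2 * expR (- (eps * r / 8))) + G ^+ m * (2 * expR (- (eps * n%:R / 8)))
  + expR (- (eps * n%:R / 8)) <= delta / 2.
Proof.
move=> eps0 eps1 G1 d0 n0 rn -> kn nbig.
have G0 : 0 < G by lra.
have nn0 : 0 < n%:R :> R by rewrite ltr0n.
have lG : 0 < ln G by rewrite ln_gt0.
have GE i : G ^+ i = expR (ln G * i%:R) by rewrite expRM_natr lnK ?posrE.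
pose x := eps * n%:R / 16.
have x0 : 0 < x by rewrite divr_gt0// mulr_gt0.
have t1 : G ^+ n * (2 * expR (- (eps * r / 8))) <= 2 * expR (- x).
  rewrite mulrCA ler_wpM2l// GE -expRD ler_expR.
  have : (ln G + 1) * n%:R <= eps * r / 8.
    have -> : (ln G + 1) * n%:R = eps / 8 * (8 * (ln G + 1) / eps * n%:R).
      by field; rewrite gt_eqF.
    by rewrite [leRHS]mulrAC ler_wpM2l// divr_ge0// ltW.
  have : x <= n%:R.
    have h : eps * n%:R <= n%:R by rewrite ler_piMl// ltW.
    rewrite /x; lra.
  rewrite mulrDl mul1r; set a := ln G * _; lra.
have t2 : G ^+ m * (2 * expR (- (eps * n%:R / 8))) <= 2 * expR (- x).
  rewrite mulrCA ler_wpM2l// GE -expRD ler_expR.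
  have : ln G * m%:R <= x.
    rewrite ltr_pdivrMr// in kn; have := ltW kn.
    have -> : eps / (16 * ln G) * n%:R = x / ln G by rewrite /x; field; rewrite gt_eqF.
    by rewrite ler_pdivlMr// mulrC.
  have -> : eps * n%:R / 8 = 2 * x by rewrite /x; field.
  set a := ln G * _; lra.
have t3 : expR (- (eps * n%:R / 8)) <= expR (- x).
  have -> : eps * n%:R / 8 = 2 * x by rewrite /x; field.
  by rewrite ler_expR; move: x0; lra.
have t4 : expR (- x) <= delta / 10.
  apply: (le_trans (expRN_le_inv x0)).
  have : 10 / delta <= x.
    have -> : 10 / delta = eps / 16 * (160 / (eps * delta)) by field; rewrite !gt_eqF.
    by rewrite /x [leRHS]mulrAC ler_wpM2l// divr_ge0// ltW.
  move=> h; have -> : delta / 10 = (10 / delta)^-1 by rewrite invf_div.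
  have p1 : 0 < 10 / delta by rewrite divr_gt0 ?ltr0n.
  by rewrite lef_pV2 ?posrE.
apply: (le_trans (lerD (lerD t1 t2) t3)); move: t4; lra.
Qed.

Lemma sample_size_bound (R : realType) (eps b delta kap kap2 : R) (K n p : nat)
    (M : linear_model R n p) (Xi0 : 'M[R]_n) C :
  0 < eps -> eps <= 1 -> (1 + (eps / 60)^-1) ^+ 2 <= K%:R ->
  1 <= b -> 8 * (ln (3 * 2 ^+ K) + 1) / eps <= b ->
  0 < delta -> 0 < kap -> 0 < kap2 ->
  2 * gauss_m2 / (eps * kap) <= delta / 4 ->
  gauss_m2 * kap / ((eps / 64) ^+ 2 * kap2) <= delta / 4 ->
  risk_const eps kap2 <= C -> (0 < n)%N -> 160 / (eps * delta) <= n%:R ->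
  coherent eps Xi0 (@lm_Xi _ _ _ M) ->
  eta n b (lm_lam M) \is a fin_num ->
  fine (eta n b (lm_lam M)) < eps / (16 * ln (3 * 2 ^+ K)) ->
  (lm_P M [set t | C%:E * (tau n b (lm_U M) (lm_lam M) (lm_beta M)
      + (opnorm (invmx Xi0 *m lm_Upsilon M))%:E * eta n b (lm_lam M))
      < `|risk M (beta_hat t)|] <= delta%:E)%E.
Proof.
case: n M Xi0 => // n M Xi0 eps0 eps1 hK b1 bK d0 kap0 kap20 t4 t5 hC _ nbig coh.
(* An infinite [k^*] would make [eta] infinite, which the finiteness hypothesis excludes. *)
rewrite /eta /tau; case E : (kstar _ _ _) => [k|] // _; rewrite /= gt_max => /andP[kn _].
have [kp rk] : (k < p)%N /\ b * n.+1%:R <= r_eff (lm_lam M) k.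
  move: E; rewrite /kstar; case F : [seq _ <- _ | _] => [//|k' s'] [kk'].
  have : k \in [seq k <- iota 0 p | b * n.+1%:R <= r_eff (lm_lam M) k].
    by rewrite F kk' mem_head.
  by rewrite mem_filter mem_iota add0n => /andP[-> /=].
have nn0 : 0 < n.+1%:R :> R by rewrite ltr0n.
have rn : n.+1%:R <= r_eff (lm_lam M) k by rewrite (le_trans _ rk)// ler_peMl// ltW.
have [L Lu LL] := cholesky (proj1 coh).
rewrite -!EFinM.
apply: (le_trans (finite_sample_bound eps0 eps1 hK coh Lu LL kp rn kap0 kap20 hC)).
rewrite lee_fin.
have G1 : 1 < 3 * 2 ^+ K :> R.
  have : 1 <= 2 ^+ K :> R by rewrite exprn_ege1// ler1n.
  lra.
have rk' : 8 * (ln (3 * 2 ^+ K) + 1) / eps * n.+1%:R <= r_eff (lm_lam M) k.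
  by rewrite (le_trans _ rk)// ler_wpM2r// ltW.
have := concentration_terms_le eps0 eps1 G1 d0 (ltn0Sn n) rk' erefl kn nbig.
by move: t4 t5; lra.
Qed.

Theorem proposition4 (R : realType) (eps : R) :
  0 < eps -> eps <= 1 ->
  exists b : R, 1 <= b /\
  forall (p : nat -> nat) (M : forall n, linear_model R n (p n))
    (Xi0 : forall n, 'M[R]_n),
  (forall n, (0 < n)%N -> 0 < eigv (lm_lam (M n)) n) ->
  (forall n, (0 < n)%N -> coherent eps (Xi0 n) (@lm_Xi _ _ _ (M n))) ->
  benign b (fun n => lm_U (M n)) (fun n => lm_lam (M n)) ->
  (fun n => l2norm (lm_beta (M n)) : R^o) =O_\oo (fun=> 1 : R^o) ->
  bigO_P (fun n => lm_P (M n)) (fun n t => risk (M n) (beta_hat t))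
    (fun n => (tau n b (lm_U (M n)) (lm_lam (M n)) (lm_beta (M n))
               + (opnorm (invmx (Xi0 n) *m lm_Upsilon (M n)))%:E
                 * eta n b (lm_lam (M n)))%E).
Proof.
move=> eps0 eps1.
pose K := Num.bound ((1 + (eps / 60)^-1) ^+ 2).
have hK : (1 + (eps / 60)^-1) ^+ 2 <= K%:R.
  by rewrite ltW// archi_boundP// sqr_ge0.
pose G : R := 3 * 2 ^+ K.
have lG : 0 < ln G.
  apply: ln_gt0; have : 1 <= 2 ^+ K :> R by rewrite exprn_ege1// ler1n.
  by rewrite /G; lra.
exists (Num.max 1 (8 * (ln G + 1) / eps)); set b := Num.max _ _.
have b1 : 1 <= b by rewrite le_max lexx.
have bK : 8 * (ln G + 1) / eps <= b by rewrite le_max lexx orbT.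
split=> // p M Xi0 _ coh ben _ delta d0.
have m2 := @gauss_m2_ge0 R.
(* [kap] and [kap2] make each Markov bound at most [delta / 4]; the added 1 gives positivity from
   [gauss_m2 >= 0] alone. *)
pose kap := 8 * gauss_m2 / (eps * delta) + 1.
have ed : 0 < eps * delta by rewrite mulr_gt0.
have kap0 : 0 < kap by rewrite ltr_wpDl// divr_ge0 ?(ltW ed)// mulr_ge0.
pose c1 := eps / 64; have c10 : 0 < c1 by rewrite divr_gt0.
pose kap2 := 4 * gauss_m2 * kap / (c1 ^+ 2 * delta) + 1.
have cd : 0 < c1 ^+ 2 * delta by rewrite mulr_gt0 ?exprn_gt0.
have kap20 : 0 < kap2.
  by rewrite ltr_wpDl// divr_ge0 ?(ltW cd)// mulr_ge0 ?(ltW kap0)// mulr_ge0.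
have t4 : 2 * gauss_m2 / (eps * kap) <= delta / 4.
  rewrite ler_pdivrMr ?mulr_gt0//.
  have : 8 * gauss_m2 / (eps * delta) <= kap by rewrite lerDl.
  rewrite ler_pdivrMr// => h.
  have -> : delta / 4 * (eps * kap) = kap * (eps * delta) / 4 by field.
  lra.
have t5 : gauss_m2 * kap / (c1 ^+ 2 * kap2) <= delta / 4.
  rewrite ler_pdivrMr ?mulr_gt0 ?exprn_gt0//.
  have : 4 * gauss_m2 * kap / (c1 ^+ 2 * delta) <= kap2 by rewrite lerDl.
  rewrite ler_pdivrMr// => h.
  have -> : delta / 4 * (c1 ^+ 2 * kap2) = kap2 * (c1 ^+ 2 * delta) / 4 by field.
  lra.
pose C := Num.max 1 (risk_const eps kap2).
exists C; split; first by rewrite lt_max ltr01.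
have hC : risk_const eps kap2 <= C by rewrite le_max lexx orbT.
(* [eta] is independent of the signal, so the zero sequence already yields its convergence to 0. *)
have [|_ /fine_cvgP[efin ecvg]] := ben (fun=> 0).
  by exists 0 => n; rewrite l2normE dotcv0l sqrtr0.
have cG : 0 < eps / (16 * ln G) by rewrite divr_gt0// mulr_gt0.
near=> n.
apply: (sample_size_bound (eps := eps) (K := K) (kap := kap) (kap2 := kap2)) => //.
- by near: n; exact: nbhs_infty_gt.
- by near: n; exact: nbhs_infty_ger.
- by apply: coh; near: n; exact: nbhs_infty_gt.
- by near: n.
- by near: n; exact: (cvgr_lt 0).
Unshelve. all: by end_near. Qed.
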